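(* Let $U\subset\mathbb R^m$ be a non-empty compact set and let $f:\mathbb R^n\times U\to\mathbb R^n$ be smooth, with $\dot x=f(x,u)$ forward complete. Assume there exist a non-empty compact set $S\subset\mathbb R^n$, a continuous function $T:\mathbb R^n\to\mathbb R_+$ and a smooth function $\psi:\mathbb R^n\to(0,+\infty)$ such that for every $u\in L^\infty(\mathbb R_+;U)$ and every $x(0)\in\mathbb R^n$ the solution of $\dot x=f(x,u)$ satisfies $x(t)\in S$ for all $t\ge T(x(0))$ and $|x(t)|\le\psi(x(0))$ for all $t\ge0$. Let $\sigma,r>0$ be constants and let $q:\mathbb R\to\mathbb R_+$ be a continuously differentiable function with $q(s)=1$ for $s\le1$ and $sq(s)\le K$ for $s\ge1$, where $K\ge1$ is a constant. Define $$p(s):=\max\{|f(\xi,u)|:\ u\in U,\ |\xi|\le K\max\{\psi(z):|z|\le s\}\},\qquad a:=\max\{|z|:z\in S\},$$ $$\tilde S:=\{\xi\in\mathbb R^n:\ |\xi|\le1+a+r\,p(a)\}.$$ Let $G_1,G_2>0$ be constants satisfying $$\left|f\left(q\left(\tfrac{|\xi|}{\psi(z)}\right)\xi,u\right)-f\left(q\left(\tfrac{|x|}{\psi(y)}\right)x,u\right)\right|\le G_1|\xi-x|+G_2|z-y|\quad\text{for all }u\in U,\ y,x,z\in S,\ \xi\in\tilde S.$$ Then for every constant $\mu\ge\sigma$ and every $\delta\in[0,r]$ with $G_1\dfrac{\exp(\sigma\delta)-1}{\sigma}<1$, there exists a non-decreasing function $M:\mathbb R_+\to\mathbb R_+$ such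 that for every $u\in L^\infty_{loc}([-r,+\infty);U)$, every absolutely continuous mapping $z:\mathbb R_+\to\mathbb R^n$ with $\dot z\in L^\infty_{loc}(\mathbb R_+;\mathbb R^n)$, $|z(t)|\le\psi(z(s))$ for all $0\le s\le t$ and $z(t)\in S$ for all $t\ge T(z(0))$, and every $x_0,\xi_0\in C^0([-r,0];\mathbb R^n)$, the unique solution of $\dot x(t)=f(x(t),u(t))$ together with $$\dot\xi(t)=\dot z(t)+\frac{d}{dt}\int_{t-\delta}^t f\left(q\left(\tfrac{|\xi(s)|}{\psi(z(t))}\right)\xi(s),u(s-r+\delta)\right)ds-\mu\left(\xi(t)-z(t)-\int_{t-\delta}^t f\left(q\left(\tfrac{|\xi(s)|}{\psi(z(t))}\right)\xi(s),u(s-r+\delta)\right)ds\right)$$ with initial condition $x(\theta)=x_0(\theta)$, $\xi(\theta)=\xi_0(\theta)$ for $\theta\in[-r,0]$, exists for all $t\ge0$ and satisfies, for all $t\ge0$, $$|\xi(t)-x(t-r+\delta)|\le\exp(-\sigma t)M\left(\|x_0\|+|z(0)|+\|\xi_0\|\right)+\beta\sup_{0\le s\le t}\left(\exp(-\sigma(t-s))|z(s)-x(s-r)|\right),$$ where $\beta:=\dfrac{\sigma+G_2(\exp(\sigma\delta)-1)}{\sigma-G_1(\exp(\sigma\delta)-1)}$.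
   Context: $\mathbb R_+=[0,+\infty)$; $|\cdot|$ is the Euclidean norm; $\|\cdot\|$ is the sup norm on $C^0([-r,0];\mathbb R^n)$. $L^\infty(I;U)$ (resp. $L^\infty_{loc}(I;U)$) is the space of Lebesgue measurable, essentially bounded (resp. locally essentially bounded) functions $I\to U$. ''Absolutely continuous'' means absolutely continuous on every bounded interval of $\mathbb R_+$. Forward complete means that for every initial condition and every $u\in L^\infty_{loc}(\mathbb R_+;U)$ the solution exists for all $t\ge0$. Differential equations hold for almost every $t\ge0$; on $[-r,0]$ the functions $x,\xi$ equal the prescribed initial functions (the initial function $x_0$ need not satisfy the differential equation). *)

(* Defs.v *)
From HB Require Import structures.
From mathcomp Require Import all_boot all_order all_algebra.
From mathcomp Require Import all_classical all_reals all_analysis.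

Set Implicit Arguments.
Unset Strict Implicit.
Unset Printing Implicit Defensive.

Import Order.TTheory GRing.Theory Num.Theory.
Import numFieldNormedType.Exports.

Local Open Scope classical_set_scope.
Local Open Scope ring_scope.

Section Norms.
Context {R : realType}.

(* The norm `|v| that the library puts on 'rV[R]_n is the maximum norm. *)
Definition enorm (n : nat) (v : 'rV[R]_n) : R :=
  Num.sqrt (\sum_(i < n) v ord0 i ^+ 2).

Definition supnorm (n : nat) (r : R) (x0 : R -> 'rV[R]_n) : R :=
  sup [set enorm (x0 s) | s in `[- r, 0]].

End Norms.

Section Smoothness.
Context {R : realType} {V W : normedModType R}.

(* V is meant to be finite-dimensional: there g is C^(k+1) on the open set O
   iff it is Frechet differentiable on O and its derivatives along all fixed
   directions are C^k on O. *)
Fixpoint Ck_on (k : nat) (O : set V) (g : V -> W) : Prop :=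
  match k with
  | 0%N => forall a, O a -> {for a, continuous g}
  | k'.+1 => (forall a, O a -> differentiable g a) /\
             (forall v, Ck_on k' O (fun a => 'D_v g a))
  end.

(* The set A need not be open (in the theorem, A = R^n x U with U compact). *)
Definition smooth_on (A : set V) (f : V -> W) : Prop :=
  exists (O : set V) (g : V -> W),
    [/\ open O, A `<=` O, {in A, f =1 g} & forall k, Ck_on k O g].

End Smoothness.

(* The completed measure lives on the Lebesgue (not only Borel) measurable
   sets: its domain [lebesgueType R] is R with that sigma-algebra. *)
Notation leb := completed_lebesgue_measure.
Notation lebesgueType R :=
  (caratheodory_type (mu_ext (@wlength R idfun))).

Section Lebesgue.
Context {R : realType}.

Definition leb_measurable (n : nat) (I : set R) (f : R -> 'rV[R]_n) : Prop :=
  forall i : 'I_n,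
    measurable_fun (I : set (lebesgueType R)) (fun t : lebesgueType R => f t ord0 i).

Definition ess_bounded (n : nat) (I : set R) (f : R -> 'rV[R]_n) : Prop :=
  exists B : R, {ae leb, forall t, I t -> enorm (f t) <= B}.

Definition Linfty (n : nat) (I : set R) (U : set 'rV[R]_n)
    (f : R -> 'rV[R]_n) : Prop :=
  [/\ forall t, I t -> U (f t), leb_measurable I f & ess_bounded I f].

Definition Linfty_loc (n : nat) (I : set R) (U : set 'rV[R]_n)
    (f : R -> 'rV[R]_n) : Prop :=
  [/\ forall t, I t -> U (f t), leb_measurable I f &
      forall a b : R, ess_bounded (I `&` `[a, b]) f].

Definition abs_continuous (n : nat) (a b : R) (x : R -> 'rV[R]_n) : Prop :=
  forall e : R, 0 < e -> exists2 d : R, 0 < d &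
    forall (k : nat) (lo hi : 'I_k -> R),
      (forall i, [/\ a <= lo i, lo i <= hi i & hi i <= b]) ->
      (forall i j, i != j -> `]lo i, hi i[ `&` `]lo j, hi j[ = set0) ->
      \sum_(i < k) (hi i - lo i) < d ->
      \sum_(i < k) enorm (x (hi i) - x (lo i)) < e.

End Lebesgue.

Section ODE.
Context {R : realType} {n m : nat}.
Implicit Types (f : 'rV[R]_n -> 'rV[R]_m -> 'rV[R]_n) (u : R -> 'rV[R]_m).

(* x is a (Caratheodory) solution of x' = f(x,u) on [0,T), where T may be +oo *)
Definition ode_solution f u (T : \bar R) (x : R -> 'rV[R]_n) : Prop :=
  (forall b : R, (b%:E < T)%E -> abs_continuous 0 b x) /\
  {ae leb, forall t : R, 0 <= t -> (t%:E < T)%E ->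
    is_derive t 1 x (f (x t) (u t))}.

Definition forward_complete (U : set 'rV[R]_m) f : Prop :=
  forall (u : R -> 'rV[R]_m) (xi : 'rV[R]_n), Linfty_loc `[0, +oo[ U u ->
    exists2 x : R -> 'rV[R]_n, x 0 = xi & ode_solution f u +oo%E x.

End ODE.

Section Predictor.
Context {R : realType} {n m : nat}.
Variables (f : 'rV[R]_n -> 'rV[R]_m -> 'rV[R]_n) (U : set 'rV[R]_m).
Variables (S : set 'rV[R]_n) (psi : 'rV[R]_n -> R) (q : R -> R) (K r : R).

(* For compact U and S and continuous f and psi, the suprema below are
   maxima (over non-empty sets as soon as U and S are non-empty and s >= 0). *)
Definition pmax (s : R) : R :=
  sup [set enorm (f w.1 w.2) | w in
        [set w : 'rV[R]_n * 'rV[R]_m |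
          U w.2 /\
          enorm w.1 <= K * sup [set psi z | z in [set z | enorm z <= s]]]].

Definition set_radius : R := sup [set enorm z | z in S].

Definition S_tilde : set 'rV[R]_n :=
  [set xi | enorm xi <= 1 + set_radius + r * pmax set_radius].

Definition saturate (z xi : 'rV[R]_n) : 'rV[R]_n :=
  q (enorm xi / psi z) *: xi.

Variables (delta mu : R) (u : R -> 'rV[R]_m) (z : R -> 'rV[R]_n).

Definition pred_int (xi : R -> 'rV[R]_n) (t : R) : 'rV[R]_n :=
  \row_(i < n) Rintegral leb (`[t - delta, t] : set R)
    (fun s => f (saturate (z t) (xi s)) (u (s - r + delta)) ord0 i).

(* (x, xi) solves the plant and the predictor on [-r,T), where T may be +oo *)
Definition delay_solution (x0 xi0 : R -> 'rV[R]_n) (T : \bar R)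
    (x xi : R -> 'rV[R]_n) : Prop :=
  [/\ {in `[- r, 0], x =1 x0} /\ {in `[- r, 0], xi =1 xi0},
      ode_solution f u T x,
      forall b : R, (b%:E < T)%E -> abs_continuous 0 b xi &
      {ae leb, forall t : R, 0 <= t -> (t%:E < T)%E ->
        [/\ derivable z t 1, derivable (pred_int xi) t 1 &
            is_derive t 1 xi
              ('D_1 z t + 'D_1 (pred_int xi) t
               - mu *: (xi t - z t - pred_int xi t))]}].

End Predictor.

(* Main.v *)
Require Import Defs.
From mathcomp Require Import all_boot all_order all_algebra.
From mathcomp Require Import all_classical all_reals all_analysis.
From mathcomp Require Import measurable_realfun.
From mathcomp Require Import ring lra.

(* With P(xi)(t) the integral of f(q(|xi(s)|/psi(z(t))) xi(s), u(s - r + delta))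
   over [t - delta, t], the defect e = xi - z - P(xi) is absolutely continuous and
   satisfies e' = - mu e almost everywhere, so xi solves the predictor equation
   iff xi(t) = z(t) + exp(- mu t) e(0) + P(xi)(t) for t >= 0.  On [0, b] this
   fixed point equation is a contraction in the norm sup_t exp(- l t) |xi(t)| for
   l large, and differentiability almost everywhere of P(xi) is obtained directly
   from that of z.  For the estimate, x(t - r + delta) is x(t - r) plus the
   integral of f(x, u) over the prediction window; once z and x have entered S
   and |e| <= 1, comparing the two integrals by the G1-G2 Lipschitz bound gives a
   small-gain inequality for xi(t) - x(t - r + delta) in the norm
   sup_t exp(sigma t) |.|. *)

Set Implicit Arguments.
Unset Strict Implicit.
Unset Printing Implicit Defensive.

Import Order.TTheory GRing.Theory Num.Theory.
Import numFieldNormedType.Exports.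

Local Open Scope classical_set_scope.
Local Open Scope ring_scope.

(** * Lebesgue measurability and integration *)

(** Inputs are only Lebesgue measurable, so integrals use the completed measure, and Borel results
    apply after discarding null sets. Differentiating [P(xi)] is the delicate point: for each frozen
    value of [z(t)] the moving endpoint costs a null set that depends on this value; integrating
    along the diagonal [z(s + c)] leaves a single one.

    The saturation bounds the integrand whatever [xi] is, hence a global solution and bounds
    depending on the data only. It leaves the plant untouched: for [s] in the window, |x(s - r +
    delta)| <= psi(x(t - r)) by time invariance, a shifted input being again admissible.

    The constants come from the window. The defect is at most [1] after the time [E / mu], because
    exp(mu t) >= mu t; this is the [1] in the radius of [S_tilde]. The condition [sigma <= mu] makes
    the defect decay fast enough. The integral of exp(- sigma s) over [[t - delta, t]] is exp(-
    sigma t) (exp(sigma delta) - 1) / sigma; its product with G1 is the small-gain number [c].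
    Finally exp(sigma delta) >= 1 + sigma delta bounds (1 + G2 delta) / (1 - c) by [beta]. *)

Section LebesgueMeasurable.
Context {R : realType}.
Local Notation mu := (@lebesgue_measure R).
Local Notation L := (lebesgueType R).
Local Notation lebR := (@completed_lebesgue_measure R).

Lemma leb_negligibleP (N : set R) : lebR.-negligible N <-> mu.-negligible N.
Proof.
split=> [[A [mA A0 NA]]|[A [mA A0 NA]]].
  apply/negligible_outer_measure/eqP.
  by rewrite eq_le outer_measure_ge0 andbT -A0; exact: le_outer_measure.
by exists A; split => //; exact: sub_caratheodory.
Qed.

(** This decomposition is how translation invariance and the reduction to Borel functions are
    obtained for Lebesgue sets. *)
Lemma leb_measurableP (A : set R) : measurable (A : set L) <->
  exists B N, [/\ measurable (B : set (measurableTypeR R)),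
    mu.-negligible N & A = B `|` N].
Proof.
have := @completed_caratheodory_measurable R.
rewrite g_sigma_completed_algebra_genE => E.
split => [mA|[B [N [mB nN ->]]]].
  have : completed_algebra_gen mu A by rewrite E.
  by move=> [B mB [N nN <-]]; exists B, N.
suff : completed_algebra_gen mu (B `|` N) by rewrite E.
by exists B => //; exists N.
Qed.

Lemma borel_leb_measurable (A : set R) :
  measurable (A : set (measurableTypeR R)) -> measurable (A : set L).
Proof. exact: sub_caratheodory. Qed.

(** The pushforward of the measure by a translation gives half-open intervals their length, and this
    determines Lebesgue measure. Translations are needed because the predictor reads [u] and [x] at
    shifted times. *)
Lemma leb_measure_translate (c : R) (A : set R) :
  measurable (A : set (measurableTypeR R)) ->
  mu ((fun x => x + c) @^-1` A) = mu A.
Proof.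
move=> mA; have mc : measurable_fun setT
    ((fun x => x + c) : measurableTypeR R -> measurableTypeR R).
  by apply: measurable_funD => //; exact: measurable_cst.
apply/esym/(@lebesgue_measure_unique R
  (measure_function_pushforward__canonical__measure_function_Measure mu mc)) => // X.
move=> /ocitvP oX; change (mu X = mu ((fun x => x + c) @^-1` X)).
case: oX => [->|[[a b]/= ab ->]].
  by rewrite preimage_set0 !measure0.
rewrite (_ : _ @^-1` _ = `]a - c, b - c]%classic); last first.
  by apply/seteqP; split => x/=; rewrite !in_itv/=; lra.
rewrite !lebesgue_measure_itv/= !lte_fin ltrD2r; case: ifPn => // _.
by rewrite -!EFinB; congr (_%:E); lra.
Qed.

Lemma negligible_translate (c : R) (N : set R) :
  mu.-negligible N -> mu.-negligible ((fun x => x + c) @^-1` N).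
Proof.
have mc : measurable_fun setT
    ((fun x => x + c) : measurableTypeR R -> measurableTypeR R).
  by apply: measurable_funD => //; exact: measurable_cst.
move=> [A [mA A0 NA]]; exists ((fun x => x + c) @^-1` A); split.
- by rewrite -[X in measurable X]setTI; exact: mc.
- by rewrite leb_measure_translate.
- by move=> x /=; exact: NA.
Qed.

Lemma ae_leb_translate (c : R) (P : R -> Prop) :
  {ae lebR, forall t, P t} -> {ae lebR, forall t, P (t + c)}.
Proof.
by move=> /leb_negligibleP/(negligible_translate c) h; exact/leb_negligibleP.
Qed.

Lemma leb_measurable_set_translate (c : R) (A : set R) :
  measurable (A : set L) -> measurable (((fun x => x + c) @^-1` A) : set L).
Proof.
have mc : measurable_fun setT
    ((fun x => x + c) : measurableTypeR R -> measurableTypeR R).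
  by apply: measurable_funD => //; exact: measurable_cst.
move=> /leb_measurableP[B [N [mB nN ->]]].
apply/leb_measurableP; exists ((fun x => x + c) @^-1` B).
exists ((fun x => x + c) @^-1` N); split => //.
  by rewrite -[X in measurable X]setTI; exact: mc.
exact: negligible_translate.
Qed.

Lemma leb_measurable_translate (c : R) (D : set R) (g : R -> R) :
  measurable_fun (D : set L) g ->
  measurable_fun (((fun x => x + c) @^-1` D) : set L) (fun x : L => g (x + c)).
Proof.
move=> mg mD' Y mY.
have mD : measurable (D : set L).
  have := leb_measurable_set_translate (- c) mD'.
  rewrite (_ : _ @^-1` _ = D)//; apply/seteqP; split => x /=;
  by rewrite addrNK.
exact: (leb_measurable_set_translate c (mg mD Y mY)).
Qed.

Lemma leb_measurable_itv (i : interval R) : measurable ([set` i] : set L).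
Proof. by apply: borel_leb_measurable; exact: measurable_itv. Qed.

Lemma measurable_id_leb :
  measurable_fun setT (id : L -> measurableTypeR R).
Proof. by move=> _ Y mY; rewrite setTI; exact: borel_leb_measurable. Qed.

Lemma leb_measurable_of_borel (D : set R) (g : R -> R) :
  measurable (D : set (measurableTypeR R)) ->
  measurable_fun (D : set (measurableTypeR R)) g -> measurable_fun (D : set L) g.
Proof. by move=> mD mg _ Y mY; apply: borel_leb_measurable; exact: mg. Qed.

Lemma leb_measurable_continuous (i : interval R) (g : R -> R) :
  {within [set` i], continuous g} -> measurable_fun ([set` i] : set L) g.
Proof.
move=> cg; apply: leb_measurable_of_borel; first exact: measurable_itv.
by apply: subspace_continuous_measurable_fun => //; exact: measurable_itv.
Qed.

(** For each rational [q] the set {g > q} is Borel up to a null set; [N] collects these countably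
    many null sets. Off [N], the set {g > x} is the union over rationals [q > x] of the Borel
    parts. *)
Lemma leb_measurable_borel (D : set R) (g : R -> R) :
  measurable (D : set (measurableTypeR R)) -> measurable_fun (D : set L) g ->
  exists N : set R, [/\ measurable (N : set (measurableTypeR R)), mu N = 0%E &
    measurable_fun ((D `\` N) : set (measurableTypeR R)) g].
Proof.
move=> mD mg.
have /choice[BN BNP] (q : rat) : exists BN : set R * set R,
    [/\ measurable (BN.1 : set (measurableTypeR R)),
        measurable (BN.2 : set (measurableTypeR R)), mu BN.2 = 0%E,
        BN.1 `<=` D `&` g @^-1` `]ratr q, +oo[ &
        D `&` g @^-1` `]ratr q, +oo[ `<=` BN.1 `|` BN.2].
  have : measurable ((D `&` g @^-1` `]ratr q, +oo[%classic) : set L).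
    by apply: mg; [exact: borel_leb_measurable|exact: measurable_itv].
  move=> /leb_measurableP[B [N [mB [N' [mN' N'0 NN']]] E]].
  exists (B, N'); split => //=; rewrite E; first by move=> x; left.
  by apply: setUS.
pose N := \bigcup_q (BN q).2.
have mN : measurable (N : set (measurableTypeR R)).
  by apply: bigcupT_measurable_rat => q; have [] := BNP q.
exists N; split => //.
  apply: measure_negligible => //.
  pose NN (o : option rat) : set R := if o is Some q then (BN q).2 else set0.
  have -> : N = \bigcup_n NN (unpickle n).
    apply/seteqP; split => [x [q _ qx]|x [n _]].
      exists (pickle q).
        exact: Logic.I.
      rewrite pickleK. exact: qx.
    by case: (unpickle n) => [q qx|[]]; exists q; [exact: Logic.I|exact: qx].
  apply: negligible_bigcup => n; case: (unpickle n) => [q|].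
    by have [_ m0 z0 _ _] := BNP q; exists (BN q).2; split.
  exact: negligible_set0.
move=> mDN; apply: (measurability _ (RGenOInfty.measurableE R)) => //.
move=> _ [_ [x ->] <-].
rewrite (_ : _ `&` _ = \bigcup_(q in [set q : rat | x < ratr q])
    ((BN q).1 `\` N)); last first.
  apply/seteqP; split => [t [[Dt Nt]]|t [q /= xq [Bt Nt]]] /=.
    rewrite in_itv/= andbT => /rat_in_itvoo[q]; rewrite in_itv/= => /andP[xq qt].
    exists q => //; split => //.
    have [_ _ _ _ /(_ t)] := BNP q.
    rewrite /= in_itv/= qt => /(_ (conj Dt isT))[//|Nt'].
    by exfalso; apply: Nt; exists q.
  have [_ _ _ /(_ _ Bt)[Dt]] := BNP q.
  rewrite /= in_itv/= andbT => qt _; split => //; rewrite in_itv/= andbT.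
  exact: lt_trans qt.
rewrite bigcup_mkcond; apply: bigcupT_measurable_rat => q.
case: ifPn => // _; apply: measurableD => //.
by have [] := BNP q.
Qed.

End LebesgueMeasurable.

(** * Integrals over segments and differentiation of primitives *)

Section LebesgueIntegral.
Context {R : realType}.
Local Notation mu := (@lebesgue_measure R).
Local Notation L := (lebesgueType R).
Local Notation lebR := (@completed_lebesgue_measure R).
Implicit Types (g h : R -> R) (a b c t C : R).

(** The bound holds at every point, not almost everywhere. The integrands below satisfy this because
    [U] is compact and the saturation is bounded, and it makes them integrable on segments. *)
Definition bmeas (D : set R) g :=
  measurable_fun (D : set L) g /\ exists C, forall t, D t -> `|g t| <= C.

(** The integral is not oriented: for [b < a] the segment is empty and the value is [0]. *)
Definition itg g a b : R := Rintegral lebR `[a, b] g.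

Lemma measure_segment_lty a b : (mu `[a, b] < +oo)%E.
Proof.
by rewrite lebesgue_measure_itv/= lte_fin; case: ifP => _; rewrite -?EFinB ltry.
Qed.

Lemma bmeas_integrable a b g : bmeas `[a, b] g ->
  lebR.-integrable (`[a, b] : set L) (EFin \o g).
Proof.
move=> [mg [C gC]]; apply: measurable_bounded_integrable => //.
- exact: leb_measurable_itv.
- exact: measure_segment_lty.
- exists C; split; first exact: num_real.
  by move=> x Cx t /= abt; apply: le_trans (ltW Cx); exact: gC.
Qed.

Lemma bmeasS (D E : set R) g : measurable (E : set L) -> D `<=` E ->
  bmeas E g -> bmeas D g.
Proof.
move=> mE DE [mg [C gC]]; split; first exact: measurable_funS mg.
by exists C => t /DE; exact: gC.
Qed.

Lemma bmeas_itvS a b c d g : a <= c -> d <= b -> bmeas `[a, b] g -> bmeas `[c, d] g.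
Proof.
move=> ac db; apply: bmeasS; first exact: leb_measurable_itv.
by move=> t; rewrite /= !in_itv/= => /andP[? ?]; apply/andP; split; lra.
Qed.

Lemma bmeas_lin (D : set R) (k l : R) g h : measurable (D : set L) ->
  bmeas D g -> bmeas D h -> bmeas D (fun t => k * g t + l * h t).
Proof.
move=> mD [mg [C gC]] [mh [C' hC']]; split.
  by apply: measurable_funD; apply: measurable_funM => //; exact: measurable_cst.
exists (`|k| * C + `|l| * C') => t Dt; apply: le_trans (ler_normD _ _) _.
by rewrite !normrM lerD// ler_wpM2l// ?gC// hC'.
Qed.

Lemma bmeas_continuous a b g : {within `[a, b], continuous g} -> bmeas `[a, b] g.
Proof.
move=> cg; split; first exact: leb_measurable_continuous.
have [ab|ba] := leP a b; last first.
  by exists 0 => t /=; rewrite in_itv/=; lra.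
have /compact_bounded[C [_ HC]] : compact (g @` `[a, b]).
  by apply: continuous_compact => //; exact: segment_compact.
exists (C + 1) => t abt; apply: (HC (C + 1)); first by rewrite ltrDl.
by exists t.
Qed.

Lemma itg_lin a b (k l : R) g h : bmeas `[a, b] g -> bmeas `[a, b] h ->
  itg (fun t => k * g t + l * h t) a b = k * itg g a b + l * itg h a b.
Proof.
move=> bg bh; have mab := @leb_measurable_itv R `[a, b].
have ig := bmeas_integrable bg; have ih := bmeas_integrable bh.
have Z (m : R) f : bmeas `[a, b] f -> bmeas `[a, b] (fun t => m * f t).
  move=> bf; have := bmeas_lin m 0 mab bf bf.
  by congr (bmeas _); apply/funext => t; rewrite mul0r addr0.
rewrite /itg RintegralD// ?RintegralZl//.
- exact: bmeas_integrable (Z k _ bg).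
- exact: bmeas_integrable (Z l _ bh).
Qed.

Lemma itg_cst a b C : a <= b -> itg (cst C) a b = C * (b - a).
Proof.
move=> ab; rewrite /itg Rintegral_cst; last exact: leb_measurable_itv.
congr (_ * _); transitivity (fine (mu `[a, b])); first by [].
rewrite lebesgue_measure_itv/= lte_fin; case: ltP => // ba /=.
by lra.
Qed.

Lemma itg_le a b g h : bmeas `[a, b] g -> bmeas `[a, b] h ->
  (forall t, a <= t <= b -> g t <= h t) -> itg g a b <= itg h a b.
Proof.
move=> bg bh gh; apply: le_Rintegral.
- exact: leb_measurable_itv.
- exact: bmeas_integrable.
- exact: bmeas_integrable.
- by move=> t /=; rewrite in_itv/=; exact: gh.
Qed.

Lemma bmeas_cst (D : set R) C : bmeas D (cst C).
Proof. by split; [exact: measurable_cst|exists `|C|]. Qed.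

Lemma itg_bound a b g C : a <= b -> bmeas `[a, b] g ->
  (forall t, a <= t <= b -> `|g t| <= C) -> `|itg g a b| <= C * (b - a).
Proof.
move=> ab bg gC; rewrite ler_norml -mulNr -!itg_cst//; apply/andP; split.
  apply: itg_le => //; first exact: bmeas_cst.
  by move=> t /gC; rewrite ler_norml => /andP[].
apply: itg_le => //; first exact: bmeas_cst.
by move=> t /gC; rewrite ler_norml => /andP[].
Qed.

Lemma itg_split a b c g : a <= b -> b <= c -> bmeas `[a, c] g ->
  itg g a c = itg g a b + itg g b c.
Proof.
move=> ab bc bg; have ig := bmeas_integrable bg.
have mI i := @leb_measurable_itv R i.
have E : [set` `[a, c]] = [set` `[a, b]] `|` [set` `]b, c]] :> set R.
  apply/seteqP; split => t /=; rewrite !in_itv/=.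
    by move=> /andP[-> ->]; case: leP => _; [left|right].
  by move=> [|] /andP[? ?]; apply/andP; split; lra.
have igbc : lebR.-integrable (`[b, c] : set L) (EFin \o g).
  by apply: bmeas_integrable; exact: bmeas_itvS bg.
rewrite /itg E Rintegral_setU//.
- congr (_ + _); apply/esym; congr fine.
  (* The closed segments share the null point [b]. *)
  have -> : [set` `]b, c]] = [set` `[b, c]] `\` [set b] :> set R by rewrite setDitv1l.
  apply: negligible_integral => //.
  + by rewrite -set_itv1; exact: mI.
  + transitivity (mu [set b]); first by [].
    by rewrite lebesgue_measure_set1.
- by rewrite -E.
- apply/disj_setPS => t []; rewrite /= !in_itv/= => /andP[? ?] /andP[? ?].
  by lra.
Qed.

(** The identity from the Lebesgue to the Borel sigma-algebra is measurable and pushes the completed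
    measure forward to the Borel one, so this is the change of variables formula for that map. *)
Lemma itg_borel (D : set R) h : measurable (D : set (measurableTypeR R)) ->
  measurable_fun (D : set (measurableTypeR R)) h ->
  mu.-integrable D (EFin \o h) ->
  Rintegral lebR D h = Rintegral mu D h.
Proof.
move=> mD mh ih.
have mid := @measurable_id_leb R.
pose nu := measure_function_pushforward__canonical__measure_function_Measure
  lebR mid.
have ihT : mu.-integrable setT ((EFin \o h) \_ D) by rewrite -integrable_mkcond.
have mhT := measurable_int _ ihT.
congr fine; rewrite integral_mkcond [RHS]integral_mkcond.
transitivity (\int[nu]_x ((EFin \o h) \_ D) x)%E; last first.
  by apply: eq_measure_integral.
rewrite integral_pushforward ?preimage_setT//.
have : nu.-integrable setT ((EFin \o h) \_ D).
  move/integrableP : ihT => [_ fin]; apply/integrableP; split => //.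
move=> /integrableP[_ fin]; apply/integrableP; split.
  exact: (measurableT_comp mhT mid).
move: fin; rewrite ge0_integral_pushforward//.
exact: measurableT_comp.
Qed.

(** [FTC1] speaks of the Borel measure. It is applied to the Borel function [h] equal to [g] off a
    null set [N] and to [0] elsewhere; near an interior point the two primitives coincide, and off
    [N] the two values do. *)
Lemma itg_derive_ae a b g : bmeas `[a, b] g ->
  {ae lebR, forall t, a < t < b -> is_derive t (1 : R) (itg g a) (g t)}.
Proof.
move=> bg; have [mg [C gC]] := bg.
have mab := measurable_itv `[a, b].
have [N [mN N0 mgN]] := leb_measurable_borel mab mg.
pose D := [set` `[a, b]] `\` N.
have mD : measurable (D : set (measurableTypeR R)) by exact: measurableD.
pose h := g \_ D.
have mh : measurable_fun setT (h : measurableTypeR R -> R).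
  by apply/(measurable_restrictT _ _).1.
have hC t : `|h t| <= `|C|.
  rewrite /h patchE; case: ifPn => [|_]; last by rewrite normr0.
  by rewrite inE => -[/gC + _]; move=> /le_trans; apply; exact: ler_norm.
have ih (c d : R) : mu.-integrable `[c, d] (EFin \o h).
  apply: measurable_bounded_integrable => //.
  - exact: measure_segment_lty.
  - exact: measurable_funS mh.
  - exists `|C|; split; first exact: num_real.
    by move=> x Cx t /= _; apply: le_trans (ltW Cx).
have locint : locally_integrable [set: R] h.
  have -> : h = h \_ `[a, b].
    apply/funext => t; rewrite [RHS]patchE; case: ifPn => // tab.
    rewrite /h patchE ifN//; apply: contra tab.
    by rewrite !inE => -[].
  apply: integrable_locally_restrict => //.
have := @FTC1 _ h (BLeft a) (ih a) locint.
move=> /leb_negligibleP fde; have nN : (lebR).-negligible N.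
  by apply/leb_negligibleP; exists N; split.
have := negligibleU fde nN; apply: negligibleS => t /= /not_implyP[/andP[ta tb]].
move=> ng; apply: contrapT => /not_orP[fd Nt]; apply: ng.
move/contrapT : fd => /= fd; have [|df fE] := fd; first by rewrite lte_fin.
have Ng : {near t, (fun x => \int[mu]_(s in [set` `[a, x]]) h s) =1 itg g a}.
  have : t \in `]a, b[ by rewrite in_itv/= ta tb.
  move/near_in_itvoo; apply: filterS => x; rewrite in_itv/= => /andP[ax xb].
  rewrite -itg_borel//; last exact: measurable_funS mh.
  congr fine; apply: ae_eq_integral; first exact: leb_measurable_itv.
  - apply/measurable_EFinP/leb_measurable_of_borel => //.
    exact: measurable_funS mh.
  - apply/measurable_EFinP; apply: measurable_funS mg => //.
      exact: leb_measurable_itv.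
    by move=> s/=; rewrite !in_itv/= => /andP[-> ?]; lra.
  - apply: negligibleS nN => s /= /not_implyP[].
    rewrite in_itv/= => /andP[as_ sx] hs; apply: contrapT => Ns; apply: hs.
    rewrite /h patchE mem_set//; split => //=; rewrite in_itv/= as_/=; lra.
apply: near_eq_is_derive Ng _; apply: DeriveDef => //.
rewrite -derive1E fE /h patchE mem_set//; split => //=.
by rewrite in_itv/= (ltW ta) (ltW tb).
Qed.

Lemma itg_lipschitz a b g C s t : bmeas `[a, b] g ->
  (forall u, a <= u <= b -> `|g u| <= C) -> a <= s <= b -> a <= t <= b ->
  `|itg g a t - itg g a s| <= C * `|t - s|.
Proof.
move=> bg gC; wlog st : s t / s <= t => [H sab tab|/andP[as_ sb] /andP[at_ tb]].
  have [st|/ltW ts] := leP s t; first exact: H.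
  by rewrite distrC (distrC t); exact: H.
rewrite (@itg_split a s t)//; last exact: bmeas_itvS bg.
rewrite addrC addKr [`|t - s|]ger0_norm ?subr_ge0//.
apply: itg_bound => //; first exact: bmeas_itvS bg.
by move=> u /andP[su ut]; apply: gC; apply/andP; split; lra.
Qed.

End LebesgueIntegral.

(** * Absolute continuity *)

Section AbsoluteContinuity.
Context {R : realType}.
Local Notation mu := (@lebesgue_measure R).
Local Notation L := (lebesgueType R).
Local Notation lebR := (@completed_lebesgue_measure R).
Implicit Types (g h : R -> R) (a b c t C : R) (N : R -> R -> R).

(* [N s t] controls an increment over [s, t]; [N s t = enorm (x t - x s)] gives
   the absolute continuity of [x]. *)
Definition ac_incr a b N : Prop :=
  forall e : R, 0 < e -> exists2 d : R, 0 < d &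
    forall (k : nat) (lo hi : 'I_k -> R),
      (forall i, [/\ a <= lo i, lo i <= hi i & hi i <= b]) ->
      (forall i j, i != j -> `]lo i, hi i[ `&` `]lo j, hi j[ = set0) ->
      \sum_(i < k) (hi i - lo i) < d ->
      \sum_(i < k) N (lo i) (hi i) < e.

Definition incr h s t : R := `|h t - h s|.

(** A single domination principle yields the closure properties used later: linear combinations,
    Lipschitz functions, the predictor integral. Each of the three terms receives a third of
    [e / C'], where [C'] replaces [C] in order to be positive. *)
Lemma ac_incr_dom a b N1 N2 N C :
  (forall s t, 0 <= N1 s t) -> (forall s t, 0 <= N2 s t) ->
  ac_incr a b N1 -> ac_incr a b N2 ->
  (forall s t, a <= s -> s <= t -> t <= b ->
    N s t <= C * (N1 s t + N2 s t + (t - s))) ->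
  ac_incr a b N.
Proof.
move=> N10 N20 ac1 ac2 NC e e0.
pose C' := `|C| + 1; have C'0 : 0 < C' by rewrite /C' ltr_wpDl.
pose e' := e / (3 * C').
have e'0 : 0 < e' by rewrite /e' divr_gt0// mulr_gt0.
have [d1 d10 H1] := ac1 _ e'0; have [d2 d20 H2] := ac2 _ e'0.
exists (Num.min (Num.min d1 d2) e'); first by rewrite !lt_min d10 d20.
move=> k lo hi lohi disj; rewrite !lt_min => /andP[/andP[s1 s2] s3].
have {H1}H1 := H1 _ _ _ lohi disj s1; have {H2}H2 := H2 _ _ _ lohi disj s2.
apply: (@le_lt_trans _ _ (\sum_(i < k)
    C' * (N1 (lo i) (hi i) + N2 (lo i) (hi i) + (hi i - lo i)))).
  apply: ler_sum => i _; have [l1 l2 l3] := lohi i.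
  apply: le_trans (NC _ _ l1 l2 l3) _; rewrite ler_wpM2r//.
    by apply: addr_ge0; [exact: addr_ge0|rewrite subr_ge0].
  by rewrite /C' (le_trans (ler_norm _))// lerDl.
rewrite -mulr_sumr !big_split/= -[X in X < _]mulrC -ltr_pdivlMr//.
have -> : e / C' = e' + e' + e' by rewrite /e'; field; rewrite gt_eqF.
by move: s3; rewrite big_split/= => s3; rewrite !ltrD.
Qed.

Lemma ac_incr0 a b : ac_incr a b (fun _ _ => 0).
Proof. by move=> e e0; exists 1 => // k lo hi _ _ _; rewrite big1. Qed.

Lemma ac_incr_lipschitz a b h C :
  (forall s t, a <= s <= b -> a <= t <= b -> `|h t - h s| <= C * `|t - s|) ->
  ac_incr a b (incr h).
Proof.
move=> hC; apply: (@ac_incr_dom _ _ (fun _ _ => 0) (fun _ _ => 0) _ C) => //;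
  [exact: ac_incr0|exact: ac_incr0|] => s t as_ st tb.
rewrite !add0r -[t - s]ger0_norm ?subr_ge0//; apply: hC; apply/andP; split => //.
  exact: le_trans tb.
exact: le_trans st.
Qed.

Lemma ac_incrD a b g h (k l : R) : ac_incr a b (incr g) -> ac_incr a b (incr h) ->
  ac_incr a b (incr (fun t => k * g t + l * h t)).
Proof.
move=> acg ach.
apply: (@ac_incr_dom _ _ _ _ _ (`|k| + `|l|) _ _ acg ach) => [s t|s t|s t as_ st tb];
  rewrite ?/incr//.
have -> : k * g t + l * h t - (k * g s + l * h s) =
    k * (g t - g s) + l * (h t - h s) by ring.
apply: le_trans (ler_normD _ _) _; rewrite !normrM mulrDl lerD//.
  by rewrite ler_wpM2l// -addrA lerDl; apply: addr_ge0 => //; rewrite subr_ge0.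
by rewrite ler_wpM2l// addrAC lerDr; apply: addr_ge0 => //; rewrite subr_ge0.
Qed.

Lemma is_derive_quotient h t l : is_derive t 1 h l -> forall e, 0 < e ->
  exists2 d : R, 0 < d & forall k, k != 0 -> `|k| < d ->
    `|k^-1 * (h (t + k) - h t) - l| < e.
Proof.
move=> [dh hl] e e0; move: dh => /cvg_ex[l' cl'].
have El : l' = l by rewrite -hl; apply/esym/cvg_lim.
move: cl' => /cvgrPdist_lt/(_ _ e0); rewrite El => -[d /= d0 H].
exists d => // k k0 kd; have := H k; rewrite /= sub0r normrN => /(_ kd k0).
by rewrite /shift/= [k%:A]mulr1 distrC (addrC k).
Qed.

Lemma negligible_open_cover (N : set R) (e : R) : lebR.-negligible N -> 0 < e ->
  exists G, [/\ open G, N `<=` G & (mu G <= e%:E)%E].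
Proof.
move=> /leb_negligibleP/negligible_outer_measure N0 e0.
have [G [oG NG]] := outer_measure_open_le N e0.
by rewrite N0 add0e; exists G.
Qed.

Lemma sum_itv_le_open (G : set R) (e : R) (k : nat) (lo hi : 'I_k -> R) :
  open G -> (mu G <= e%:E)%E ->
  (forall i, lo i <= hi i) -> (forall i, `]lo i, hi i[ `<=` G) ->
  (forall i j, i != j -> `]lo i, hi i[ `&` `]lo j, hi j[ = set0) ->
  \sum_(i < k) (hi i - lo i) <= e.
Proof.
move=> oG Ge lohi sub disj; rewrite -lee_fin; apply: le_trans Ge.
rewrite -sumEFin.
have -> : (\sum_(i < k) (hi i - lo i)%:E = \sum_(i < k) mu `]lo i, hi i[)%E.
  apply: eq_bigr => i _; rewrite lebesgue_measure_itv/= lte_fin.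
  by rewrite lt_neqAle lohi andbT; case: eqVneq => [->|_]//=; rewrite subrr.
rewrite -(@measure_bigsetU_ord _ _ _ mu k predT (fun i => `]lo i, hi i[%classic))//.
- apply: le_measure; rewrite ?inE.
  + by apply: bigsetU_measurable.
  + exact: open_measurable.
  + elim/big_ind : _ => [//|A B HA HB|i _]; last exact: sub.
    by rewrite subUset.
- apply/trivIsetP => i j _ _; exact: disj.
Qed.

(* A creeping argument: starting from [a], points outside the exceptional null
   set are passed with slope at most [e], the others inside a small open set
   covering them, where the growth is controlled by absolute continuity. *)
Lemma ac_derive_le0 a b h : a <= b -> ac_incr a b (incr h) ->
  {ae lebR, forall t, a < t < b -> exists2 l, is_derive t 1 h l & l <= 0} ->
  h b <= h a.
Proof.
move=> ab ach hd.
have [->//|neab] := eqVneq a b; have {ab neab}ab : a < b by rewrite lt_neqAle neab.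
suff H e : 0 < e -> h b - h a <= e * (b - a) + e.
  rewrite -subr_le0; apply/ler_addgt0Pr => e e0; rewrite add0r.
  have e'0 : 0 < e / (b - a + 1) by rewrite divr_gt0//; lra.
  apply: le_trans (H _ e'0) _.
  rewrite [leLHS](_ : _ = e)//; field; lra.
move=> e0; have [d d0 Hd] := ach _ e0.
(* The endpoints are declared exceptional because the derivative is controlled in the open interval
   only. *)
pose Nex := (~` [set t | a < t < b -> exists2 l, is_derive t 1 h l & l <= 0])
  `|` ([set a] `|` [set b]).
have nN : lebR.-negligible Nex.
  apply: negligibleU; first exact: hd.
  have n1 (x : R) : lebR.-negligible [set x].
    apply/leb_negligibleP; exists [set x]; split => //.
    exact: lebesgue_measure_set1.
  exact: negligibleU.
have d20 : 0 < d / 2 by rewrite divr_gt0.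
have [G [oG NG Gd]] := negligible_open_cover nN d20.
pose P s t := h t - h s <= e * (t - s) \/ `]s, t[ `<=` G.
have loc c : a <= c <= b -> exists2 eta, 0 < eta &
    (forall s, c - eta < s -> s <= c -> P s c) /\
    (forall t, c <= t -> t < c + eta -> P c t).
  move=> /andP[ac cb]; have [Gc|NGc] := pselect (G c).
    have [eta /= eta0 Heta] : \forall x \near c, G x by exact: open_nbhs_nbhs.
    exists eta => //; split => [s s1 s2|t t1 t2]; right => x;
      rewrite /= in_itv/= => /andP[x1 x2]; apply: Heta => /=;
      rewrite ltr_norml; apply/andP; split; lra.
  have nNc : ~ Nex c by move=> /NG.
  have ca : c != a by apply/eqP => E; apply: nNc; right; left.
  have cb' : c != b by apply/eqP => E; apply: nNc; right; right.
  have {ca}ac' : a < c by rewrite lt_neqAle eq_sym ca.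
  have {cb'}cb' : c < b by rewrite lt_neqAle cb'.
  have /(_ _)/cid2[|l hl l0] : a < c < b -> exists2 l, is_derive c 1 h l & l <= 0.
    by apply: contrapT => H; apply: nNc; left.
    by rewrite ac'.
  have [eta eta0 Heta] := is_derive_quotient hl e0.
  exists eta => //; split => [s s1 s2|t t1 t2]; left.
  - have [->|sc] := eqVneq s c; first by rewrite !subrr mulr0.
    have sc0 : s - c < 0 by rewrite subr_lt0 lt_neqAle sc.
    have := Heta (s - c); rewrite lt_eqF// ltr0_norm// => /(_ isT).
    have -> : c + (s - c) = s by ring.
    move=> /(_ _)/wrap[]; first lra.
    rewrite ltr_norml => /andP[_]; rewrite ltrBlDr mulrC ltr_ndivrMr//; nra.
  - have [->|sc] := eqVneq t c; first by rewrite !subrr mulr0.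
    have sc0 : 0 < t - c by rewrite subr_gt0 lt_neqAle eq_sym sc.
    have := Heta (t - c); rewrite gt_eqF// gtr0_norm// => /(_ isT).
    have -> : c + (t - c) = t by ring.
    move=> /(_ _)/wrap[]; first lra.
    rewrite ltr_norml => /andP[_]; rewrite ltrBlDr mulrC ltr_pdivrMr//; nra.
(* The list records the steps taken inside [G], newest first, so later entries lie further left.
   Being disjoint and inside [G], they have total length at most [d / 2], and absolute continuity is
   invoked only once, at the end. *)
pose good t := exists s : seq (R * R),
  [/\ forall p, p \in s -> [/\ a <= p.1, p.1 <= p.2, p.2 <= t & `]p.1, p.2[ `<=` G],
      pairwise (fun p q : R * R => q.2 <= p.1) s &
      h t - h a <= e * (t - a) + \sum_(p <- s) `|h p.2 - h p.1|].
have step s t : a <= s -> s <= t -> good s -> P s t -> good t.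
  move=> as_ st [fam [famP fampw famh]] [hst|Gst].
    exists fam; split => //; last by nra.
    by move=> p /famP[p1 p2 p3 p4]; split => //; exact: le_trans st.
  exists ((s, t) :: fam); split.
  - move=> p; rewrite inE => /predU1P[->//|/famP[p1 p2 p3 p4]].
    by split => //; exact: le_trans st.
  - rewrite /= fampw andbT; apply/allP => p /famP[p1 p2 p3 p4] /=.
    by [].
  - rewrite big_cons/=; have := ler_norm (h t - h s).
    have : 0 <= e * (t - s) by rewrite mulr_ge0 ?subr_ge0// ltW.
    lra.
have gooda : good a by exists [::]; split => //; rewrite !subrr mulr0 big_nil addr0.
pose E := [set t | a <= t <= b /\ good t].
have Ea : E a by split => //; rewrite lexx ltW.
have Eub : has_ubound E by exists b => t [/andP[]].
have Esup : has_sup E by split; [exists a|].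
pose c := sup E.
have ac : a <= c by apply: ub_le_sup.
have cb : c <= b by apply: ge_sup; [exists a|move=> t [/andP[]]].
have [eta eta0 [Hl Hr]] := loc c (introT andP (conj ac cb)).
have goodc : good c.
  have [s [/andP[as_ sb] gs] cs] := sup_adherent eta0 Esup.
  have sc : s <= c by apply: ub_le_sup => //; split => //; rewrite as_.
  by apply: (step s c) => //; exact: Hl.
(* If the supremum were below [b], one more step, of length at most [eta / 2], would pass it. *)
have {Ea Esup loc}cbE : c = b.
  apply/eqP; rewrite eq_le cb/= leNgt; apply/negP => cb'.
  pose t := Num.min b (c + eta / 2).
  have ct : c < t by rewrite lt_min cb' ltrDl divr_gt0.
  have gt_ : good t.
    apply: (step c t) => //; first exact: ltW.
    apply: Hr; first exact: ltW.
    by rewrite gt_min; apply/orP; right; lra.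
  have : t <= c.
    apply: ub_le_sup => //; split => //; apply/andP; split; first lra.
    by rewrite ge_min lexx.
  by rewrite leNgt ct.
have [fam [famP fampw famh]] : good b by rewrite -cbE.
apply: le_trans famh _; rewrite lerD2l; apply: ltW.
pose p0 : R * R := (0, 0).
rewrite (big_nth p0) big_mkord.
have inf (i : 'I_(size fam)) : nth p0 fam i \in fam by exact: mem_nth.
have disj (i j : 'I_(size fam)) : i != j ->
    `](nth p0 fam i).1, (nth p0 fam i).2[ `&`
    `](nth p0 fam j).1, (nth p0 fam j).2[ = set0.
  wlog ij : i j / (i < j)%N => [H ij|_].
    have [lij|lji|/val_inj eij] := ltngtP i j; first exact: H.
    - by rewrite setIC; apply: H => //; rewrite eq_sym.
    - by rewrite eij eqxx in ij.
  have /(pairwiseP p0)/(_ i j) := fampw; rewrite !inE !ltn_ord => /(_ isT isT ij).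
  move=> ji; rewrite -subset0 => x [] /=; rewrite !in_itv/= => /andP[? ?] /andP[? ?].
  lra.
apply: (Hd _ (fun i => (nth p0 fam i).1) (fun i => (nth p0 fam i).2)) => //.
  by move=> i; have [] := famP _ (inf i).
apply: (@le_lt_trans _ _ (d / 2)); last by lra.
apply: (sum_itv_le_open oG Gd) => // i; by have [] := famP _ (inf i).
Qed.

End AbsoluteContinuity.

(** * Euclidean norm and vector-valued integrals *)

Section EuclideanNorm.
Context {R : realType} {n : nat}.
Implicit Types v w : 'rV[R]_n.

Lemma enorm_ge0 v : 0 <= enorm v.
Proof. exact: sqrtr_ge0. Qed.

Lemma sqr_enorm v : enorm v ^+ 2 = \sum_(i < n) v ord0 i ^+ 2.
Proof. by rewrite sqr_sqrtr// sumr_ge0// => i _; rewrite sqr_ge0. Qed.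

Lemma coord_le_enorm v i : `|v ord0 i| <= enorm v.
Proof.
rewrite -(ler_pXn2r (n := 2))// ?nnegrE ?enorm_ge0// sqr_enorm real_normK ?num_real//.
by rewrite (bigD1 i)//= lerDl sumr_ge0// => j _; rewrite sqr_ge0.
Qed.

Lemma enorm_le_sum v : enorm v <= \sum_(i < n) `|v ord0 i|.
Proof.
have S0 : 0 <= \sum_(i < n) `|v ord0 i| by apply: sumr_ge0.
rewrite -(ler_pXn2r (n := 2))// ?nnegrE ?enorm_ge0// sqr_enorm.
rewrite [leRHS]expr2 mulr_suml; apply: ler_sum => i _.
rewrite -real_normK ?num_real// expr2 ler_wpM2l//.
by rewrite (bigD1 i)//= lerDl sumr_ge0.
Qed.

Lemma enorm0 : enorm (0 : 'rV[R]_n) = 0.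
Proof. by rewrite /enorm big1 ?sqrtr0// => i _; rewrite mxE expr0n. Qed.

Lemma enorm0_eq0 v : enorm v <= 0 -> v = 0.
Proof.
move=> v0; apply/rowP => i; rewrite mxE; apply/eqP.
by rewrite -normr_le0 (le_trans (coord_le_enorm v i)).
Qed.

Lemma enormZ (k : R) v : enorm (k *: v) = `|k| * enorm v.
Proof.
rewrite /enorm; under eq_bigr do rewrite mxE exprMn.
by rewrite -mulr_sumr sqrtrM ?sqr_ge0// sqrtr_sqr.
Qed.

Lemma enormN v : enorm (- v) = enorm v.
Proof. by rewrite -scaleN1r enormZ normrN normr1 mul1r. Qed.

Lemma enormBC v w : enorm (v - w) = enorm (w - v).
Proof. by rewrite -enormN opprB. Qed.

(** Expand the sum of the squares of |w| v_i - |v| w_i and divide by 2 |v| |w|; the zero vectors are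
    split off because of this division. *)
Lemma cauchy_schwarz v w :
  \sum_(i < n) v ord0 i * w ord0 i <= enorm v * enorm w.
Proof.
have [v0|v0] := leP (enorm v) 0.
  by rewrite (enorm0_eq0 v0) enorm0 mul0r big1// => i _; rewrite mxE mul0r.
have [w0|w0] := leP (enorm w) 0.
  by rewrite (enorm0_eq0 w0) enorm0 mulr0 big1// => i _; rewrite mxE mulr0.
have : 0 <= \sum_(i < n) (enorm w * v ord0 i - enorm v * w ord0 i) ^+ 2.
  by apply: sumr_ge0 => i _; rewrite sqr_ge0.
have -> : \sum_(i < n) (enorm w * v ord0 i - enorm v * w ord0 i) ^+ 2 =
    enorm w ^+ 2 * (\sum_(i < n) v ord0 i ^+ 2) +
    enorm v ^+ 2 * (\sum_(i < n) w ord0 i ^+ 2) -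
    2 * (enorm v * enorm w) * \sum_(i < n) v ord0 i * w ord0 i.
  rewrite !mulr_sumr -big_split/= -sumrB; apply: eq_bigr => i _; ring.
rewrite -!sqr_enorm; have := mulr_gt0 v0 w0; move: (\sum_(i < n) _) => S.
nra.
Qed.

Lemma enormD v w : enorm (v + w) <= enorm v + enorm w.
Proof.
rewrite -(ler_pXn2r (n := 2))// ?nnegrE ?addr_ge0 ?enorm_ge0// sqr_enorm.
under eq_bigr do rewrite mxE sqrrD.
rewrite !big_split/= -!sqr_enorm.
by rewrite sqrrD lerD2r lerD2l mulr2n lerD// cauchy_schwarz.
Qed.

Lemma enormB v w : enorm (v - w) <= enorm v + enorm w.
Proof. by rewrite -(enormN w); exact: enormD. Qed.

Lemma enorm_dist v w : `|enorm v - enorm w| <= enorm (v - w).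
Proof.
have h (x y : 'rV[R]_n) : enorm x - enorm y <= enorm (x - y).
  by have := enormD (x - y) y; rewrite subrK lerBlDr.
by rewrite ler_norml h andbT lerNl opprB enormBC h.
Qed.

Lemma coord_le_norm v i : `|v ord0 i| <= `|v|.
Proof.
rewrite [leRHS]/Num.Def.normr/= mx_normrE.
exact: (le_bigmax _ (fun ij : 'I_1 * 'I_n => `|v ij.1 ij.2|) (ord0, i)).
Qed.

(** The topology of row vectors comes from the maximum norm. This bound and [norm_le_enorm] carry
    continuity and boundedness between it and the Euclidean norm. *)
Lemma enorm_le_norm v : enorm v <= n%:R * `|v|.
Proof.
apply: le_trans (enorm_le_sum v) _.
rewrite mulrC mulr_natr -[X in _ *+ X](card_ord n) -sumr_const.
by apply: ler_sum => i _; exact: coord_le_norm.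
Qed.

Lemma norm_le_enorm v : `|v| <= enorm v.
Proof.
rewrite [leLHS]/Num.Def.normr/= mx_normrE; apply/bigmax_leP; split => [|[i j] _ /=].
  exact: enorm_ge0.
by rewrite (ord1 i); exact: coord_le_enorm.
Qed.

Lemma near_norm_lt v (e : R) : 0 < e -> \forall w \near v, `|v - w| < e.
Proof. by move=> e0; apply/nbhs_normP; exists e. Qed.

Lemma enorm_continuous : continuous (@enorm R n).
Proof.
move=> v; have FF : Filter (nbhs v) by exact: nbhs_filter.
apply: (cvgrPdist_lt _ _).2 => e e0.
have n0 : 0 < n%:R + 1 :> R by rewrite ltr_wpDl.
have e'0 : 0 < e / (n%:R + 1) by rewrite divr_gt0.
near=> w; apply: le_lt_trans (enorm_dist v w) _.
apply: le_lt_trans (enorm_le_norm _) _.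
have : `|v - w| < e / (n%:R + 1) by near: w; exact: near_norm_lt.
rewrite ltr_pdivlMr//; have := normr_ge0 (v - w); nra.
Unshelve. all: by end_near. Qed.

End EuclideanNorm.

Section VectorIntegral.
Context {R : realType}.
Local Notation mu := (@lebesgue_measure R).
Local Notation L := (lebesgueType R).
Local Notation lebR := (@completed_lebesgue_measure R).
Implicit Types (a b : R).

Lemma ae_leb_imply (P Q : R -> Prop) : {ae lebR, forall t, P t} ->
  (forall t, P t -> Q t) -> {ae lebR, forall t, Q t}.
Proof. by move=> h PQ; apply: negligibleS h => t /= nQ /PQ. Qed.

Lemma ae_leb_imply2 (P Q S : R -> Prop) : {ae lebR, forall t, P t} ->
  {ae lebR, forall t, Q t} -> (forall t, P t -> Q t -> S t) ->
  {ae lebR, forall t, S t}.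
Proof.
move=> hP hQ PQS; apply: negligibleS (negligibleU hP hQ) => t /= nS.
by apply: contrapT => /not_orP[/= /contrapT p /contrapT q]; exact/nS/PQS.
Qed.

(** The difference of [h] and the primitive of [g] is absolutely continuous with zero derivative
    almost everywhere; applying [ac_derive_le0] to it and to its opposite shows that it is
    constant. *)
Lemma itg_derive a b (g h : R -> R) : a <= b -> bmeas `[a, b] g ->
  ac_incr a b (incr h) ->
  {ae lebR, forall t, a < t < b -> is_derive t (1 : R) h (g t)} ->
  itg g a b = h b - h a.
Proof.
move=> ab bg ach hd; have [mg [C gC]] := bg.
have gd := itg_derive_ae bg.
have aci : ac_incr a b (incr (itg g a)).
  apply: (@ac_incr_lipschitz _ _ _ _ C) => s t sab tab.
  by apply: (@itg_lipschitz _ a b).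
have itg0 : itg g a a = 0.
  apply/eqP; rewrite -normr_le0.
  have := @itg_bound _ a a g C (lexx _); rewrite subrr mulr0; apply.
    exact: bmeas_itvS bg.
  by move=> t /andP[ta ta']; apply: gC; rewrite /= in_itv/= ta (le_trans ta').
have key (k l : R) : k + l = 0 ->
    {ae lebR, forall t, a < t < b ->
      is_derive t (1 : R) (fun t => k * itg g a t + l * h t) 0}.
  move=> kl; apply: ae_leb_imply2 hd gd _ => t + + tab.
  move=> /(_ tab) h1 /(_ tab) h2.
  have := is_deriveD (is_deriveZ k h2) (is_deriveZ l h1).
  by rewrite -scalerDl kl scale0r.
have leq (k l : R) : k + l = 0 ->
    k * itg g a b + l * h b <= k * itg g a a + l * h a.
  move=> kl; apply: (@ac_derive_le0 _ a b (fun t => k * itg g a t + l * h t)) => //.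
    exact: ac_incrD.
  apply: ae_leb_imply (key k l kl) _ => t H tab; exists 0 => //; exact: H.
have := leq 1 (- 1) (subrr _); have := leq (- 1) 1 (addNr _); rewrite itg0.
lra.
Qed.

Lemma itg_expR a b (k : R) : k != 0 -> a <= b ->
  itg (fun s => expR (k * s)) a b = (expR (k * b) - expR (k * a)) / k.
Proof.
move=> k0 ab.
have d (t : R) : is_derive t (1 : R) (fun s : R => k^-1 * expR (k * s)) (expR (k * t)).
  have h : is_derive t (1 : R) (fun s : R => k * s) k.
    by rewrite -[X in is_derive _ _ _ X]mulr1; exact: is_deriveZ.
  have := is_deriveZ k^-1 (is_derive1_comp (is_derive_expR (k * t)) h).
  by rewrite /GRing.scale/= [X in _ * X]mulrC mulKf.
have c : continuous (fun s : R => expR (k * s)).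
  move=> t; apply: continuous_comp; last exact: continuous_expR.
  by apply: cvgM; [exact: cvg_cst|exact: cvg_id].
rewrite (@itg_derive a b _ (fun s => k^-1 * expR (k * s))).
- by field.
- exact: ab.
- by apply: bmeas_continuous; exact: continuous_subspaceT.
- apply: (@ac_incr_lipschitz _ _ _ _ (expR (`|k| * (`|a| + `|b|)))).
  suff H s t : a <= s <= b -> a <= t <= b -> s < t ->
      `|k^-1 * expR (k * t) - k^-1 * expR (k * s)| <=
      expR (`|k| * (`|a| + `|b|)) * `|t - s|.
    move=> s t sab tab; have [st|ts|->] := ltgtP s t; first exact: H.
      by rewrite distrC (distrC t); exact: H.
    by rewrite !subrr normr0 mulr0.
  move=> /andP[as_ sb] /andP[at_ tb] st.
  have cst_ : {within `[s, t], continuous (fun s : R => k^-1 * expR (k * s))}.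
    by apply: continuous_subspaceT => x; apply: cvgM; [exact: cvg_cst|exact: c].
  have [x] := MVT_segment (ltW st) (fun x _ => d x) cst_.
  rewrite in_itv/= => /andP[sx xt] ->.
  rewrite normrM ler_wpM2r// ger0_norm ?expR_ge0// ler_expR.
  apply: le_trans (ler_norm _) _; rewrite normrM ler_wpM2l//.
  rewrite ler_norml; have := ler_norm b.
  have := ler_norm (- a); have := normr_ge0 a; have := normr_ge0 b.
  rewrite normrN; lra.
- by apply: aeW => t _; exact: d.
Qed.

Definition bmeasv n (D : set R) (g : R -> 'rV[R]_n) :=
  forall i, bmeas D (fun t => g t ord0 i).

Definition vint n (g : R -> 'rV[R]_n) a b : 'rV[R]_n :=
  \row_(i < n) itg (fun s => g s ord0 i) a b.

Lemma bmeasvP n (D : set R) (g : R -> 'rV[R]_n) (C : R) :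
  leb_measurable D g -> (forall t, D t -> enorm (g t) <= C) -> bmeasv D g.
Proof.
move=> mg gC i; split; first exact: mg.
by exists C => t Dt; apply: le_trans (coord_le_enorm _ _) _; exact: gC.
Qed.

Lemma bmeas_itg_sum (I : Type) (r : seq I) a b (k : I -> R) (g : I -> R -> R) :
  (forall i, bmeas `[a, b] (g i)) ->
  bmeas `[a, b] (fun t => \sum_(i <- r) k i * g i t) /\
  itg (fun t => \sum_(i <- r) k i * g i t) a b = \sum_(i <- r) k i * itg (g i) a b.
Proof.
move=> bg; elim: r => [|i r [IH1 IH2]].
  have -> : (fun t => \sum_(i <- [::]) k i * g i t) = cst 0.
    by apply/funext => t; rewrite big_nil.
  split; first exact: bmeas_cst.
  by rewrite big_nil /itg Rintegral_cst ?mul0r//; exact: leb_measurable_itv.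
have -> : (fun t => \sum_(j <- i :: r) k j * g j t) =
    (fun t => k i * g i t + 1 * \sum_(j <- r) k j * g j t).
  by apply/funext => t; rewrite big_cons mul1r.
split; first by apply: bmeas_lin => //; exact: leb_measurable_itv.
by rewrite itg_lin// IH2 big_cons mul1r.
Qed.

(** Pair the integral [w] with itself: |w|^2 is the integral of the scalar products of [w] with [g],
    at most |w| times the integral of [h]. Working by coordinates would cost a dimensional factor
    and spoil the constants G1 and G2. *)
Lemma enorm_vint_le n a b (g : R -> 'rV[R]_n) (h : R -> R) :
  bmeasv `[a, b] g -> bmeas `[a, b] h ->
  (forall t, a <= t <= b -> enorm (g t) <= h t) ->
  enorm (vint g a b) <= itg h a b.
Proof.
move=> bg bh gh; set w := vint g a b.
have [w0|w0] := leP (enorm w) 0.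
  apply: le_trans w0 _; apply: Rintegral_ge0 => t /=; rewrite in_itv/= => tab.
  by apply: le_trans (gh _ tab); exact: enorm_ge0.
rewrite -(ler_pM2l w0) -expr2 sqr_enorm.
have [bS iS] := bmeas_itg_sum (index_enum 'I_n) (fun i => w ord0 i) bg.
have -> : \sum_(i < n) w ord0 i ^+ 2 =
    itg (fun t => \sum_(i < n) w ord0 i * g t ord0 i) a b.
  by rewrite iS; apply: eq_bigr => i _; rewrite expr2 {2}/w mxE.
have -> : enorm w * itg h a b = itg (fun t => enorm w * h t + 0 * h t) a b.
  by rewrite itg_lin// mul0r addr0.
apply: itg_le; first exact: bS.
  by apply: bmeas_lin; [exact: leb_measurable_itv|exact: bh|exact: bh].
move=> t tab; rewrite mul0r addr0; apply: le_trans (cauchy_schwarz w (g t)) _.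
by rewrite ler_wpM2l ?enorm_ge0// gh.
Qed.

Lemma enorm_vint_bound n a b (g : R -> 'rV[R]_n) (C : R) : a <= b ->
  bmeasv `[a, b] g -> (forall t, a <= t <= b -> enorm (g t) <= C) ->
  enorm (vint g a b) <= C * (b - a).
Proof.
move=> ab bg gC; rewrite -itg_cst//; apply: enorm_vint_le => //.
exact: bmeas_cst.
Qed.

Lemma vintB n a b (g h : R -> 'rV[R]_n) : bmeasv `[a, b] g -> bmeasv `[a, b] h ->
  vint g a b - vint h a b = vint (fun t => g t - h t) a b.
Proof.
move=> bg bh; apply/rowP => i; rewrite !mxE.
have -> : (fun s => (g s - h s) ord0 i) =
  (fun s => 1 * g s ord0 i + (- 1) * h s ord0 i).
  by apply/funext => s; rewrite !mxE mul1r mulN1r.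
by rewrite itg_lin// mul1r mulN1r.
Qed.

Lemma vint_split n a b c (g : R -> 'rV[R]_n) : a <= b -> b <= c ->
  bmeasv `[a, c] g -> vint g a c = vint g a b + vint g b c.
Proof. by move=> ab bc bg; apply/rowP => i; rewrite !mxE -itg_split. Qed.

Lemma bmeasvB n (D : set R) (g h : R -> 'rV[R]_n) : measurable (D : set L) ->
  bmeasv D g -> bmeasv D h -> bmeasv D (fun t => g t - h t).
Proof.
move=> mD bg bh i; have := bmeas_lin 1 (- 1) mD (bg i) (bh i).
by congr (bmeas _); apply/funext => t; rewrite !mxE mul1r mulN1r.
Qed.

Lemma bmeasv_itvS n a b c d (g : R -> 'rV[R]_n) : a <= c -> d <= b ->
  bmeasv `[a, b] g -> bmeasv `[c, d] g.
Proof. by move=> ac db bg i; exact: bmeas_itvS (bg i). Qed.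

End VectorIntegral.

(** * Absolutely continuous curves *)

Section VectorAbsoluteContinuity.
Context {R : realType}.
Local Notation L := (lebesgueType R).
Local Notation lebR := (@completed_lebesgue_measure R).
Implicit Types (a b : R).

Lemma is_derive_rowP n (x : R -> 'rV[R]_n) (t : R) (dx : 'rV[R]_n) :
  is_derive t (1 : R) x dx <->
  forall i, is_derive t (1 : R) (fun s => x s ord0 i) (dx ord0 i).
Proof.
split=> [[dxt <-] i|H].
  apply: DeriveDef; first exact: ((derivable_mxP x t 1).1 dxt ord0 i).
  by rewrite derive_mx// mxE.
have dxt : derivable x t 1.
  by apply/derivable_mxP => i j; rewrite (ord1 i); have [] := H j.
apply: DeriveDef => //; rewrite derive_mx//; apply/rowP => j.
by rewrite mxE; have [_ ->] := H j.
Qed.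

Lemma ac_incrS a b c d N : a <= c -> d <= b -> ac_incr a b N -> @ac_incr R c d N.
Proof.
move=> ac db acN e /acN[eta eta0 H]; exists eta => // k lo hi lohi; apply: H.
by move=> i; have [h1 h2 h3] := lohi i; split => //;
  [exact: le_trans h1|exact: le_trans db].
Qed.

Definition vincr n (x : R -> 'rV[R]_n) s t : R := enorm (x t - x s).

Lemma abs_continuous_coord n a b (x : R -> 'rV[R]_n) i : abs_continuous a b x ->
  ac_incr a b (incr (fun t => x t ord0 i)).
Proof.
move=> acx; apply: (@ac_incr_dom _ _ _ (vincr x) (fun _ _ => 0) _ 1
  (fun _ _ => enorm_ge0 _) (fun _ _ => lexx _) acx (@ac_incr0 R a b)).
move=> s t as_ st tb; rewrite mul1r addr0 -[leLHS]addr0 lerD ?subr_ge0//.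
by have := coord_le_enorm (x t - x s) i; rewrite !mxE.
Qed.

Lemma abs_continuous_dom n1 n2 n a b (y1 : R -> 'rV[R]_n1) (y2 : R -> 'rV[R]_n2)
    (x : R -> 'rV[R]_n) C :
  abs_continuous a b y1 -> abs_continuous a b y2 ->
  (forall s t, a <= s -> s <= t -> t <= b ->
    enorm (x t - x s) <=
    C * (enorm (y1 t - y1 s) + enorm (y2 t - y2 s) + (t - s))) ->
  abs_continuous a b x.
Proof.
move=> ac1 ac2 H; exact: (@ac_incr_dom _ _ _ (vincr y1) (vincr y2)
  (vincr x) C (fun _ _ => enorm_ge0 _) (fun _ _ => enorm_ge0 _) ac1 ac2 H).
Qed.

Lemma abs_continuous_cst n a b (v : 'rV[R]_n) : abs_continuous a b (cst v).
Proof.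
change (ac_incr a b (vincr (cst v))).
have -> : vincr (cst v) = (fun _ _ => 0).
  by apply/funext => s; apply/funext => t; rewrite /vincr subrr enorm0.
exact: ac_incr0.
Qed.

Lemma ac_incr_continuous a b (h : R -> R) : ac_incr a b (incr h) ->
  {within `[a, b], continuous h}.
Proof.
move=> ach; apply/subspace_continuousP => t; rewrite /= in_itv/= => /andP[at_ tb].
apply/cvgrPdist_lt => e e0; have [d d0 H] := ach _ e0.
rewrite near_withinE; exists d => // s /= ts; rewrite in_itv/= => /andP[as_ sb].
have key (lo hi : R) : a <= lo -> lo <= hi -> hi <= b -> hi - lo < d ->
    `|h hi - h lo| < e.
  move=> alo lohi hib hid.
  have /= := H 1%N (fun=> lo) (fun=> hi); rewrite !big_ord1; apply => //.
  by move=> i j; rewrite !ord1 eqxx.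
have [st|/ltW ts'] := leP s t.
  by apply: key => //; rewrite ger0_norm ?subr_ge0 in ts.
by rewrite distrC; apply: key => //; rewrite distrC ger0_norm ?subr_ge0 in ts.
Qed.

Lemma abs_continuous_within n a b (x : R -> 'rV[R]_n) i : abs_continuous a b x ->
  {within `[a, b], continuous (fun t => x t ord0 i)}.
Proof. by move=> /(@abs_continuous_coord _ _ _ _ i)/ac_incr_continuous. Qed.

Lemma within_bounded n a b (x : R -> 'rV[R]_n) :
  (forall i, {within `[a, b], continuous (fun t => x t ord0 i)}) ->
  exists2 C, 0 <= C & forall t, a <= t <= b -> enorm (x t) <= C.
Proof.
move=> cx; have /choice[C HC] (i : 'I_n) : exists C : R, forall t,
    `[a, b]%classic t -> `|x t ord0 i| <= C by exact: (bmeas_continuous (cx i)).2.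
exists (\sum_(i < n) `|C i|) => [|t tab]; first exact: sumr_ge0.
apply: le_trans (enorm_le_sum _) _; apply: ler_sum => i _.
apply: le_trans (ler_norm (C i)); apply: HC.
by rewrite /= in_itv.
Qed.

Lemma abs_continuous_bounded n a b (x : R -> 'rV[R]_n) : abs_continuous a b x ->
  exists2 C, 0 <= C & forall t, a <= t <= b -> enorm (x t) <= C.
Proof. by move=> acx; apply: within_bounded => i; exact: abs_continuous_within. Qed.

(** The uniqueness half of the contraction principle: iteration gives the bound N0 / 2^k for every
    [k]. It serves [gronwall0] and [volterra_unique], with an exponential weight [w]. *)
Lemma halving_le0 (D : set R) (g w : R -> R) (N0 : R) : 0 <= N0 ->
  (forall t, D t -> g t <= N0 * w t) ->
  (forall N, 0 <= N -> (forall t, D t -> g t <= N * w t) ->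
    forall t, D t -> g t <= N / 2 * w t) ->
  forall t, D t -> g t <= 0.
Proof.
move=> N00 H0 Hs.
have H k : forall t, D t -> g t <= N0 / 2 ^+ k * w t.
  elim: k => [t Dt|k IH]; first by rewrite expr0 divr1; exact: H0.
  have -> : N0 / 2 ^+ k.+1 = N0 / 2 ^+ k / 2.
    by rewrite exprS invfM mulrA mulrAC.
  by apply: Hs => //; rewrite divr_ge0// exprn_ge0.
move=> t Dt; rewrite leNgt; apply/negP => g0.
have Nw0 : 0 <= N0 * w t by apply: le_trans (ltW g0) (H0 _ Dt).
have := archi_boundP (divr_ge0 Nw0 (ltW g0)); set k := Num.bound _ => Hk.
have := H k t Dt; apply/negP; rewrite -ltNge.
rewrite mulrAC ltr_pdivrMr ?exprn_gt0//.
apply: (@lt_le_trans _ _ (k%:R * g t)); first by rewrite -ltr_pdivrMr.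
rewrite mulrC ler_wpM2l ?(ltW g0)// -natrX ler_nat; exact/ltnW/ltn_expl.
Qed.

Lemma gronwall0 n (b : R) (v : R -> 'rV[R]_n) (K : R) : 0 <= K ->
  abs_continuous 0 b v -> v 0 = 0 ->
  {ae lebR, forall t, 0 < t < b -> exists2 dv,
    is_derive t (1 : R) v dv & enorm dv <= K * enorm (v t)} ->
  forall t, 0 <= t <= b -> v t = 0.
Proof.
move=> K0 acv v0 dv t0 t0b.
have [C C0 vC] := abs_continuous_bounded acv.
(* Integrating the weight produces the factor K / l, and summing over the coordinates a factor [n];
   this [l] makes n K / l at most 1/2. *)
pose l := 2 * n%:R * K + 1.
have l0 : 0 < l by rewrite /l ltr_wpDl// !mulr_ge0.
apply: enorm0_eq0.
apply: (@halving_le0 `[0, b] (fun t => enorm (v t)) (fun t => expR (l * t)) C) => //.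
- move=> t; rewrite /= in_itv/= => tb; apply: le_trans (vC _ tb) _.
  rewrite -[leLHS]mulr1 ler_wpM2l// -expR0 ler_expR mulr_ge0 ?(ltW l0)//.
  by case/andP : tb.
- move=> N N0 HN t; rewrite /= in_itv/= => /andP[t0' tb].
  have dE (s : R) : is_derive s (1 : R) (fun s => l^-1 * expR (l * s)) (expR (l * s)).
    have h : is_derive s (1 : R) (fun s : R => l * s) l.
      by rewrite -[X in is_derive _ _ _ X]mulr1; exact: is_deriveZ.
    have := is_deriveZ l^-1 (is_derive1_comp (is_derive_expR (l * s)) h).
    by rewrite /GRing.scale/= [X in _ * X]mulrC mulKf// gt_eqF.
  (* With [sg] equal to [1] or [- 1] this bounds the absolute value: the derivative of [sg * v_i] is
     at most [K * N * expR (l * s)], so subtracting a primitive of the latter leaves a function to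
     which [ac_derive_le0] applies. *)
  have key (sg : R) i : `|sg| = 1 -> sg * v t ord0 i <= K * N * (l^-1 * expR (l * t)).
    move=> sg1.
    have ach : ac_incr 0 t (incr (fun s => sg * v s ord0 i +
        (- (K * N)) * (l^-1 * expR (l * s)))).
      apply: ac_incrD; first by apply: ac_incrS (abs_continuous_coord i acv).
      apply: (@ac_incr_lipschitz _ _ _ _ (expR (l * t))) => x y /andP[x0 xt] /andP[y0 yt].
      wlog xy : x y x0 xt y0 yt / x <= y => [H|].
        have [|/ltW yx] := leP x y; first exact: H.
        by rewrite distrC (distrC y); exact: H.
      have cE : {within `[x, y], continuous (fun s : R => l^-1 * expR (l * s))}.
        apply: continuous_subspaceT => s; apply/differentiable_continuous.
        by apply/derivable1_diffP; have [] := dE s.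
      have [z] := MVT_segment xy (fun s _ => dE s) cE.
      rewrite in_itv/= => /andP[xz zy] ->.
      rewrite normrM ler_wpM2r// ger0_norm ?expR_ge0// ler_expR ler_wpM2l ?(ltW l0)//.
      exact: le_trans yt.
    have := @ac_derive_le0 _ 0 t _ t0' ach; rewrite v0 mxE mulr0 add0r => H.
    have {}H : sg * v t ord0 i + - (K * N) * (l^-1 * expR (l * t)) <=
        - (K * N) * (l^-1 * expR (l * 0)).
      apply: H; apply: ae_leb_imply dv _ => s Hs /andP[s0 st].
      have [|dvs /is_derive_rowP/(_ i) dvi Hdv] := Hs.
        by rewrite s0 (lt_le_trans st).
      exists (sg * dvs ord0 i + (- (K * N)) * expR (l * s)).
        exact: is_deriveD (is_deriveZ sg dvi) (is_deriveZ _ (dE s)).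
      rewrite mulNr subr_le0; apply: le_trans (ler_norm _) _.
      rewrite normrM sg1 mul1r; apply: le_trans (coord_le_enorm _ _) _.
      apply: le_trans Hdv _; rewrite -mulrA ler_wpM2l//; apply: HN.
      by rewrite /= in_itv/= (ltW s0) (ltW (lt_le_trans st tb)).
    have : 0 <= (K * N) * (l^-1 * expR (l * 0)).
      by rewrite !mulr_ge0 ?expR_ge0// invr_ge0 ltW.
    lra.
  have coordb i : `|v t ord0 i| <= K * N * (l^-1 * expR (l * t)).
    rewrite ler_norml; have := key 1 i (normr1 _).
    have := key (- 1) i; rewrite normrN normr1 => /(_ erefl).
    rewrite mulN1r mul1r; lra.
  apply: le_trans (enorm_le_sum _) _.
  apply: (@le_trans _ _ (\sum_(i < n) K * N * (l^-1 * expR (l * t)))).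
    by apply: ler_sum => i _; exact: coordb.
  rewrite sumr_const card_ord -[leLHS]mulr_natl.
  have -> : n%:R * (K * N * (l^-1 * expR (l * t))) =
    (n%:R * K / l) * N * expR (l * t) by ring.
  rewrite ler_wpM2r ?expR_ge0// mulrC ler_wpM2l// ler_pdivrMr//.
  rewrite /l; lra.
Qed.

End VectorAbsoluteContinuity.

(** * Continuous functions of measurable curves *)

Section VectorMeasurability.
Context {R : realType}.
Local Notation L := (lebesgueType R).

(** The part of [O] where [phi] exceeds [x] is open, hence a countable union of boxes with rational
    centres and radii 1/(k+1). Membership of (w1 s, w2 s) in a box is a finite number of conditions
    on coordinates. *)
Lemma measurable_comp_open n m (D : set R) (w1 : R -> 'rV[R]_n)
    (w2 : R -> 'rV[R]_m) (O : set ('rV[R]_n * 'rV[R]_m))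
    (phi : 'rV[R]_n * 'rV[R]_m -> R) :
  measurable (D : set L) -> leb_measurable D w1 -> leb_measurable D w2 ->
  open O -> (forall p, O p -> {for p, continuous phi}) ->
  (forall s, D s -> O (w1 s, w2 s)) ->
  measurable_fun (D : set L) (fun s : L => phi (w1 s, w2 s)).
Proof.
move=> mD m1 m2 oO cphi DO.
apply: (measurability _ (RGenOInfty.measurableE R)) => // _ [_ [x ->] <-].
pose V := [set p | O p /\ x < phi p].
have nV p : V p -> nbhs p V.
  move=> [Op xp]; have nO : nbhs p O by exact: open_nbhs_nbhs.
  have nphi : nbhs (phi p) `]x, +oo[%classic.
    apply: open_nbhs_nbhs; split; first exact: interval_open.
    by rewrite /= in_itv/= xp.
  have := cphi _ Op _ nphi; apply: filterS2 nO => q Oq; rewrite /= in_itv/= andbT.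
  by [].
(* An index is a pair of rational centres with a radius; being a countable type, it can be
   enumerated by [unpickle], whose value [None] contributes the empty set. *)
pose I := ('rV[rat]_n * 'rV[rat]_m * nat)%type.
pose nr (i : I) (p : 'rV[R]_n * 'rV[R]_m) :=
  (forall k, `|p.1 ord0 k - ratr (i.1.1 ord0 k)| < i.2.+1%:R^-1) /\
  (forall k, `|p.2 ord0 k - ratr (i.1.2 ord0 k)| < i.2.+1%:R^-1).
pose box (i : I) := D `&` [set s | nr i (w1 s, w2 s)].
pose good (o : option I) := if o is Some i then
  [set s | box i s /\ nr i `<=` V] else set0.
have -> : D `&` (fun s => phi (w1 s, w2 s)) @^-1` `]x, +oo[ =
    \bigcup_k good (unpickle k).
  apply/seteqP; split => [s [Ds]|s [k _]]; rewrite /= ?in_itv/= ?andbT.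
    move=> xs; have Vs : V (w1 s, w2 s) by split => //; exact: DO.
    have /nbhs_ballP[e /= e0 He] := nV _ Vs.
    have [k Hk] : exists k : nat, k.+1%:R^-1 < e / 2.
      have e20 : 0 < e / 2 by rewrite divr_gt0.
      near \oo => k; exists k; near: k.
      exact: (near_infty_natSinv_lt (PosNum e20)).
    have ratc (y : R) : exists q : rat, `|y - ratr q| < k.+1%:R^-1.
      have yk : y < y + k.+1%:R^-1 by rewrite ltrDl invr_gt0.
      have [q] := rat_in_itvoo yk; rewrite in_itv/= => /andP[yq qy].
      by exists q; rewrite distrC gtr0_norm ?subr_gt0// ltrBlDl.
    have /choice[c1 Hc1] : forall i, exists q : rat,
      `|w1 s ord0 i - ratr q| < k.+1%:R^-1 by move=> i; exact: ratc.
    have /choice[c2 Hc2] : forall i, exists q : rat,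
      `|w2 s ord0 i - ratr q| < k.+1%:R^-1 by move=> i; exact: ratc.
    pose i : I := (\row_j c1 j, \row_j c2 j, k).
    exists (pickle i); first exact: Logic.I.
    rewrite pickleK /=; split; first by split => //; split => j; rewrite mxE.
    move=> [p1 p2] [/= Hp1 Hp2]; apply: He.
    have near_ (y p q : R) : `|y - q| < k.+1%:R^-1 -> `|p - q| < k.+1%:R^-1 ->
        `|y - p| < e.
      move=> yq pq; have -> : y - p = (y - q) - (p - q) by ring.
      apply: le_lt_trans (ler_normB _ _) _.
      by rewrite (splitr e) ltrD// (lt_trans _ Hk).
    split; split => // i0 j; rewrite (ord1 i0).
      by apply: near_ (Hc1 j) _; have := Hp1 j; rewrite mxE.
    by apply: near_ (Hc2 j) _; have := Hp2 j; rewrite mxE.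
  case: (unpickle k) => [i [[Ds nrs] nrV]|[]]; split => //.
  by have [] := nrV _ nrs.
apply: bigcupT_measurable => k; case: (unpickle k) => [i|]; last exact: measurable0.
have [nrV|nrV] := pselect (nr i `<=` V); last first.
  by rewrite (_ : good _ = set0)//; apply/seteqP; split => // s [].
have -> : good (Some i) =
    (D `&` \bigcap_(j in [set: 'I_n]) (D `&` (fun s => w1 s ord0 j) @^-1`
       `]ratr (i.1.1 ord0 j) - i.2.+1%:R^-1, ratr (i.1.1 ord0 j) + i.2.+1%:R^-1[)) `&`
    \bigcap_(j in [set: 'I_m]) (D `&` (fun s => w2 s ord0 j) @^-1`
       `]ratr (i.1.2 ord0 j) - i.2.+1%:R^-1, ratr (i.1.2 ord0 j) + i.2.+1%:R^-1[).
  apply/seteqP; split => [s [[Ds [H1 H2]] _]|s [[Ds H1] H2]].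
    split; [split => // j _|move=> j _]; split => //=; rewrite in_itv/=.
      by have := H1 j; rewrite /= ltr_distl.
    by have := H2 j; rewrite /= ltr_distl.
  split => //; split => //; split => j /=.
    by have [_] := H1 j Logic.I; rewrite /= in_itv/= -ltr_distl.
  by have [_] := H2 j Logic.I; rewrite /= in_itv/= -ltr_distl.
apply: measurableI; first apply: measurableI => //.
  apply: fin_bigcap_measurable => // j _.
  by apply: m1 => //; exact: measurable_itv.
apply: fin_bigcap_measurable => // j _.
by apply: m2 => //; exact: measurable_itv.
Unshelve. all: by end_near. Qed.

End VectorMeasurability.

(** * Differentiation under the integral sign *)

Section DifferentiationUnderIntegral.
Context {R : realType}.
Local Notation L := (lebesgueType R).
Local Notation lebR := (@completed_lebesgue_measure R).

(** Dominated convergence for the difference quotients along sequences tending to zero. The limit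
    integrand [d] is measurable as a pointwise limit of the quotients. *)
Lemma derivable_itg (G : R -> R -> R) (a b t C e0 : R) : 0 < e0 ->
  (forall s, a <= s <= b -> derivable (G ^~ s) t 1) ->
  (forall h, `|h| < e0 -> bmeas `[a, b] (G (t + h))) ->
  (forall h s, `|h| < e0 -> a <= s <= b -> `|G (t + h) s - G t s| <= C * `|h|) ->
  derivable (fun x => itg (G x) a b) t 1.
Proof.
move=> e00 dG bG GC.
pose d s := 'D_1 (G ^~ s) t.
have key (w : nat -> R) : (forall k, w k != 0) -> (forall k, `|w k| < e0) ->
    w k @[k --> \oo] --> 0 ->
    itg (fun s => (w k)^-1 * (G (t + w k) s - G t s)) a b @[k --> \oo] --> itg d a b.
  move=> w0 we wcvg.
  have bq k : bmeas `[a, b] (fun s => (w k)^-1 * (G (t + w k) s - G t s)).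
    have bG0 : bmeas `[a, b] (G t) by have := bG 0; rewrite normr0 addr0; exact.
    have := bmeas_lin (w k)^-1 (- (w k)^-1) (leb_measurable_itv _) (bG _ (we k)) bG0.
    by congr (bmeas _); apply/funext => s; rewrite mulNr -mulrBr.
  have qcvg s : a <= s <= b ->
      (w k)^-1 * (G (t + w k) s - G t s) @[k --> \oo] --> d s.
    move=> sab; have := dG s sab.
    move=> /cvgr_dnbhsP/(_ w (conj w0 wcvg)); rewrite -/(d s).
    set f1 := (X in X @ _ --> _) => H; set f2 := (X in X @ _ --> _).
    suff -> : f2 = f1 by [].
    apply/funext => k; rewrite /f1 /f2 /shift/= [(w k)%:A]mulr1 (addrC (w k)).
    by [].
  have [] := @dominated_convergence _ L R lebR `[a, b] (leb_measurable_itv _)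
    (fun k s => ((w k)^-1 * (G (t + w k) s - G t s))%:E) (fun s => (d s)%:E)
    (fun=> (`|C|)%:E).
  - by move=> k; apply/measurable_EFinP; have [] := bq k.
  - apply/measurable_EFinP.
    apply: (@measurable_fun_cvg _ L R `[a, b]%classic
      (fun k s => (w k)^-1 * (G (t + w k) s - G t s))) => [k|s].
      by have [] := bq k.
    by rewrite /= in_itv/=; exact: qcvg.
  - apply: aeW => s; rewrite /= in_itv/= => sab.
    by apply: cvg_EFin; [exact: nearW|exact: qcvg].
  - exact: (bmeas_integrable (bmeas_cst _ `|C|)).
  - apply: aeW => s k; rewrite /= in_itv/= => sab; rewrite lee_fin normrM normfV.
    rewrite ler_pdivrMl ?normr_gt0// mulrC; apply: le_trans (GC _ _ (we k) sab) _.
    by rewrite ler_wpM2r// ler_norm.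
  move=> id _ dcv; rewrite /itg /Rintegral.
  apply: fine_cvg; rewrite fineK; first exact: dcv.
  apply: integrable_fin_num id; exact: leb_measurable_itv.
apply/cvg_ex; exists (itg d a b); apply/cvgr_dnbhsP => u [u0 ucvg].
(* The first terms of [u] may leave the range where the domination holds; only finitely many are
   replaced, so the limit is unaffected. *)
pose w k := if `|u k| < e0 then u k else e0 / 2.
have w0 k : w k != 0 by rewrite /w; case: ifP => // _; rewrite gt_eqF// divr_gt0.
have we k : `|w k| < e0.
  by rewrite /w; case: ifP => // _; rewrite gtr0_norm ?divr_gt0//; lra.
have uw : \forall k \near \oo, u k = w k.
  by near=> k; rewrite /w ifT//; near: k; exact: cvgr0_norm_lt.
have wcvg : w k @[k --> \oo] --> 0.
  by apply: cvg_trans ucvg; apply: near_eq_cvg; near=> k; near: k.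
have := key w w0 we wcvg; apply: cvg_trans; apply: near_eq_cvg; near=> k.
have -> : w k = u k by apply/esym; near: k.
have uk : `|u k| < e0 by near: k; exact: cvgr0_norm_lt.
have bG0 : bmeas `[a, b] (G t) by have := bG 0; rewrite normr0 addr0; exact.
have := itg_lin (u k)^-1 (- (u k)^-1) (bG _ uk) bG0.
rewrite /shift/= [(u k)%:A]mulr1 (addrC (u k)) scalerBr mulNr => <-.
by congr (itg _ _ _); apply/funext => s; rewrite mulNr -mulrBr.
Unshelve. all: by end_near. Qed.

Lemma is_derive0_enorm n (x : R -> 'rV[R]_n) (t : R) :
  (forall e, 0 < e -> exists2 d : R, 0 < d & forall h, `|h| < d ->
    enorm (x (t + h) - x t) <= e * `|h|) -> is_derive t (1 : R) x 0.
Proof.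
move=> H; apply/is_derive_rowP => i; rewrite mxE.
have c : h^-1 *: (((fun s => x s ord0 i) \o shift t) (h *: 1) - x t ord0 i)
    @[h --> 0^'] --> (0 : R).
  apply/cvgrPdist_le => e e0; have [d d0 Hd] := H _ e0.
  exists d => // h /=; rewrite sub0r normrN => hd h0.
  rewrite sub0r normrN /shift/= [h%:A]mulr1 (addrC h) normrM normfV.
  rewrite ler_pdivrMl ?normr_gt0// mulrC; apply: le_trans (Hd _ hd).
  by have := coord_le_enorm (x (t + h) - x t) i; rewrite !mxE.
apply: DeriveDef; first by apply/cvg_ex; exists 0.
exact: cvg_lim.
Qed.

Lemma ae_forall_ord n (P : 'I_n -> R -> Prop) :
  (forall i, {ae lebR, forall t, P i t}) -> {ae lebR, forall t, forall i, P i t}.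
Proof.
move=> H; pose A (k : nat) : set R :=
  if insub k is Some i then ~` [set t | P i t] else set0.
have nA : lebR.-negligible (\bigcup_k A k).
  apply: negligible_bigcup => k; rewrite /A; case: insubP => [i _ _|_].
    exact: H.
  exact: negligible_set0.
apply: negligibleS nA => t /= /existsNP[i Pi].
by exists i => //; rewrite /A valK.
Qed.

Lemma derivable_row_near n (x : R -> 'rV[R]_n) (t : R) : derivable x t 1 ->
  exists2 C, 0 <= C & exists2 d : R, 0 < d & forall h, `|h| < d ->
    enorm (x (t + h) - x t) <= C * `|h|.
Proof.
move=> dx; have H (i : 'I_n) : exists p : R * R, [/\ 0 <= p.1, 0 < p.2 &
    forall h, `|h| < p.2 -> `|x (t + h) ord0 i - x t ord0 i| <= p.1 * `|h|].
  have dxi := (derivable_mxP x t 1).1 dx ord0 i.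
  have := is_derive_quotient (derivableP dxi) ltr01.
  set l := derive _ _ _ => -[d d0 Hd]; exists (`|l| + 1, d); split => //=.
  move=> h hd; have [->|h0] := eqVneq h 0; first by rewrite addr0 subrr normr0 mulr0.
  have := Hd h h0 hd; set q := x _ _ _ - _ => ql.
  have : `|h^-1 * q| <= `|l| + 1.
    have := ler_normD (h^-1 * q - l) l; rewrite subrK => /le_trans; apply.
    by rewrite addrC lerD2l ltW.
  by rewrite normrM normfV ler_pdivrMl ?normr_gt0// mulrC.
have /choice[p Hp] := H.
exists (\sum_(i < n) (p i).1); first by apply: sumr_ge0 => i _; have [] := Hp i.
exists (\big[Num.min/1]_(i < n) (p i).2).
  by apply/bigmin_gtP; split => // i _; have [] := Hp i.
move=> h hd; apply: le_trans (enorm_le_sum _) _; rewrite mulr_suml.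
apply: ler_sum => i _; have [_ _ Hi] := Hp i; rewrite !mxE; apply: Hi.
by apply: lt_le_trans hd _; exact: bigmin_le.
Qed.

End DifferentiationUnderIntegral.

(** * The predictor integral and its Volterra equation *)

(* [F y s xi] abstracts the integrand f(q(|xi|/psi(y)) xi, u(s - r + delta)). *)
Record predictor_field (R : realType) (n : nat)
    (F : 'rV[R]_n -> R -> 'rV[R]_n -> 'rV[R]_n) (dl : R) : Prop := {
  field_bounded : forall rho, exists2 C, 0 <= C &
    forall y s xi, enorm y <= rho -> - dl <= s -> enorm (F y s xi) <= C;
  field_lipschitz : forall B, exists2 C, 0 <= C &
    forall y y' s xi xi', enorm y <= B -> enorm y' <= B -> enorm xi <= B ->
      enorm xi' <= B -> - dl <= s ->
      enorm (F y s xi - F y' s xi') <= C * (enorm (y - y') + enorm (xi - xi'));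
  field_measurable : forall (D : set R) (y xi : R -> 'rV[R]_n),
    measurable (D : set (lebesgueType R)) -> D `<=` `[- dl, +oo[ ->
    leb_measurable D y -> leb_measurable D xi ->
    leb_measurable D (fun s => F (y s) s (xi s));
  field_derivable : forall (y : R -> 'rV[R]_n) (t s : R) (xi : 'rV[R]_n), - dl <= s ->
    derivable y t 1 -> derivable (fun x => F (y x) s xi) t 1 }.

Section PredictorIntegral.
Context {R : realType} {n : nat}.
Local Notation L := (lebesgueType R).
Local Notation lebR := (@completed_lebesgue_measure R).
Local Notation V := 'rV[R]_n.

Context (F : V -> R -> V -> V) (dl : R) (dl0 : 0 <= dl) (HF : predictor_field F dl).
Implicit Types (a b c d s t : R) (y : V) (z xi : R -> V).

Definition predF z xi t : V := vint (fun s => F (z t) s (xi s)) (t - dl) t.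

(** A cumulative integral with frozen parameter [y]. The predictor integral is a difference of two
    of these, which separates the dependence on the parameter from that on the endpoints. *)
Definition curF xi y t : V := vint (fun s => F y s (xi s)) (- dl) t.

Lemma leb_measurableS (D E : set R) xi : measurable (E : set L) -> D `<=` E ->
  leb_measurable E xi -> leb_measurable D xi.
Proof. by move=> mE DE h i; exact: measurable_funS (h i). Qed.

Lemma leb_measurable_itvS a b c d xi : a <= c -> d <= b ->
  leb_measurable `[a, b] xi -> leb_measurable `[c, d] xi.
Proof.
move=> ac db; apply: leb_measurableS; first exact: leb_measurable_itv.
by move=> t; rewrite /= !in_itv/= => /andP[? ?]; apply/andP; split; lra.
Qed.

Lemma field_bmeasv c d y xi : - dl <= c -> leb_measurable `[c, d] xi ->
  bmeasv `[c, d] (fun s => F y s (xi s)).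
Proof.
move=> dc mxi; have [C _ HC] := field_bounded HF (enorm y).
have sub : `[c, d] `<=` `[- dl, +oo[.
  by move=> s; rewrite /= !in_itv/= andbT => /andP[cs _]; exact: le_trans cs.
apply: (@bmeasvP _ _ _ _ C).
  apply: (field_measurable HF (y := cst y)) => //.
  exact: leb_measurable_itv.
by move=> s /sub; rewrite /= in_itv/= andbT => ds; exact: HC.
Qed.

Context (b : R) (xi : R -> V) (B : R).
Hypothesis mxi : leb_measurable `[- dl, b] xi.
Hypothesis xiB : forall s, - dl <= s <= b -> enorm (xi s) <= B.

Lemma field_bmeasv_itv c d y : - dl <= c -> d <= b ->
  bmeasv `[c, d] (fun s => F y s (xi s)).
Proof. by move=> dc db; exact: (field_bmeasv _ dc
  (leb_measurable_itvS dc db mxi)). Qed.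

Lemma curF_incr y s t : - dl <= s -> s <= t -> t <= b ->
  curF xi y t - curF xi y s = vint (fun x => F y x (xi x)) s t.
Proof.
move=> ds st tb; rewrite /curF (vint_split ds st); last exact: field_bmeasv_itv.
by rewrite addrC addKr.
Qed.

Lemma predF_curF z t : 0 <= t <= b ->
  predF z xi t = curF xi (z t) t - curF xi (z t) (t - dl).
Proof.
move=> /andP[t0 tb]; have h1 : - dl <= t - dl by lra.
have h2 : t - dl <= t by rewrite gerBl.
by rewrite (curF_incr _ h1 h2 tb).
Qed.

Lemma curF_lipschitz rho : exists2 C, 0 <= C &
  forall y y' t t', enorm y <= rho -> enorm y' <= rho ->
    - dl <= t <= b -> - dl <= t' <= b ->
    enorm (curF xi y t - curF xi y' t') <= C * (enorm (y - y') + `|t - t'|).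
Proof.
have [C C0 HC] := field_bounded HF rho.
have [K K0 HK] := field_lipschitz HF (Num.max rho B).
pose b' := `|b + dl|.
have b'0 : 0 <= b' by exact: normr_ge0.
exists (K * b' + C); first by rewrite addr_ge0// mulr_ge0.
move=> y y' t t' yr yr' tb tb'.
have -> : curF xi y t - curF xi y' t' =
  (curF xi y t - curF xi y' t) + (curF xi y' t - curF xi y' t').
  by rewrite subrKA.
apply: le_trans (enormD _ _) _; rewrite [leRHS]mulrDr lerD//.
  case/andP : tb => dt tb.
  rewrite /curF vintB; [|exact: field_bmeasv_itv|exact: field_bmeasv_itv].
  apply: (@le_trans _ _ (K * enorm (y - y') * (t - - dl))).
    apply: enorm_vint_bound; [exact: dt| |].
      by apply: bmeasvB; [exact: leb_measurable_itv|exact: field_bmeasv_itv|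
        exact: field_bmeasv_itv].
    move=> s /andP[ds st]; apply: le_trans (HK _ _ _ _ _ _ _ _ _ _) _ => //;
      rewrite ?le_max ?yr ?yr' ?xiB ?orbT ?ds ?(le_trans st)//.
    by rewrite subrr enorm0 addr0.
  rewrite mulrAC ler_wpM2r ?enorm_ge0//.
  apply: (@le_trans _ _ (K * b')); last by rewrite lerDl.
  rewrite ler_wpM2l// /b' ger0_norm; lra.
wlog tt : t t' tb tb' / t' <= t => [H|].
  have [/H|/ltW/H] := leP t' t; first exact.
  by rewrite enormBC distrC; exact.
case/andP : tb tb' => dt tb /andP[dt' tb'].
rewrite curF_incr// ger0_norm ?subr_ge0//.
apply: (@le_trans _ _ (C * (t - t'))).
  apply: enorm_vint_bound; [exact: tt|exact: field_bmeasv_itv|].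
  by move=> s /andP[s1 s2]; apply: HC; [exact: yr'|exact: le_trans s1].
by rewrite ler_wpM2r ?subr_ge0// lerDr mulr_ge0.
Qed.

Lemma predF_incr z rho : (forall t, 0 <= t <= b -> enorm (z t) <= rho) ->
  exists2 C, 0 <= C & forall s t, 0 <= s <= b -> 0 <= t <= b ->
    enorm (predF z xi t - predF z xi s) <= C * (enorm (z t - z s) + `|t - s|).
Proof.
move=> zr; have dl0' := dl0; have [C C0 HC] := curF_lipschitz rho.
exists (C + C) => [|s t sb tb]; first exact: addr_ge0.
have sh c : 0 <= c <= b -> (- dl <= c <= b) && (- dl <= c - dl <= b).
  by move=> /andP[c0 cb]; do 2?[apply/andP; split]; lra.
have /andP[sb1 sb2] := sh s sb; have /andP[tb1 tb2] := sh t tb.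
have E (A1 A2 A3 A4 : V) : A1 - A2 - (A3 - A4) = (A1 - A3) - (A2 - A4).
  by apply/rowP => i; rewrite !mxE; ring.
rewrite !predF_curF// E.
apply: le_trans (enormB _ _) _; rewrite mulrDl lerD//.
  by apply: HC => //; exact: zr.
have := HC (z t) (z s) (t - dl) (s - dl) (zr _ tb) (zr _ sb) tb2 sb2.
by rewrite opprB addrA subrK.
Qed.

Lemma predF_abs_continuous z : abs_continuous 0 b z ->
  abs_continuous 0 b (predF z xi).
Proof.
move=> acz; have [rho _ zr] := abs_continuous_bounded acz.
have [C C0 HC] := predF_incr zr.
apply: (abs_continuous_dom (C := C) acz (abs_continuous_cst 0 b (0 : V))).
move=> s t s0 st tb; rewrite subrr enorm0 addr0 -[t - s]ger0_norm ?subr_ge0//.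
by apply: HC; rewrite ?s0 ?tb ?(le_trans s0 st) ?(le_trans st tb).
Qed.

Lemma curF_derivable z t c : 0 <= t -> - dl <= c <= b ->
  (forall i, {within `[0, b], continuous (fun x => z x ord0 i)}) ->
  derivable z t 1 -> derivable (fun x => curF xi (z x) c) t 1.
Proof.
move=> t0 /andP[dc cb] cz dz; apply/derivable_mxP => i j; rewrite (ord1 i) {i}.
have [C C0 [e e0 He]] := derivable_row_near dz.
(* A ball containing [xi] and all [z (t + h)] with |h| < e, so that one Lipschitz constant of the
   field dominates the quotients. *)
pose B' := Num.max B (enorm (z t) + C * e).
have [K K0 HK] := field_lipschitz HF B'.
rewrite [X in derivable X](_ : _ = fun x =>
  itg (fun s => F (z x) s (xi s) ord0 j) (- dl) c); last first.
  by apply/funext => x; rewrite mxE.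
apply: (@derivable_itg _ (fun x s => F (z x) s (xi s) ord0 j) _ _ _ (K * C) e).
- exact: e0.
- move=> s /andP[ds sc].
  exact: ((derivable_mxP (fun x => F (z x) s (xi s)) t 1).1
    (field_derivable HF ds dz) ord0 j).
- by move=> h he; exact: (field_bmeasv_itv _ (lexx _) cb).
- move=> h s he /andP[ds sc].
  have := coord_le_enorm (F (z (t + h)) s (xi s) - F (z t) s (xi s)) j.
  rewrite !mxE => /le_trans; apply.
  have sb : enorm (xi s) <= B' by rewrite le_max xiB// ds (le_trans sc).
  have zt : enorm (z t) <= B'.
    by rewrite le_max lerDl mulr_ge0 ?orbT// ltW.
  have zth : enorm (z (t + h)) <= B'.
    rewrite le_max; apply/orP; right.
    have := enormD (z (t + h) - z t) (z t); rewrite subrK => /le_trans; apply.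
    rewrite addrC lerD2l; apply: le_trans (He _ he) _.
    by rewrite ler_wpM2l// ltW.
  apply: le_trans (HK _ _ _ _ _ zth zt sb sb ds) _.
  by rewrite subrr enorm0 addr0 -mulrA ler_wpM2l// He.
Qed.

(* The moving endpoint is handled by comparison with the primitive of
   [s |-> F (z (s + c)) s (xi s)], which is differentiable almost everywhere. *)
Lemma curF_shift_derivable z c : 0 <= c <= dl -> abs_continuous 0 b z ->
  {ae lebR, forall t, 0 < t < b -> derivable z t 1} ->
  {ae lebR, forall t, 0 < t < b -> derivable (fun x => curF xi (z x) (x - c)) t 1}.
Proof.
move=> /andP[c0 cdl] acz dz; have dl0' := dl0.
have cz i := @abs_continuous_within _ _ _ _ _ i acz.
have [rho rho0 zr] := abs_continuous_bounded acz.
have [C C0 HC] := field_bounded HF rho.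
have [K K0 HK] := field_lipschitz HF (Num.max rho B).
pose g s := F (z (s + c)) s (xi s).
have subc : `[- c, b - c] `<=` `[- dl, +oo[.
  by move=> s; rewrite /= !in_itv/= andbT => /andP[? ?]; lra.
have mzc : leb_measurable `[- c, b - c] (fun s => z (s + c)).
  move=> i; have := leb_measurable_translate (c := c) (leb_measurable_continuous (cz i)).
  apply: measurable_funS.
    by apply: leb_measurable_set_translate; exact: leb_measurable_itv.
  by move=> s; rewrite /= !in_itv/= => /andP[? ?]; apply/andP; split; lra.
have bg : bmeasv `[- c, b - c] g.
  apply: (@bmeasvP _ _ _ _ C).
    have dc : - dl <= - c by lra.
    have cb : b - c <= b by lra.
    exact: (field_measurable HF (leb_measurable_itv _) subc mzc
      (leb_measurable_itvS dc cb mxi)).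
  move=> s; rewrite /= in_itv/= => /andP[s1 s2]; apply: HC; last lra.
  by apply: zr; apply/andP; split; lra.
have := ae_forall_ord (fun i => itg_derive_ae (bg i)).
move=> /(@ae_leb_translate _ (- c)) dphi.
apply: ae_leb_imply2 dz dphi _ => t dzt dphit /andP[t0 tb].
have {}dzt := dzt (introT andP (conj t0 tb)).
pose phi x := vint g (- c) x.
have {}dphit : derivable (fun x => phi (x - c)) t 1.
  have : is_derive (t - c) (1 : R) phi (g (t - c)).
    apply/is_derive_rowP => i.
    have -> : (fun s => phi s ord0 i) = itg (fun s => g s ord0 i) (- c).
      by apply/funext => s; rewrite mxE.
    by apply: dphit; apply/andP; split; lra.
  move=> dphi1; apply/derivable_mxP => i j; rewrite (ord1 i) {i}.
  have /is_derive_rowP/(_ j) dj := dphi1.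
  have ds : is_derive t (1 : R) (fun x : R => x - c) 1.
    by apply: is_derive_eq (addr0 _); exact: is_deriveB.
  by have [] := @is_derive1_comp _ (fun s => phi s ord0 j) (fun x => x - c) t _ _ dj ds.
have dA : derivable (fun x => curF xi (z x) (t - c)) t 1.
  by apply: curF_derivable => //; [exact: ltW|apply/andP; split; lra].
have dE : derivable (fun x => curF xi (z x) (x - c) -
    (curF xi (z x) (t - c) + phi (x - c))) t 1.
  suff : is_derive t (1 : R) (fun x => curF xi (z x) (x - c) -
    (curF xi (z x) (t - c) + phi (x - c))) 0 by case.
  apply: is_derive0_enorm => e e0.
  have [Cz Cz0 [d1 d10 Hd1]] := derivable_row_near dzt.
  pose M := 2 * Cz * K + 1.
  have M0 : 0 < M by rewrite /M ltr_wpDl// !mulr_ge0.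
  (* In order: the linear bound on [z] near [t] is valid, the integrand is at most [e], and [t + h]
     stays between [0] and [b]. *)
  pose d := Num.min (Num.min d1 (e / M)) (Num.min t (b - t)).
  have d0 : 0 < d by rewrite !lt_min d10 divr_gt0//= t0 subr_gt0.
  exists d => // h; rewrite !lt_min => /andP[/andP[hd1 heM] /andP[ht hbt]].
  have [h1 h2] : - h <= `|h| /\ h <= `|h| by rewrite ler_norm -normrN ler_norm.
  have thb : 0 <= t + h <= b by apply/andP; split; lra.
  have bd s s' : t - `|h| <= s -> s <= t + `|h| -> 0 <= s <= b ->
      - dl <= s' <= b -> enorm (F (z (t + h)) s' (xi s') - F (z s) s' (xi s')) <= e.
    move=> s1 s2 sb /andP[s'1 s'2].
    apply: le_trans (HK _ _ _ _ _ _ _ _ _ s'1) _; rewrite ?le_max ?zr ?orTb//.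
      by rewrite xiB ?orbT// s'1.
      by rewrite xiB ?orbT// s'1.
    rewrite subrr enorm0 addr0.
    have -> : z (t + h) - z s = (z (t + h) - z t) - (z (t + (s - t)) - z t).
      by rewrite [t + (s - t)]addrC subrK opprB addrA subrK.
    have st : `|s - t| <= `|h| by rewrite ler_norml; apply/andP; split; lra.
    apply: (@le_trans _ _ (K * (Cz * `|h| + Cz * `|h|))).
      rewrite ler_wpM2l//; apply: le_trans (enormB _ _) _; rewrite lerD ?Hd1//.
      apply: le_trans (Hd1 _ (le_lt_trans st hd1)) _.
      by rewrite ler_wpM2l.
    have := ltW heM; rewrite ler_pdivlMr// /M; have := normr_ge0 h; nra.
  have phiI s s' : - c <= s -> s <= s' -> s' <= b - c ->
      phi s' - phi s = vint g s s'.
    move=> cs ss sb; rewrite /phi (vint_split cs ss); last first.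
      exact: bmeasv_itvS (lexx _) sb bg.
    by rewrite addrC addKr.
  have EE (A1 A2 A3 p1 p2 : V) :
      A1 - (A2 + p1) - (A3 - (A3 + p2)) = (A1 - A2) - (p1 - p2).
    by apply/rowP => i; rewrite !mxE; ring.
  rewrite EE.
  have key s s' : s <= s' -> - c <= s -> s' <= b - c -> s' - s = `|h| ->
      t - `|h| <= s + c -> s' + c <= t + `|h| ->
      enorm (vint (fun x => F (z (t + h)) x (xi x)) s s' - vint g s s') <= e * `|h|.
    move=> ss sc sb hE s1 s2; rewrite -[X in e * X]hE.
    have bgs : bmeasv `[s, s'] g by exact: bmeasv_itvS sc sb bg.
    have bFs : bmeasv `[s, s'] (fun x => F (z (t + h)) x (xi x)).
      by apply: field_bmeasv_itv; lra.
    rewrite vintB; [|exact: bFs|exact: bgs].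
    apply: enorm_vint_bound; first exact: ss.
      by apply: bmeasvB; [exact: leb_measurable_itv|exact: bFs|exact: bgs].
    move=> x /andP[sx xs]; apply: bd; first lra.
    - lra.
    - by apply/andP; split; lra.
    - by apply/andP; split; lra.
  (* Since integrals are not oriented, a negative increment is handled by exchanging the
     endpoints. *)
  have [h0|/ltW h0] := leP 0 h.
    have hE : `|h| = h by rewrite ger0_norm.
    have l1 : - dl <= t - c by lra.
    have l2 : t - c <= t + h - c by lra.
    have l3 : t + h - c <= b by lra.
    have l4 : - c <= t - c by lra.
    have l5 : t + h - c <= b - c by lra.
    rewrite (curF_incr _ l1 l2 l3) (phiI _ _ l4 l2 l5).
    by apply: (key _ _ l2 l4 l5); rewrite hE; lra.
  have hE : `|h| = - h by rewrite ler0_norm.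
  have l1 : - dl <= t + h - c by lra.
  have l2 : t + h - c <= t - c by lra.
  have l3 : t - c <= b by lra.
  have l4 : - c <= t + h - c by lra.
  have l5 : t - c <= b - c by lra.
  have EN (A1 A2 p1 p2 : V) : A1 - A2 - (p1 - p2) = - ((A2 - A1) - (p2 - p1)).
    by apply/rowP => i; rewrite !mxE; ring.
  rewrite (EN (curF xi (z (t + h)) (t + h - c)) (curF xi (z (t + h)) (t - c))
    (phi (t + h - c)) (phi (t - c))) enormN (curF_incr _ l1 l2 l3) (phiI _ _ l4 l2 l5).
  by apply: (key _ _ l2 l4 l5); rewrite hE; lra.
have E (f1 f2 f3 : R -> V) : f1 = (f2 \+ f3) \+ (fun x => f1 x - (f2 x + f3 x)).
  by apply/funext => x /=; rewrite addrC subrK.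
rewrite (E (fun x => curF xi (z x) (x - c)) (fun x => curF xi (z x) (t - c))
  (fun x => phi (x - c))).
exact: (derivableD (derivableD dA dphit) dE).
Qed.

(** The shifts [c = 0] and [c = dl] of [curF_shift_derivable] give the two moving ends of the
    window. *)
Lemma predF_derivable z : abs_continuous 0 b z ->
  {ae lebR, forall t, 0 < t < b -> derivable z t 1} ->
  {ae lebR, forall t, 0 < t < b -> derivable (predF z xi) t 1}.
Proof.
move=> acz dz.
have c0 : (0 : R) <= 0 <= dl := introT andP (conj (lexx _) dl0).
have cdl : 0 <= dl <= dl := introT andP (conj dl0 (lexx _)).
apply: ae_leb_imply2 (curF_shift_derivable c0 acz dz)
  (curF_shift_derivable cdl acz dz) _ => t d1 d2 tb.
have := derivableB (d1 tb) (d2 tb).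
apply: near_eq_derivable.
have : t \in `]0, b[ by rewrite in_itv.
move/near_in_itvoo; apply: filterS => x; rewrite in_itv/= => /andP[x0 xb].
have xb' : 0 <= x <= b := introT andP (conj (ltW x0) (ltW xb)).
rewrite (predF_curF z xb').
have -> : curF xi (z x) x = curF xi (z x) (x - 0) by rewrite subr0.
by [].
Qed.

End PredictorIntegral.

(** * Existence and uniqueness for the Volterra equation *)

Section Volterra.
Context {R : realType} {n : nat}.
Local Notation L := (lebesgueType R).
Local Notation lebR := (@completed_lebesgue_measure R).
Local Notation V := 'rV[R]_n.
Implicit Types (a b c s t : R).

Lemma expRN_lipschitz (mu s t : R) : 0 <= mu -> 0 <= s -> s <= t ->
  `|expR (- mu * t) - expR (- mu * s)| <= mu * (t - s).
Proof.
move=> mu0 s0 st.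
have -> : - mu * t = - mu * s + - (mu * (t - s)) by ring.
rewrite expRD -{2}[expR (- mu * s)]mulr1 -mulrBr normrM.
have h0 : 0 <= mu * (t - s) by rewrite mulr_ge0// subr_ge0.
have e1 : expR (- mu * s) <= 1 by rewrite -expR0 ler_expR mulNr oppr_le0 mulr_ge0.
have e2 : expR (- (mu * (t - s))) <= 1 by rewrite -expR0 ler_expR oppr_le0.
have e3 := expR_ge1Dx (- (mu * (t - s))).
rewrite ger0_norm ?expR_ge0// ler0_norm ?subr_le0//.
apply: (@le_trans _ _ (1 * (mu * (t - s)))); last by rewrite mul1r.
apply: ler_pM => //.
- by rewrite oppr_ge0 subr_le0.
- by rewrite opprB; move: e3; set x := mu * _; set y := expR _; lra.
Qed.

Lemma geometric_le0 (x C : R) : (forall k, x <= C / 2 ^+ k) -> x <= 0.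
Proof.
move=> H; rewrite leNgt; apply/negP => x0.
have C0 : 0 <= C by have := H 0%N; rewrite expr0 divr1; lra.
have := archi_boundP (divr_ge0 C0 (ltW x0)); set k := Num.bound _ => Hk.
have := H k; apply/negP; rewrite -ltNge ltr_pdivrMr ?exprn_gt0//.
apply: (@lt_le_trans _ _ (k%:R * x)); first by rewrite -ltr_pdivrMr.
rewrite mulrC ler_wpM2l ?(ltW x0)// -natrX ler_nat; exact/ltnW/ltn_expl.
Qed.

(** The intervals of radius 2 c / 2^k around [u k] are nested, and the supremum of their left ends
    belongs to all of them. *)
Lemma geometric_limit (u : nat -> R) (c : R) :
  (forall k, `|u k.+1 - u k| <= c / 2 ^+ k) ->
  exists l, forall k, `|l - u k| <= 2 * c / 2 ^+ k.
Proof.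
move=> H; pose a k := u k - 2 * c / 2 ^+ k; pose b k := u k + 2 * c / 2 ^+ k.
have c0 : 0 <= c by have := H 0%N; rewrite expr0 divr1; apply: le_trans.
have E k : 2 * c / 2 ^+ k.+1 = c / 2 ^+ k.
  by rewrite exprS invfM mulrACA divff// mul1r.
have E2 k : 2 * c / 2 ^+ k = c / 2 ^+ k + c / 2 ^+ k by rewrite -mulrA mulr_natl mulr2n.
have am k j : a k <= a (k + j)%N.
  elim: j => [|j IH]; first by rewrite addn0.
  apply: le_trans IH _; rewrite addnS /a E E2.
  have := H (k + j)%N; rewrite ler_norml => /andP[h _]; lra.
have bm k j : b (k + j)%N <= b k.
  elim: j => [|j IH]; first by rewrite addn0.
  apply: le_trans _ IH; rewrite addnS /b E E2.
  have := H (k + j)%N; rewrite ler_norml => /andP[_ h]; lra.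
have ab k j : a k <= b j.
  apply: le_trans (am k j) _; rewrite addnC; apply: le_trans _ (bm j k).
  have : 0 <= 2 * c / 2 ^+ (j + k) by rewrite divr_ge0 ?mulr_ge0// exprn_ge0.
  rewrite /a /b; lra.
exists (sup (range a)) => k.
have h1 : a k <= sup (range a).
  by apply: ub_le_sup; [exists (b 0%N) => _ [j _ <-]|exists k].
have h2 : sup (range a) <= b k.
  by apply: ge_sup; [exists (a 0%N); exists 0%N|move=> _ [j _ <-]].
move: h1 h2; rewrite /a /b ler_norml; lra.
Qed.

Lemma geometric_cvg (u : nat -> R) (l c : R) :
  (forall k, `|l - u k| <= c / 2 ^+ k) -> u k @[k --> \oo] --> l.
Proof.
move=> H; apply/cvgrPdist_le => e e0.
have c0 : 0 <= c by have := H 0%N; rewrite expr0 divr1; apply: le_trans.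
have := archi_boundP (divr_ge0 c0 (ltW e0)); set k := Num.bound _ => Hk.
exists k => // j /= kj; apply: le_trans (H j) _.
rewrite ler_pdivrMr ?exprn_gt0//; apply: (@le_trans _ _ (k%:R * e)).
  by rewrite -ler_pdivrMr// ltW.
rewrite mulrC ler_wpM2l ?(ltW e0)// -natrX ler_nat.
exact: leq_trans kj (ltnW (ltn_expl _ _)).
Qed.

Context (F : V -> R -> V -> V) (dl : R) (dl0 : 0 <= dl) (HF : predictor_field F dl).
Implicit Types (z xi : R -> V).

(** With Lipschitz constant [K] in [xi], the difference is at most the integral of K N exp(l s),
    hence at most (K / l) N exp(l t), and l = 2 K + 1 gives K / l <= 1/2. The weight depends on
    [rho] and [B] only, not on the time [t]. *)
Lemma predF_contraction rho B : exists2 l : R, 0 < l &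
  forall z xi1 xi2 t N, 0 <= t -> 0 <= N -> enorm (z t) <= rho ->
    leb_measurable `[t - dl, t] xi1 -> leb_measurable `[t - dl, t] xi2 ->
    (forall s, t - dl <= s <= t -> [/\ enorm (xi1 s) <= B, enorm (xi2 s) <= B &
      enorm (xi1 s - xi2 s) <= N * expR (l * s)]) ->
    enorm (predF F dl z xi1 t - predF F dl z xi2 t) <= N / 2 * expR (l * t).
Proof.
have [K K0 HK] := field_lipschitz HF (Num.max rho B).
pose l := 2 * K + 1; have l0 : 0 < l by rewrite /l ltr_wpDl// mulr_ge0.
exists l => // z xi1 xi2 t N t0 N0 zr m1 m2 H.
have tdt : t - dl <= t by rewrite gerBl.
have dlt : - dl <= t - dl by rewrite lerDr.
have b1 := field_bmeasv HF (z t) dlt m1; have b2 := field_bmeasv HF (z t) dlt m2.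
rewrite /predF vintB; [|exact: b1|exact: b2].
have ce : bmeas `[t - dl, t] (fun s => expR (l * s)).
  apply: bmeas_continuous; apply: continuous_subspaceT => s.
  apply: continuous_comp; last exact: continuous_expR.
  by apply: cvgM; [exact: cvg_cst|exact: cvg_id].
apply: (@le_trans _ _
  (itg (fun s => (K * N) * expR (l * s) + 0 * expR (l * s)) (t - dl) t)).
  apply: enorm_vint_le.
  - by apply: bmeasvB; [exact: leb_measurable_itv|exact: b1|exact: b2].
  - by apply: bmeas_lin; [exact: leb_measurable_itv|exact: ce|exact: ce].
  - move=> s st; have [h1 h2 h3] := H s st.
    have ds : - dl <= s by case/andP : st => + _; exact: le_trans.
    apply: (@le_trans _ _ (K * (enorm (z t - z t) + enorm (xi1 s - xi2 s)))).
      by apply: HK; rewrite // le_max ?zr ?h1 ?h2 ?orbT.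
    rewrite subrr enorm0 add0r mul0r addr0 -mulrA ler_wpM2l//.
rewrite itg_lin; [|exact: ce|exact: ce].
rewrite mul0r addr0 itg_expR ?gt_eqF//.
have KN : 0 <= K * N by rewrite mulr_ge0.
apply: (@le_trans _ _ ((K * N) * (expR (l * t) / l))).
  by rewrite ler_wpM2l// ler_pM2r ?invr_gt0// lerBlDr lerDl expR_ge0.
have -> : K * N * (expR (l * t) / l) = (K / l) * (N * expR (l * t)) by ring.
have -> : N / 2 * expR (l * t) = 2^-1 * (N * expR (l * t)) by ring.
apply: ler_wpM2r; first by rewrite mulr_ge0 ?expR_ge0.
by rewrite ler_pdivrMr// /l; lra.
Qed.

Lemma volterra_unique b z (h : R -> V) xi1 xi2 rho B : 0 <= B ->
  (forall t, 0 <= t <= b -> enorm (z t) <= rho) ->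
  leb_measurable `[- dl, b] xi1 -> leb_measurable `[- dl, b] xi2 ->
  (forall s, - dl <= s <= b -> enorm (xi1 s) <= B) ->
  (forall s, - dl <= s <= b -> enorm (xi2 s) <= B) ->
  (forall s, - dl <= s <= 0 -> xi1 s = xi2 s) ->
  (forall t, 0 <= t <= b -> xi1 t = h t + predF F dl z xi1 t) ->
  (forall t, 0 <= t <= b -> xi2 t = h t + predF F dl z xi2 t) ->
  forall t, 0 <= t <= b -> xi1 t = xi2 t.
Proof.
move=> B0 zr m1 m2 B1 B2 init e1 e2 t tb.
have dl0' := dl0.
have [l l0 Hl] := predF_contraction rho B.
suff : enorm (xi1 t - xi2 t) <= 0 by move=> /enorm0_eq0/eqP; rewrite subr_eq0 => /eqP.
apply: (@halving_le0 _ `[0, b] (fun t => enorm (xi1 t - xi2 t))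
  (fun t => expR (l * t)) (B + B)); [exact: addr_ge0| | |by rewrite /= in_itv].
- move=> {tb}t; rewrite /= in_itv/= => /andP[t0 tb].
  apply: (@le_trans _ _ (B + B)).
    apply: le_trans (enormB _ _) _; rewrite lerD ?B1 ?B2//; apply/andP; split => //;
    by apply: le_trans t0; rewrite oppr_le0.
  rewrite ler_peMr ?addr_ge0//.
  by rewrite -expR0 ler_expR mulr_ge0// ltW.
- move=> N N0 HN {tb}t; rewrite /= in_itv/= => tb.
  rewrite (e1 _ tb) (e2 _ tb) opprD addrACA subrr add0r.
  have /andP[t0 tb'] := tb.
  have dt : - dl <= t - dl by rewrite lerDr.
  apply: Hl; [exact: t0|exact: N0|exact: zr| | |].
  + exact: leb_measurable_itvS dt tb' m1.
  + exact: leb_measurable_itvS dt tb' m2.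
  + move=> s /andP[s1 s2].
    have sb : - dl <= s <= b by rewrite (le_trans dt s1) (le_trans s2 tb').
    split; [exact: B1|exact: B2|].
    (* The window of [t] may reach into the history, where both functions agree. *)
    have [s0|/ltW s0] := leP 0 s.
      by apply: HN; rewrite /= in_itv/= s0 (le_trans s2).
    rewrite init ?subrr ?enorm0 ?mulr_ge0 ?expR_ge0// s0 andbT.
    exact: le_trans s1.
Qed.

(** The curve [v], the defect minus its expected value exp(- mu t) e0, is absolutely continuous,
    vanishes at [0] and satisfies v' = - mu v almost everywhere; [gronwall0] then gives v = 0. *)
Lemma predictor_integral_eq b (mu : R) z xi B : 0 <= mu ->
  abs_continuous 0 b z -> abs_continuous 0 b xi ->
  leb_measurable `[- dl, b] xi -> (forall s, - dl <= s <= b -> enorm (xi s) <= B) ->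
  {ae lebR, forall t, 0 < t < b -> [/\ derivable z t 1,
    derivable (predF F dl z xi) t 1 &
    is_derive t (1 : R) xi ('D_1 z t + 'D_1 (predF F dl z xi) t -
      mu *: (xi t - z t - predF F dl z xi t))]} ->
  forall t, 0 <= t <= b -> xi t = z t +
    expR (- mu * t) *: (xi 0 - z 0 - predF F dl z xi 0) + predF F dl z xi t.
Proof.
have lin (d1 d2 v1 v2 v3 v4 : V) (m ex : R) :
    d1 + d2 - m *: (v1 - v2 - v3) - d1 - d2 - (- m * ex) *: v4 =
    - m *: (v1 - v2 - v3 - ex *: v4).
  by apply/rowP => i; rewrite !mxE; ring.
move=> mu0 acz acx mx xB dx t tb.
set P := predF F dl z xi; set e0 := xi 0 - z 0 - P 0.
have acP : abs_continuous 0 b P := predF_abs_continuous dl0 HF mx xB acz.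
pose v x := xi x - z x - P x - expR (- mu * x) *: e0.
suff : v t = 0.
  move=> /eqP; rewrite subr_eq0 => /eqP <-.
  by apply/rowP => i; rewrite !mxE; ring.
have acw : abs_continuous 0 b (fun x => xi x - z x).
  apply: (abs_continuous_dom (C := 1) acx acz) => s s' s0 ss sb.
  rewrite mul1r; apply: (@le_trans _ _ (enorm (xi s' - xi s) + enorm (z s' - z s))).
    have -> : xi s' - z s' - (xi s - z s) = (xi s' - xi s) - (z s' - z s).
      by apply/rowP => i; rewrite !mxE; ring.
    exact: enormB.
  by rewrite lerDl subr_ge0.
have acv : abs_continuous 0 b v.
  apply: (abs_continuous_dom (C := 1 + mu * enorm e0) acw acP) => s s' s0 ss sb.
  have -> : v s' - v s = (xi s' - z s' - (xi s - z s)) - (P s' - P s)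
      - (expR (- mu * s') - expR (- mu * s)) *: e0.
    by rewrite scalerBl /v; apply/rowP => i; rewrite !mxE; ring.
  apply: le_trans (enormB _ _) _; rewrite enormZ.
  apply: (@le_trans _ _ (enorm (xi s' - z s' - (xi s - z s)) + enorm (P s' - P s) +
     (mu * (s' - s)) * enorm e0)).
    apply: lerD; first exact: enormB.
    by apply: ler_wpM2r; [exact: enorm_ge0|exact: expRN_lipschitz].
  move: (enorm_ge0 (xi s' - z s' - (xi s - z s))) (enorm_ge0 (P s' - P s)).
  have : 0 <= mu * enorm e0 by rewrite mulr_ge0 ?enorm_ge0.
  have : 0 <= s' - s by rewrite subr_ge0.
  by move: (enorm _) (enorm _) (enorm _) => A1 A2 A3; nra.
apply: (gronwall0 mu0 acv) tb; first by rewrite /v mulr0 expR0 scale1r subrr.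
apply: ae_leb_imply dx _ => x Hx xb; have [dz dP dxi] := Hx xb.
exists (- mu *: v x); last by rewrite enormZ normrN ger0_norm.
have dE : is_derive x (1 : R) (fun x => expR (- mu * x) *: e0)
    ((- mu * expR (- mu * x)) *: e0).
  apply/is_derive_rowP => i.
  have h : is_derive x (1 : R) (fun s : R => - mu * s) (- mu).
    by rewrite -[X in is_derive _ _ _ X]mulr1; exact: is_deriveZ.
  have -> : (fun s => (expR (- mu * s) *: e0) ord0 i) =
      (fun s : R => e0 ord0 i * expR (- mu * s)).
    by apply/funext => s; rewrite mxE mulrC.
  have := is_deriveZ (e0 ord0 i) (is_derive1_comp (is_derive_expR (- mu * x)) h).
  move=> H; apply: (is_derive_eq H).
  by rewrite !mxE /GRing.scale/=; ring.
have := is_deriveB (is_deriveB (is_deriveB dxi (derivableP dz)) (derivableP dP)) dE.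
move=> H; apply: (is_derive_eq H).
exact: lin.
Qed.

(** Picard iteration on the whole half-line at once: the field is bounded independently of [xi], so
    all iterates obey one bound, and the weight exp(l s) gives one rate of convergence for all
    times. *)
Lemma volterra_exists (mu : R) z xi0 (e : V) rho B0 : 0 <= mu ->
  (forall b, abs_continuous 0 b z) -> (forall t, 0 <= t -> enorm (z t) <= rho) ->
  leb_measurable `[- dl, 0] xi0 ->
  (forall s, - dl <= s <= 0 -> enorm (xi0 s) <= B0) ->
  exists xi B, [/\ forall t, t <= 0 -> xi t = xi0 t,
    forall t, 0 < t -> xi t = z t + expR (- mu * t) *: e + predF F dl z xi t,
    forall b, leb_measurable `[- dl, b] xi &
    forall s, - dl <= s -> enorm (xi s) <= B].
Proof.
move=> mu0 acz zr mx0 xB0.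
have dl0' := dl0.
pose G (eta : R -> V) t := if t <= 0 then xi0 t
  else z t + expR (- mu * t) *: e + predF F dl z eta t.
have [C C0 HC] := field_bounded HF rho.
(* The history contributes [B0]; the three terms of the equation contribute [rho], [e] (as the
   exponential is at most [1]) and [C * dl], the window having length [dl]. *)
pose B := `|B0| + `|rho| + enorm e + C * dl.
have B_ge0 : 0 <= B by rewrite /B !addr_ge0 ?enorm_ge0 ?mulr_ge0.
have B0B : `|B0| <= B.
  by rewrite /B -!addrA lerDl !addr_ge0 ?enorm_ge0 ?mulr_ge0.
pose Inv (eta : R -> V) := (forall b, leb_measurable `[- dl, b] eta) /\
  (forall s, - dl <= s -> enorm (eta s) <= B).
have mglue (eta eta' : R -> V) : (forall t, t <= 0 -> eta t = xi0 t) ->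
    (forall t, 0 < t -> eta t = eta' t) ->
    (forall b, 0 <= b -> leb_measurable `[0, b] eta') ->
    forall b, leb_measurable `[- dl, b] eta.
  move=> h1 h2 meta b i.
  have sub : `[- dl, b] `<=` `[- dl, 0] `|` `]0, `|b|].
    move=> t; rewrite /= !in_itv/= => /andP[t1 t2].
    have := ler_norm b; have [t0|t0] := leP t 0; [left; rewrite t1|right] => //=.
    lra.
  apply: (@measurable_funS _ _ L R _ _ _ _ sub).
    by apply: measurableU; exact: leb_measurable_itv.
  apply/measurable_funU; [exact: leb_measurable_itv|exact: leb_measurable_itv|split].
    apply: eq_measurable_fun (mx0 i) => t; rewrite inE/= in_itv/= => /andP[_ t0].
    by rewrite h1.
  have := meta `|b| (normr_ge0 _) i => mi.
  have sub2 : `]0, `|b|] `<=` `[0, `|b|].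
    by move=> t; rewrite /= !in_itv/= => /andP[/ltW -> ->].
  have := measurable_funS (leb_measurable_itv _) sub2 mi.
  apply: eq_measurable_fun => t; rewrite inE/= in_itv/= => /andP[t0 _].
  by rewrite h2.
have InvG eta : Inv eta -> Inv (G eta).
  move=> [me be]; split.
    apply: (mglue _ (fun t => z t + expR (- mu * t) *: e + predF F dl z eta t)).
    - by move=> t t0; rewrite /G t0.
    - by move=> t t0; rewrite /G leNgt t0.
    - move=> b b0 i; apply: leb_measurable_continuous.
      have acP := predF_abs_continuous dl0 HF (me b)
        (fun s sb => be s (proj1 (andP sb))) (acz b).
      have cz := @abs_continuous_within _ _ _ _ _ i (acz b).
      have cP := @abs_continuous_within _ _ _ _ _ i acP.
      have -> : (fun t => (z t + expR (- mu * t) *: e + predF F dl z eta t) ord0 i) =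
        (fun t => (z t ord0 i + expR (- mu * t) * e ord0 i) + predF F dl z eta t ord0 i).
        by apply/funext => t; rewrite !mxE.
      have cE : {within `[0, b], continuous (fun t : R => expR (- mu * t) * e ord0 i)}.
        apply: continuous_subspaceT => s; apply: cvgM; last exact: cvg_cst.
        apply: continuous_comp; last exact: continuous_expR.
        by apply: cvgM; [exact: cvg_cst|exact: cvg_id].
      move=> t; apply: cvgD; last exact: cP.
      by apply: cvgD; [exact: cz|exact: cE].
  move=> s ds; rewrite /G; have [s0|s0] := leP s 0.
    by apply: le_trans B0B; apply: le_trans (ler_norm _); rewrite xB0// ds.
  apply: (@le_trans _ _ (`|rho| + enorm e + C * dl)); last first.
    by rewrite /B -!addrA lerDr.
  apply: le_trans (enormD _ _) _; rewrite lerD//.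
    apply: le_trans (enormD _ _) _; rewrite lerD//.
      by apply: le_trans (ler_norm _); apply: zr; exact: ltW.
    rewrite enormZ ger0_norm ?expR_ge0// ler_piMl ?enorm_ge0//.
    by rewrite -expR0 ler_expR mulNr oppr_le0 mulr_ge0// ltW.
  have -> : C * dl = C * (s - (s - dl)) by ring.
  have dsd : - dl <= s - dl by rewrite lerDr ltW.
  apply: enorm_vint_bound.
  - by rewrite gerBl.
  - exact: (field_bmeasv HF _ dsd (leb_measurable_itvS dsd (lexx _) (me s))).
  - by move=> x /andP[x1 x2]; apply: HC; [apply: zr; exact: ltW|exact: le_trans x1].
pose it k := iter k G (fun t => if t <= 0 then xi0 t else 0).
have Invit k : Inv (it k).
  elim: k => [|k IH]; last exact: InvG.
  split => [|s ds].
    apply: (mglue _ (cst 0)) => [t t0|t t0|b _ i].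
    - by rewrite /it/= t0.
    - by rewrite /it/= leNgt t0.
    - exact: measurable_cst.
  rewrite /it/=; have [s0|s0] := leP s 0; last by rewrite enorm0.
  by apply: le_trans B0B; apply: le_trans (ler_norm _); rewrite xB0// ds.
have it_le0 k t : t <= 0 -> it k t = xi0 t.
  by move=> t0; case: k => [|k]; rewrite /it/= ?/G t0.
have [l l0 Hl] := predF_contraction rho B.
have contr (eta1 eta2 : R -> V) N : 0 <= N -> Inv eta1 -> Inv eta2 ->
    (forall s, - dl <= s -> enorm (eta1 s - eta2 s) <= N * expR (l * s)) ->
    forall s, - dl <= s -> enorm (G eta1 s - G eta2 s) <= N / 2 * expR (l * s).
  move=> N0 [m1 b1] [m2 b2] H s ds; rewrite /G; have [s0|s0] := leP s 0.
    by rewrite subrr enorm0 mulr_ge0 ?expR_ge0// divr_ge0.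
  rewrite opprD addrACA subrr add0r.
  have dsd : - dl <= s - dl by rewrite lerDr ltW.
  apply: Hl; [exact: ltW|exact: N0|apply: zr; exact: ltW| | |].
  - exact: leb_measurable_itvS dsd (lexx _) (m1 s).
  - exact: leb_measurable_itvS dsd (lexx _) (m2 s).
  - move=> x /andP[x1 x2]; have dx := le_trans dsd x1.
    by split; [exact: b1|exact: b2|exact: H].
pose N0 := B + B.
have N00 : 0 <= N0 by exact: addr_ge0.
have geo k : forall s, - dl <= s ->
    enorm (it k.+1 s - it k s) <= N0 / 2 ^+ k * expR (l * s).
  elim: k => [s ds|k IH s ds].
    rewrite expr0 divr1; have [s0|s0] := leP s 0.
      by rewrite !it_le0// subrr enorm0 mulr_ge0 ?expR_ge0.
    apply: (@le_trans _ _ N0).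
      by apply: le_trans (enormB _ _) _; rewrite lerD ?(Invit _).2.
    by rewrite ler_peMr// -expR0 ler_expR mulr_ge0// ltW.
  have -> : N0 / 2 ^+ k.+1 = N0 / 2 ^+ k / 2 by rewrite exprS invfM mulrA mulrAC.
  apply: (contr (it k.+1) (it k)) => //.
  by rewrite divr_ge0// exprn_ge0.
have lim_ (s : R) (i : 'I_n) : exists x : R, - dl <= s -> forall k,
    `|x - it k s ord0 i| <= 2 * (N0 * expR (l * s)) / 2 ^+ k.
  have [ds|ds] := leP (- dl) s; last by exists 0.
  have H k : `|it k.+1 s ord0 i - it k s ord0 i| <= N0 * expR (l * s) / 2 ^+ k.
    have := coord_le_enorm (it k.+1 s - it k s) i; rewrite !mxE => /le_trans; apply.
    by rewrite mulrAC; exact: geo.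
  by have [x Hx] := geometric_limit H; exists x.
have /choice[X HX] : forall s, exists x : 'I_n -> R, - dl <= s -> forall i k,
    `|x i - it k s ord0 i| <= 2 * (N0 * expR (l * s)) / 2 ^+ k.
  by move=> s; have /choice[x Hx] := lim_ s; exists x => ds i k; exact: Hx.
pose xi s : V := \row_i X s i.
pose N1 := n%:R * (2 * N0).
have N10 : 0 <= N1 by rewrite !mulr_ge0.
have xiit s k : - dl <= s -> enorm (xi s - it k s) <= N1 / 2 ^+ k * expR (l * s).
  move=> ds; apply: le_trans (enorm_le_sum _) _.
  apply: (@le_trans _ _ (\sum_(i < n) (2 * (N0 * expR (l * s)) / 2 ^+ k))).
    by apply: ler_sum => i _; rewrite !mxE; exact: HX.
  rewrite sumr_const card_ord -mulr_natl /N1 le_eqVlt.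
  by apply/orP; left; apply/eqP; ring.
have xi_le0 t : - dl <= t -> t <= 0 -> xi t = xi0 t.
  move=> dt t0; apply/eqP; rewrite -subr_eq0; apply/eqP/enorm0_eq0.
  apply: (@geometric_le0 _ (N1 * expR (l * t))) => k.
  by have := xiit t k dt; rewrite it_le0// mulrAC.
have mxi b : leb_measurable `[- dl, b] xi.
  move=> i; apply: (@measurable_fun_cvg _ L R _ (fun k s => it k s ord0 i)).
    by move=> k; have [m _] := Invit k; exact: m.
  move=> s; rewrite /= in_itv/= => /andP[ds _].
  apply: (@geometric_cvg _ _ (2 * (N0 * expR (l * s)))) => k.
  by rewrite mxE; exact: HX.
have xiB s : - dl <= s -> enorm (xi s) <= B.
  move=> ds; rewrite -subr_le0; apply: (@geometric_le0 _ (N1 * expR (l * s))) => k.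
  rewrite mulrAC lerBlDr; apply: le_trans (lerD (xiit s k ds) ((Invit k).2 s ds)).
  by have := enormD (xi s - it k s) (it k s); rewrite subrK.
(* The limit is controlled only from [- dl] on; before that, the prescribed history is restored. *)
pose xi' t := if t <= 0 then xi0 t else xi t.
have xi'E t : - dl <= t -> xi' t = xi t.
  by move=> dt; rewrite /xi'; case: leP => // t0; rewrite xi_le0.
exists xi', B; split.
- by move=> t t0; rewrite /xi' t0.
- move=> t t0; have dt : - dl <= t by apply: le_trans (ltW t0); rewrite oppr_le0.
  have dtd : - dl <= t - dl by rewrite lerDr ltW.
  have -> : predF F dl z xi' t = predF F dl z xi t.
    rewrite /predF /vint; apply/rowP => i; rewrite !mxE; apply: eq_Rintegral => s.
    rewrite inE/= in_itv/= => /andP[s1 s2]; rewrite xi'E//.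
    exact: le_trans s1.
  rewrite xi'E// -[RHS](_ : G xi t = _); last by rewrite /G leNgt t0.
  apply/eqP; rewrite -subr_eq0; apply/eqP/enorm0_eq0.
  (* The limit is a fixed point: its distance to the iterate k + 1 and the distance of that iterate
     to [G xi] are each at most half of N1 / 2^k in the weighted sense. *)
  apply: (@geometric_le0 _ (N1 * expR (l * t))) => k.
  have Hk := xiit t k.+1 dt.
  have Nk0 : 0 <= N1 / 2 ^+ k by rewrite divr_ge0// exprn_ge0.
  have InvXi : Inv xi by split; [exact: mxi|exact: xiB].
  have Gk : enorm (it k.+1 t - G xi t) <= N1 / 2 ^+ k / 2 * expR (l * t).
    apply: (contr (it k) xi (N1 / 2 ^+ k) Nk0 (Invit k) InvXi _ t dt) => s ds.
    by rewrite enormBC; exact: xiit.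
  have -> : xi t - G xi t = (xi t - it k.+1 t) + (it k.+1 t - G xi t).
    by rewrite subrKA.
  apply: le_trans (enormD _ _) _; apply: le_trans (lerD Hk Gk) _.
  rewrite -mulrDl [N1 * expR (l * t) / _]mulrAC; apply: ler_wpM2r; first exact: expR_ge0.
  have -> : N1 / 2 ^+ k.+1 = N1 / 2 ^+ k / 2 by rewrite exprS invfM mulrA mulrAC.
  by rewrite -splitr.
- move=> b i; apply: eq_measurable_fun (mxi b i) => s.
  by rewrite inE/= in_itv/= => /andP[ds _]; rewrite xi'E.
- by move=> s ds; rewrite xi'E//; exact: xiB.
Qed.

End Volterra.

(** * Lipschitz bounds for the plant and the saturated field *)

Section LocalLipschitz.
Context {R : realType}.

Lemma compact_continuous_bounded (T : topologicalType) (A : set T) (h : T -> R) :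
  compact A -> (forall p, A p -> {for p, continuous h}) ->
  exists2 C, 0 <= C & forall p, A p -> `|h p| <= C.
Proof.
move=> cA ch.
have /compact_bounded[C [_ HC]] : compact (h @` A).
  apply: continuous_compact cA; apply/continuous_in_subspaceT => p.
  by rewrite inE; exact: ch.
exists (`|C| + 1) => [|p Ap]; first by rewrite addr_ge0.
apply: (HC (`|C| + 1)); last by exists p.
by apply: le_lt_trans (ler_norm _) _; rewrite ltrDl.
Qed.

Lemma compact_enorm_ball n (B : R) : compact [set v : 'rV[R]_n | enorm v <= B].
Proof.
apply: bounded_closed_compact.
  exists B; split; first exact: num_real.
  move=> x Bx v /= vB; apply: le_trans (norm_le_enorm v) _.
  exact: le_trans vB (ltW Bx).
have -> : [set v : 'rV[R]_n | enorm v <= B] = @enorm R n @^-1` [set x | x <= B].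
  by [].
apply: preimage_closed; last exact: closed_le.
by move=> v _; exact: enorm_continuous.
Qed.

Lemma is_derive_segment (V W : normedModType R) (g : V -> W) (a e : V) (t : R) (l : W) :
  is_derive (a + t *: e) e g l ->
  is_derive t (1 : R) (fun s => g (a + s *: e)) l.
Proof.
have E : (fun h : R => h^-1 *: (((fun s => g (a + s *: e)) \o shift t) (h *: 1) -
      g (a + t *: e))) =
    (fun h => h^-1 *: ((g \o shift (a + t *: e)) (h *: e) - g (a + t *: e))).
  apply/funext => h; rewrite /shift/= [h%:A]mulr1 scalerDl.
  by rewrite addrCA.
by move=> [dg gl]; apply: DeriveDef; rewrite /derivable /derive E.
Qed.

(** Mean value theorem along the segment, the derivative being expanded in the directions [E i].
    Restricting the directions allows the state to vary while the input is fixed, so [U] may be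
    non-convex; hence the hypothesis on segments instead of convexity of [K]. *)
Lemma C1_lipschitz n (V : normedModType R) (O K : set V) (g : V -> R)
    (E : 'I_n -> V) : compact K -> K `<=` O ->
  (forall p, O p -> differentiable g p) ->
  (forall v p, O p -> {for p, continuous ('D_v g)}) ->
  exists2 C, 0 <= C & forall (a : V) (w : 'rV[R]_n),
    (forall t : R, 0 <= t <= 1 -> K (a + t *: \sum_i w ord0 i *: E i)) ->
    `|g (a + \sum_i w ord0 i *: E i) - g a| <= C * enorm w.
Proof.
move=> cK KO dg cg.
have /choice[C HC] (i : 'I_n) : exists C : R,
    0 <= C /\ forall p, K p -> `|'D_(E i) g p| <= C.
  have [p Kp|C C0 HC] := @compact_continuous_bounded _ K ('D_(E i) g) cK.
    by apply: cg; exact: KO.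
  by exists C.
exists (\sum_(i < n) C i) => [|a w Kaw].
  by apply: sumr_ge0 => i _; exact: (HC i).1.
set e := \sum_i w ord0 i *: E i.
have dE (t : R) : 0 <= t <= 1 ->
    is_derive t (1 : R) (fun s => g (a + s *: e)) ('D_e g (a + t *: e)).
  move=> t01; apply: is_derive_segment; apply: derivableP.
  by apply: diff_derivable; apply/dg/KO/Kaw.
have cst_ : {within `[0, 1], continuous (fun s : R => g (a + s *: e))}.
  apply/continuous_in_subspaceT => t; rewrite inE/= in_itv/= => t01.
  apply/differentiable_continuous/derivable1_diffP.
  by have [] := dE _ t01.
have [|t] := @MVT_segment _ _ (fun s => 'D_e g (a + s *: e)) 0 1 ler01 _ cst_.
  by move=> t; rewrite in_itv/= => /andP[t0 t1]; apply: dE; rewrite !ltW.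
rewrite in_itv/= => t01; rewrite scale1r scale0r addr0 subr0 mulr1 => ->.
have Kt := Kaw _ t01; have dgt := dg _ (KO _ Kt).
rewrite deriveE// linear_sum mulr_suml.
apply: le_trans (ler_norm_sum _ _ _) _; apply: ler_sum => i _.
rewrite linearZ -deriveE// normrM mulrC ler_pM//; first exact: (HC i).2.
exact: coord_le_enorm.
Qed.

End LocalLipschitz.

(** * Bounds for the plant *)

Section PlantField.
Context {R : realType} {n m : nat} (U : set 'rV[R]_m).
Context (f : 'rV[R]_n -> 'rV[R]_m -> 'rV[R]_n) (U_compact : compact U).
Hypothesis f_smooth : smooth_on (setT `*` U)
  (fun w : 'rV[R]_n * 'rV[R]_m => f w.1 w.2).

Let W : normedModType R := ('rV[R]_n * 'rV[R]_m)%type.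

(** The domain of [f] need not be open, so derivatives are those of an extension [g]. They are
    stated by coordinates because the mean value theorem is scalar. *)
Lemma plant_C1 : exists (O : set W) (g : W -> 'rV[R]_n),
  [/\ open O, (forall x u, U u -> O (x, u)), (forall x u, U u -> f x u = g (x, u)),
    (forall p, O p -> differentiable g p) &
    (forall v j p, O p -> {for p, continuous ('D_v (fun p => g p ord0 j : R))})].
Proof.
have [Om [g [oO sO fg Ck]]] := f_smooth.
have [dg cg] := Ck 1%N.
exists Om, g; split => //.
- by move=> x u Uu; apply: sO.
- by move=> x u Uu; apply: (fg (x, u)); rewrite inE.
- move=> v j p Op.
  have nO : nbhs p Om by exact: open_nbhs_nbhs.
  (* Coordinates commute with the derivative only where [g] is differentiable, that is, on the open
     set around [p]. *)
  have Ng : \forall q \near p, ('D_v g q) ord0 j = 'D_v (fun p => g p ord0 j : R) q.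
    near=> q; have Oq : Om q by near: q.
    rewrite derive_mx ?mxE//; exact: diff_derivable (dg q Oq).
  have c1 : {for p, continuous (fun q => ('D_v g q) ord0 j)}.
    apply: (@continuous_comp _ _ _ ('D_v g) (fun M : 'rV[R]_n => M ord0 j)).
      exact: cg.
    exact: coord_continuous.
  have c2 : ('D_v g q) ord0 j @[q --> p] --> ('D_v g p) ord0 j := c1.
  rewrite (nbhs_singleton Ng) in c2; apply: cvg_trans c2.
  apply: near_eq_cvg; exact: Ng.
Unshelve. all: by end_near. Qed.

Lemma compact_plant_domain (B : R) :
  compact ([set x : 'rV[R]_n | enorm x <= B] `*` U : set W).
Proof. by apply: compact_setX => //; exact: compact_enorm_ball. Qed.

Lemma plant_bounded (B : R) : exists2 C, 0 <= C &
  forall x u, enorm x <= B -> U u -> enorm (f x u) <= C.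
Proof.
have [Om [g [oO UO fg dg _]]] := plant_C1.
have /choice[C HC] (j : 'I_n) : exists C : R, 0 <= C /\ forall p : W,
    enorm p.1 <= B /\ U p.2 -> `|g p ord0 j| <= C.
  have [p [Bp Up]|C C0 HC] := @compact_continuous_bounded _ _ _
      (fun p : W => g p ord0 j) (@compact_plant_domain B).
    apply: (@continuous_comp _ _ _ g (fun M : 'rV[R]_n => M ord0 j));
      last exact: coord_continuous.
    by apply: differentiable_continuous; apply: dg; case: p Bp Up => x u _; exact: UO.
  by exists C.
exists (\sum_(j < n) C j) => [|x u xB Uu].
  by apply: sumr_ge0 => j _; exact: (HC j).1.
rewrite fg//; apply: le_trans (enorm_le_sum _) _; apply: ler_sum => j _.
exact: (HC j).2.
Qed.

Lemma plant_lipschitz (B : R) : exists2 C, 0 <= C &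
  forall x y u, enorm x <= B -> enorm y <= B -> U u ->
    enorm (f x u - f y u) <= C * enorm (x - y).
Proof.
have [Om [g [oO UO fg dg cg]]] := plant_C1.
pose E (i : 'I_n) : W := (delta_mx ord0 i, 0).
have ES (w : 'rV[R]_n) : \sum_i w ord0 i *: E i = (w, 0) :> W.
  have -> : \sum_i w ord0 i *: E i =
      (\sum_i w ord0 i *: (delta_mx ord0 i : 'rV[R]_n), 0) :> W.
    elim/big_ind2 : _ => [//|a1 a2 b1 b2 -> ->|i _].
      by congr pair; rewrite addr0.
    by congr pair; rewrite scaler0.
  by rewrite -row_sum_delta.
have KO : [set x : 'rV[R]_n | enorm x <= B] `*` U `<=` Om.
  by move=> [x u] [_ Uu]; exact: UO.
have /choice[C HC] (j : 'I_n) : exists C : R, 0 <= C /\ forall (a : W) (w : 'rV[R]_n),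
    (forall t : R, 0 <= t <= 1 -> ([set x : 'rV[R]_n | enorm x <= B] `*` U)
       (a + t *: \sum_i w ord0 i *: E i)) ->
    `|g (a + \sum_i w ord0 i *: E i) ord0 j - g a ord0 j| <= C * enorm w.
  have [||C C0 HC] := @C1_lipschitz R n W Om _ (fun p => g p ord0 j) E
    (@compact_plant_domain B) KO.
  - move=> p Op.
    apply: (@differentiable_comp _ _ _ _ g (fun M : 'rV[R]_n => M ord0 j : R)).
      exact: dg.
    exact: differentiable_coord.
  - by move=> v p Op; exact: cg.
  - by exists C.
exists (\sum_(j < n) C j) => [|x y u xB yB Uu].
  by apply: sumr_ge0 => j _; exact: (HC j).1.
apply: le_trans (enorm_le_sum _) _; rewrite mulr_suml; apply: ler_sum => j _.
rewrite !fg// !mxE.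
have := (HC j).2 (y, u) (x - y).
rewrite ES.
have -> : (y, u) + (x - y, 0) = (x, u) :> W.
  by congr pair; rewrite ?addr0// addrC subrK.
apply=> t /andP[t0 t1].
have -> : (y, u) + t *: (x - y, 0) = ((1 - t) *: y + t *: x, u) :> W.
  congr pair => /=; last by rewrite scaler0 addr0.
  by rewrite scalerBl scale1r scalerBr addrA addrAC.
split => //=; apply: le_trans (enormD _ _) _; rewrite !enormZ.
have := ler_wpM2l t0 xB; have t1' : 0 <= 1 - t by rewrite subr_ge0.
have := ler_wpM2l t1' yB.
rewrite !ger0_norm//; lra.
Qed.

End PlantField.

(** * Bounds and regularity of the saturation *)

Section Saturation.
Context {R : realType} {n : nat} (psi : 'rV[R]_n -> R) (q : R -> R) (K : R).
Hypothesis psi_smooth : smooth_on setT (psi : 'rV[R]_n -> R^o).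
Hypothesis psi_gt0 : forall y, 0 < psi y.
Hypothesis K_ge1 : 1 <= K.
Hypothesis q_ge0 : forall s, 0 <= q s.
Hypothesis q_derivable : forall s : R, derivable q s 1.
Hypothesis q_C1 : continuous (derive1 q).
Hypothesis q_eq1 : forall s, s <= 1 -> q s = 1.
Hypothesis q_bound : forall s, 1 <= s -> s * q s <= K.

Lemma psi_differentiable_C1 : (forall y, differentiable psi y) /\
  (forall v y, {for y, continuous ('D_v psi)}).
Proof.
have [Om [g [_ sO fg Ck]]] := psi_smooth.
have E : psi = g by apply/funext => y; apply: fg; rewrite inE.
have [dg cg] := Ck 1%N.
by rewrite E; split => [y|v y]; [apply/dg/sO|apply/cg/sO].
Qed.

Lemma psi_continuous : continuous psi.
Proof. by move=> y; apply/differentiable_continuous/psi_differentiable_C1.1. Qed.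

(** The lower bound comes from a bound [D] of the continuous function 1 / psi on the compact ball;
    [D + 1] is taken to be invertible. *)
Lemma psi_bounds (B : R) : exists p : R * R, [/\ 0 < p.1, 0 <= p.2 &
  forall y, enorm y <= B -> p.1 <= psi y <= p.2].
Proof.
have [y _|C C0 HC] := compact_continuous_bounded (@compact_enorm_ball R n B) (h := psi).
  exact: psi_continuous.
have [y _|D D0 HD] := compact_continuous_bounded (@compact_enorm_ball R n B)
    (h := fun y => (psi y)^-1).
  have n0 : psi y != 0 by rewrite gt_eqF.
  exact: (cvgV n0 (@psi_continuous y)).
exists ((D + 1)^-1, C); split => //=; first by rewrite invr_gt0 ltr_wpDl.
move=> y yB; apply/andP; split; last exact: le_trans (ler_norm _) (HC y yB).
rewrite -[leRHS]invrK lef_pV2 ?posrE ?invr_gt0 ?ltr_wpDl//.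
by apply: le_trans (ler_norm _) _; apply: le_trans (HD y yB) _; rewrite lerDl.
Qed.

Lemma psi_lipschitz (B : R) : exists2 C, 0 <= C &
  forall x y, enorm x <= B -> enorm y <= B -> `|psi x - psi y| <= C * enorm (x - y).
Proof.
have [dpsi cpsi] := psi_differentiable_C1.
have [||C C0 HC] := @C1_lipschitz R n 'rV[R]_n setT [set x | enorm x <= B] psi
    (fun i => delta_mx ord0 i) (@compact_enorm_ball R n B) (fun _ _ => Logic.I).
- by move=> p _; exact: dpsi.
- by move=> v p _; exact: cpsi.
exists C => // x y xB yB; have := HC y (x - y).
rewrite -row_sum_delta [y + (x - y)]addrC subrK; apply => t /andP[t0 t1].
have -> : y + t *: (x - y) = (1 - t) *: y + t *: x.
  by rewrite scalerBl scale1r scalerBr addrA addrAC.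
rewrite /=; apply: le_trans (enormD _ _) _; rewrite !enormZ.
have t1' : 0 <= 1 - t by rewrite subr_ge0.
have := ler_wpM2l t0 xB; have := ler_wpM2l t1' yB.
rewrite !ger0_norm//; lra.
Qed.

Lemma q_continuous : continuous q.
Proof. by move=> s; apply/differentiable_continuous/derivable1_diffP. Qed.

Lemma q_lipschitz (S : R) : exists2 C, 0 <= C &
  forall a b, 0 <= a <= S -> 0 <= b <= S -> `|q a - q b| <= C * `|a - b|.
Proof.
have [_ [C HC]] := @bmeas_continuous R 0 S _ (continuous_subspaceT q_C1).
exists `|C| => // a b.
wlog ab : a b / b <= a => [H aS bS|/andP[a0 aS] /andP[b0 bS]].
  have [|/ltW] := leP b a => ab; first exact: H.
  by rewrite distrC (distrC a); exact: H.
have dq (x : R) : is_derive x (1 : R) q (derive1 q x).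
  by rewrite derive1E; exact: derivableP.
have [t] := MVT_segment ab (fun x _ => dq x) (continuous_subspaceT q_continuous).
rewrite in_itv/= => /andP[bt ta] ->.
rewrite normrM ler_wpM2r//; apply: le_trans (ler_norm C).
by apply: HC; rewrite /= in_itv/= (le_trans b0 bt) (le_trans ta aS).
Qed.

Lemma saturate_id y xi : enorm xi <= psi y -> saturate psi q y xi = xi.
Proof. by move=> h; rewrite /saturate q_eq1 ?scale1r// ler_pdivrMr// mul1r. Qed.

(** In terms of the ratio s = |xi| / psi(y) the claim is s q(s) <= K, assumed for s >= 1 and equal
    to s <= 1 <= K otherwise. The bound does not involve [xi], which rules out blow-up of the
    predictor. *)
Lemma saturate_bound y xi : enorm (saturate psi q y xi) <= K * psi y.
Proof.
have p0 := psi_gt0 y; rewrite /saturate enormZ ger0_norm//.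
have -> : q (enorm xi / psi y) * enorm xi =
    (enorm xi / psi y * q (enorm xi / psi y)) * psi y.
  by rewrite mulrAC divfK ?gt_eqF// mulrC.
rewrite ler_wpM2r ?(ltW p0)//; have [h|/ltW h] := leP (enorm xi / psi y) 1.
  by rewrite q_eq1// mulr1; exact: le_trans K_ge1.
exact: q_bound.
Qed.

(** Split into q(s) (xi - xi') + (q(s) - q(s')) xi'. Both ratios lie in [0, |B| / m], with [m] a
    lower bound of [psi] on the ball, and [q] is Lipschitz there. The absolute value appears because
    [B] has no assumed sign. *)
Lemma saturate_lipschitz (B : R) : exists2 C, 0 <= C &
  forall y y' xi xi', enorm y <= B -> enorm y' <= B -> enorm xi <= B ->
    enorm xi' <= B -> enorm (saturate psi q y xi - saturate psi q y' xi') <=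
    C * (enorm (y - y') + enorm (xi - xi')).
Proof.
have [[m C] /= [m0 C0 Hpsi]] := psi_bounds B.
have [Lp Lp0 HLp] := psi_lipschitz B.
have [Lq Lq0 HLq] := q_lipschitz (`|B| / m).
pose Qm := 1 + Lq * (`|B| / m).
have Qm0 : 0 <= Qm by rewrite /Qm addr_ge0// mulr_ge0// divr_ge0// ltW.
(* Lipschitz constants of the second term in [xi] and in [y]; the latter comes from the variation of
   1 / psi. *)
pose C1 := Lq * `|B| / m; pose C2 := Lq * `|B| * (`|B| * Lp / (m * m)).
have C10 : 0 <= C1 by rewrite /C1 divr_ge0 ?mulr_ge0// ltW.
have C20 : 0 <= C2 by rewrite /C2 mulr_ge0// ?divr_ge0 ?mulr_ge0// ltW.
exists (Qm + C1 + C2) => [|y y' xi xi' yB yB' xB xB'].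
  by rewrite addr_ge0// addr_ge0.
have /andP[py _] := Hpsi _ yB; have /andP[py' _] := Hpsi _ yB'.
have p0 := psi_gt0 y; have p0' := psi_gt0 y'.
rewrite /saturate; set s := enorm xi / psi y; set s' := enorm xi' / psi y'.
have sB : 0 <= s <= `|B| / m.
  rewrite /s divr_ge0 ?enorm_ge0 ?(ltW p0)//= ler_pM ?enorm_ge0 ?invr_ge0 ?(ltW p0)//.
    exact: le_trans xB (ler_norm _).
  by rewrite lef_pV2.
have sB' : 0 <= s' <= `|B| / m.
  rewrite /s' divr_ge0 ?enorm_ge0 ?(ltW p0')//= ler_pM ?enorm_ge0 ?invr_ge0 ?(ltW p0')//.
    exact: le_trans xB' (ler_norm _).
  by rewrite lef_pV2.
have qs : q s <= Qm.
  have Bm0 : 0 <= `|B| / m by rewrite divr_ge0// ltW.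
  have z0 : (0 : R) <= 0 <= `|B| / m := introT andP (conj (lexx _) Bm0).
  have := HLq s 0 sB z0; rewrite (q_eq1 ler01) subr0 => /(le_trans (ler_norm _)).
  case/andP : sB => s0 sB; rewrite ger0_norm// lerBlDl => /le_trans; apply.
  by rewrite /Qm lerD2l ler_wpM2l.
have -> : q s *: xi - q s' *: xi' = q s *: (xi - xi') + (q s - q s') *: xi'.
  by apply/rowP => i; rewrite !mxE; ring.
set dx := enorm (xi - xi'); set dy := enorm (y - y').
have dx0 : 0 <= dx by exact: enorm_ge0.
have dy0 : 0 <= dy by exact: enorm_ge0.
have B0 : 0 <= `|B| by [].
have ss : `|s - s'| <= dx / m + `|B| * Lp / (m * m) * dy.
  have -> : s - s' = (enorm xi - enorm xi') / psi y +
      enorm xi' * ((psi y' - psi y) / (psi y * psi y')).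
    by rewrite /s /s'; field; rewrite !gt_eqF.
  apply: le_trans (ler_normD _ _) _; apply: lerD.
    rewrite normrM normfV (ger0_norm (ltW p0)) ler_pM ?invr_ge0 ?(ltW p0)//.
      exact: enorm_dist.
    by rewrite lef_pV2.
  rewrite normrM (ger0_norm (enorm_ge0 _)).
  have -> : `|B| * Lp / (m * m) * dy = `|B| * (Lp * dy / (m * m)) by ring.
  rewrite ler_pM ?enorm_ge0//; first exact: le_trans xB' (ler_norm _).
  rewrite normrM normfV ler_pM ?invr_ge0//.
    by rewrite /dy enormBC; exact: HLp.
  rewrite lef_pV2 ?posrE ?normr_gt0 ?mulf_neq0 ?gt_eqF ?mulr_gt0//.
  by rewrite ger0_norm ?mulr_ge0 ?(ltW p0) ?(ltW p0')// ler_pM ?(ltW m0).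
apply: le_trans (enormD _ _) _; rewrite !enormZ (ger0_norm (q_ge0 _)).
have h1 : q s * dx <= Qm * dx by rewrite ler_wpM2r.
have h2 : `|q s - q s'| * enorm xi' <= C1 * dx + C2 * dy.
  apply: (@le_trans _ _ (Lq * (dx / m + `|B| * Lp / (m * m) * dy) * `|B|)).
    rewrite ler_pM ?enorm_ge0//; last exact: le_trans xB' (ler_norm _).
    by apply: le_trans (HLq _ _ sB sB') _; rewrite ler_wpM2l.
  by rewrite /C1 /C2 le_eqVlt; apply/orP; left; apply/eqP; ring.
apply: le_trans (lerD h1 h2) _.
have := mulr_ge0 Qm0 dy0; have := mulr_ge0 C10 dy0; have := mulr_ge0 C20 dx0.
by move: Qm C1 C2 {Qm0 C10 C20 h1 h2 qs} => a1 a2 a3; lra.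
Qed.

Lemma saturate_continuous i : continuous (fun p : 'rV[R]_n * 'rV[R]_n =>
  saturate psi q p.1 p.2 ord0 i).
Proof.
move=> p.
have -> : (fun p : 'rV[R]_n * 'rV[R]_n => saturate psi q p.1 p.2 ord0 i) =
    (fun p => q (enorm p.2 / psi p.1) * p.2 ord0 i).
  by apply/funext => p'; rewrite mxE.
apply: (@cvgM _ _ _ _ (fun p : 'rV[R]_n * 'rV[R]_n => q (enorm p.2 / psi p.1))).
  apply: (@continuous_comp _ _ _ (fun p : 'rV[R]_n * 'rV[R]_n => enorm p.2 / psi p.1) q);
    last exact: q_continuous.
  apply: (@cvgM _ _ _ _ (fun p : 'rV[R]_n * 'rV[R]_n => enorm p.2)).
    apply: (@continuous_comp _ _ _ snd (@enorm R n)); last exact: enorm_continuous.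
    exact: cvg_snd.
  apply: cvgV; first by rewrite gt_eqF.
  by apply: (@continuous_comp _ _ _ fst psi); [exact: cvg_fst|exact: psi_continuous].
apply: (@continuous_comp _ _ _ snd (fun M : 'rV[R]_n => M ord0 i)).
  exact: cvg_snd.
exact: coord_continuous.
Qed.

Lemma saturate_derivable (y : R -> 'rV[R]_n) (t : R) xi :
  derivable y t 1 -> derivable (fun x => saturate psi q (y x) xi) t 1.
Proof.
move=> dy; apply/derivable1_diffP.
apply: (@differentiableZl _ _ _ (fun x => q (enorm xi / psi (y x)))).
have dpsi : differentiable (psi \o y) t.
  apply: differentiable_comp; first exact/derivable1_diffP.
  exact: psi_differentiable_C1.1.
have dquot : differentiable (fun x => enorm xi * (psi (y x))^-1) t.
  apply: (@differentiableM _ _ (cst (enorm xi)) (fun x => (psi (y x))^-1)).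
    exact: differentiable_cst.
  by apply: (differentiableV dpsi); rewrite /= gt_eqF.
apply: (@differentiable_comp _ _ _ _ (fun x => enorm xi * (psi (y x))^-1) q) => //.
exact/derivable1_diffP.
Qed.

End Saturation.

(** * Solutions of the plant *)

Section PlantSolutions.
Context {R : realType} {n m : nat} (U : set 'rV[R]_m).
Context (f : 'rV[R]_n -> 'rV[R]_m -> 'rV[R]_n) (U_compact : compact U).
Hypothesis f_smooth : smooth_on (setT `*` U)
  (fun w : 'rV[R]_n * 'rV[R]_m => f w.1 w.2).
Local Notation L := (lebesgueType R).
Local Notation lebR := (@completed_lebesgue_measure R).
Implicit Types (x : R -> 'rV[R]_n) (u : R -> 'rV[R]_m).

Lemma plant_measurable (D : set R) x u : measurable (D : set L) ->
  leb_measurable D x -> leb_measurable D u -> (forall t, D t -> U (u t)) ->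
  leb_measurable D (fun t => f (x t) (u t)).
Proof.
move=> mD mx mu_ Uu i.
have [Om [g [oO UO fg dg _]]] := plant_C1 f_smooth.
have := @measurable_comp_open R n m D x u Om (fun p => g p ord0 i) mD mx mu_ oO _ _.
move=> /(_ _ _)/wrap[p Op|t Dt|].
- apply: (@continuous_comp _ _ _ g (fun M : 'rV[R]_n => M ord0 i)).
    exact/differentiable_continuous/dg.
  exact: coord_continuous.
- by apply: UO; exact: Uu.
apply: eq_measurable_fun => t; rewrite inE => Dt.
by rewrite fg//; exact: Uu.
Qed.

Lemma ode_unique b x1 x2 u : (forall t, 0 <= t <= b -> U (u t)) ->
  abs_continuous 0 b x1 -> abs_continuous 0 b x2 -> x1 0 = x2 0 ->
  {ae lebR, forall t, 0 < t < b -> is_derive t (1 : R) x1 (f (x1 t) (u t))} ->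
  {ae lebR, forall t, 0 < t < b -> is_derive t (1 : R) x2 (f (x2 t) (u t))} ->
  forall t, 0 <= t <= b -> x1 t = x2 t.
Proof.
move=> Uu ac1 ac2 x12 d1 d2 t tb.
have [B1 B10 H1] := abs_continuous_bounded ac1.
have [B2 B20 H2] := abs_continuous_bounded ac2.
have [C C0 HC] := plant_lipschitz U_compact f_smooth (Num.max B1 B2).
apply/eqP; rewrite -subr_eq0; apply/eqP.
apply: (@gronwall0 _ _ b (fun t => x1 t - x2 t) C C0) => //.
- apply: (abs_continuous_dom (C := 1) ac1 ac2) => s s' s0 ss sb.
  rewrite mul1r; apply: (@le_trans _ _ (enorm (x1 s' - x1 s) + enorm (x2 s' - x2 s))).
    have -> : x1 s' - x2 s' - (x1 s - x2 s) = (x1 s' - x1 s) - (x2 s' - x2 s).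
      by apply/rowP => i; rewrite !mxE; ring.
    exact: enormB.
  by rewrite lerDl subr_ge0.
- by rewrite x12 subrr.
- apply: ae_leb_imply2 d1 d2 _ => s e1 e2 /andP[s0 sb].
  have sb' : 0 <= s <= b by rewrite !ltW.
  exists (f (x1 s) (u s) - f (x2 s) (u s)).
    by apply: is_deriveB; [apply: e1|apply: e2]; rewrite s0.
  apply: HC; [by rewrite le_max H1|by rewrite le_max H2 ?orbT|exact: Uu].
Qed.

Lemma ac_incr_translate a b c (h : R -> R) : ac_incr (a + c) (b + c) (incr h) ->
  ac_incr a b (incr (fun t => h (t + c))).
Proof.
move=> ach e /ach[d d0 H]; exists d => // k lo hi lohi disj sd.
apply: (H _ (fun i => lo i + c) (fun i => hi i + c)).
- by move=> i; have [h1 h2 h3] := lohi i; rewrite !lerD2r.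
- move=> i j /disj dij; rewrite -subset0 => t [].
  rewrite /= !in_itv/= => /andP[t1 t2] /andP[t3 t4].
  have : (`]lo i, hi i[ `&` `]lo j, hi j[)%classic (t - c).
    by split; rewrite /= in_itv/=; apply/andP; split; lra.
  by rewrite dij.
- by apply: le_lt_trans sd; apply: ler_sum => i _; lra.
Qed.

Lemma abs_continuous_translate a b c x : abs_continuous (a + c) (b + c) x ->
  abs_continuous a b (fun t => x (t + c)).
Proof.
move=> ach e /ach[d d0 H]; exists d => // k lo hi lohi disj sd.
apply: (H _ (fun i => lo i + c) (fun i => hi i + c)).
- by move=> i; have [h1 h2 h3] := lohi i; rewrite !lerD2r.
- move=> i j /disj dij; rewrite -subset0 => t [].
  rewrite /= !in_itv/= => /andP[t1 t2] /andP[t3 t4].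
  have : (`]lo i, hi i[ `&` `]lo j, hi j[)%classic (t - c).
    by split; rewrite /= in_itv/=; apply/andP; split; lra.
  by rewrite dij.
- by apply: le_lt_trans sd; apply: ler_sum => i _; lra.
Qed.

Lemma is_derive_translate x (t c : R) dx : is_derive (t + c) (1 : R) x dx ->
  is_derive t (1 : R) (fun s => x (s + c)) dx.
Proof.
have EE : (fun h : R => h^-1 *: ((x \o shift (t + c)) (h *: (1 : R)) - x (t + c))) =
    (fun h => h^-1 *: (((fun s => x (s + c)) \o shift t) (h *: 1) - x (t + c))).
  by apply/funext => h; rewrite /shift/= addrA.
by move=> [dg gl]; apply: DeriveDef; rewrite /derivable /derive -EE.
Qed.

(** With [c = delta - r] this writes x(t - r + delta) - x(t - r) as an integral over
    [[t - delta, t]], the very window of the predictor integral. *)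
Lemma ode_integral_translate (x : R -> 'rV[R]_n) u (a b c : R) : a <= b ->
  0 <= a + c -> (forall t, 0 <= t -> U (u t)) -> leb_measurable `[0, +oo[ u ->
  (forall d, abs_continuous 0 d x) ->
  {ae lebR, forall t : R, 0 < t -> is_derive t (1 : R) x (f (x t) (u t))} ->
  bmeasv `[a, b] (fun s => f (x (s + c)) (u (s + c))) /\
  x (b + c) - x (a + c) = vint (fun s => f (x (s + c)) (u (s + c))) a b.
Proof.
move=> ab ac Uu mu_ acx dx.
have sub : `[a, b] `<=` ((fun t => t + c) @^-1` `[0, +oo[%classic).
  by move=> t; rewrite /= !in_itv/= andbT => /andP[ta tb]; lra.
have sub2 : `[a, b] `<=` ((fun t => t + c) @^-1` `[0, b + c]%classic).
  by move=> t; rewrite /= !in_itv/= => /andP[ta tb]; apply/andP; split; lra.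
have mE (i : interval R) : measurable (((fun t : R => t + c) @^-1` [set` i]) : set L).
  by apply: leb_measurable_set_translate; exact: leb_measurable_itv.
have muc : leb_measurable `[a, b] (fun s => u (s + c)).
  by move=> i; exact: measurable_funS (mE _) sub (leb_measurable_translate (mu_ i)).
have mxc : leb_measurable `[a, b] (fun s => x (s + c)).
  move=> i; have cx := @abs_continuous_within _ _ _ _ _ i (acx (b + c)).
  exact: measurable_funS (mE _) sub2
    (leb_measurable_translate (leb_measurable_continuous cx)).
have Uuc t : `[a, b]%classic t -> U (u (t + c)).
  by rewrite /= in_itv/= => /andP[ta tb]; apply: Uu; lra.
have [B B0 HB] := abs_continuous_bounded (acx (b + c)).
have [C C0 HC] := plant_bounded U_compact f_smooth B.
have bF : bmeasv `[a, b] (fun s => f (x (s + c)) (u (s + c))).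
  apply: (@bmeasvP _ _ _ _ C).
    exact: plant_measurable (leb_measurable_itv _) mxc muc Uuc.
  move=> t tab; apply: HC; last exact: Uuc.
  by apply: HB; have := sub2 t tab; rewrite /= in_itv.
split => //; apply/rowP => i; rewrite !mxE; apply/esym.
apply: (@itg_derive _ a b _ (fun t => x (t + c) ord0 i) ab (bF i)).
  apply: (@ac_incr_translate a b c (fun t => x t ord0 i)).
  apply: (@ac_incrS _ 0 (b + c)) => //.
  exact: abs_continuous_coord (acx (b + c)).
apply: ae_leb_imply (ae_leb_translate c dx) _ => t H /andP[ta tb].
have tc : 0 < t + c by lra.
by have /is_derive_translate/is_derive_rowP/(_ i) := H tc.
Qed.

Context (S : set 'rV[R]_n) (T psi : 'rV[R]_n -> R).
Hypothesis f_dissipative : forall (u : R -> 'rV[R]_m) (x : R -> 'rV[R]_n),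
     Linfty `[0, +oo[ U u -> ode_solution f u +oo%E x ->
     (forall t : R, 0 <= t -> T (x 0) <= t -> S (x t)) /\
     (forall t : R, 0 <= t -> enorm (x t) <= psi (x 0)).

Lemma compact_Linfty u : (forall t, 0 <= t -> U (u t)) ->
  leb_measurable `[0, +oo[ u -> Linfty `[0, +oo[ U u.
Proof.
move=> Uu mu_; have Uu' t : `[0, +oo[%classic t -> U (u t).
  by rewrite /= in_itv/= andbT; exact: Uu.
split => //.
have [p Up|C C0 HC] := compact_continuous_bounded U_compact (h := @enorm R m).
  exact: enorm_continuous.
exists C; apply: aeW => t /Uu' Ut; apply: le_trans (HC _ Ut); exact: ler_norm.
Qed.

(** Restart at time [s]: the shifted input is admissible and the shifted curve solves the plant, so
    the bound from time [0] applies. This puts the saturation threshold at psi(x(t - r)) above the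
    plant over the window. *)
Lemma dissipative_semigroup u x : (forall t, 0 <= t -> U (u t)) ->
  leb_measurable `[0, +oo[ u -> ode_solution f u +oo%E x ->
  forall s t, 0 <= s -> s <= t -> enorm (x t) <= psi (x s).
Proof.
move=> Uu mu_ [acx dx] s t s0 st.
have Lu : Linfty `[0, +oo[ U (fun t => u (t + s)).
  apply: compact_Linfty => [t' t'0|i]; first by apply: Uu; lra.
  have := leb_measurable_translate (c := s) (mu_ i).
  apply: measurable_funS.
    by apply: leb_measurable_set_translate; exact: leb_measurable_itv.
  by move=> t'; rewrite /= !in_itv/= !andbT; lra.
have sol : ode_solution f (fun t => u (t + s)) +oo%E (fun t => x (t + s)).
  split => [b _|].
    apply: abs_continuous_translate.
    have := acx (b + s) (ltry _); rewrite add0r => acxb e /acxb[d d0 H].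
    exists d => // k lo hi lohi; apply: H => i; have [h1 h2 h3] := lohi i.
    by split => //; exact: le_trans h1.
  apply: ae_leb_imply (ae_leb_translate s dx) _ => t' H t'0 _.
  by apply: is_derive_translate; apply: H; [lra|exact: ltry].
have [_ H] := f_dissipative Lu sol; have := H (t - s).
by rewrite subrK add0r subr_ge0; exact.
Qed.

End PlantSolutions.

(** * Monotone majorants for the constants of the estimate *)

Section SupremumBounds.
Context {R : realType} {n m : nat}.

(** Turns dependence on an initial point into monotone dependence on its norm. For [psi] it is the
    supremum occurring in [pmax]. *)
Definition supball (g : 'rV[R]_n -> R) (s : R) : R :=
  sup [set g z | z in [set z | enorm z <= s]].

Lemma supball_has_ubound (g : 'rV[R]_n -> R) s : continuous g ->
  has_ubound [set g z | z in [set z | enorm z <= s]].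
Proof.
move=> cg.
have [p _|C C0 HC] := compact_continuous_bounded (@compact_enorm_ball R n s) (h := g).
  exact: cg.
by exists C => _ [z zs <-]; apply: le_trans (ler_norm _) _; exact: HC.
Qed.

Lemma le_supball (g : 'rV[R]_n -> R) s y :
  continuous g -> enorm y <= s -> g y <= supball g s.
Proof. by move=> cg ys; apply: ub_le_sup; [exact: supball_has_ubound|exists y]. Qed.

Lemma supball_mono (g : 'rV[R]_n -> R) s t : continuous g -> 0 <= s -> s <= t ->
  supball g s <= supball g t.
Proof.
move=> cg s0 st; apply: ge_sup.
  by exists (g 0); exists 0 => //=; rewrite enorm0.
by move=> _ [z zs <-]; apply: le_supball => //; exact: le_trans zs st.
Qed.

Lemma within_coord (A : set R) (x0 : R -> 'rV[R]_n) i :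
  {within A, continuous x0} -> {within A, continuous (fun s => x0 s ord0 i)}.
Proof.
move=> cx t; apply: (@continuous_comp _ _ _ (x0 : subspace A -> _)
  (fun M : 'rV[R]_n => M ord0 i)); first exact: cx.
exact: coord_continuous.
Qed.

Lemma le_supnorm (r : R) (x0 : R -> 'rV[R]_n) s : {within `[- r, 0], continuous x0} ->
  - r <= s <= 0 -> enorm (x0 s) <= supnorm r x0.
Proof.
move=> cx sr; apply: ub_le_sup; last by exists s => //=; rewrite in_itv.
have [C _ HC] := within_bounded (fun i => @within_coord _ _ i cx).
by exists C => _ [t tr <-]; apply: HC; move: tr; rewrite /= in_itv.
Qed.

Context (U : set 'rV[R]_m) (f : 'rV[R]_n -> 'rV[R]_m -> 'rV[R]_n).
Context (psi : 'rV[R]_n -> R) (K : R).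
Hypothesis f_bounded : forall B, exists2 C, 0 <= C &
  forall x u, enorm x <= B -> U u -> enorm (f x u) <= C.
Hypothesis psi_cont : continuous psi.
Hypothesis psi_gt0 : forall y, 0 < psi y.
Hypothesis K_ge1 : 1 <= K.
Hypothesis U_nonempty : U !=set0.

Lemma supball_psi_ge0 s : 0 <= s -> 0 <= supball psi s.
Proof.
move=> s0; apply: le_trans (ltW (psi_gt0 0)) _.
by apply: le_supball => //; rewrite enorm0.
Qed.

Lemma le_pmax s x u : enorm x <= K * supball psi s -> U u ->
  enorm (f x u) <= pmax f U psi K s.
Proof.
move=> xs Uu; apply: ub_le_sup; last by exists (x, u).
have [C _ HC] := f_bounded (K * supball psi s).
by exists C => _ [w [Uw ws] <-]; exact: HC.
Qed.

Lemma pmax_ge0 s : 0 <= s -> 0 <= pmax f U psi K s.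
Proof.
move=> s0; have [u Uu] := U_nonempty.
apply: le_trans (enorm_ge0 (f 0 u)) _; apply: le_pmax => //.
by rewrite enorm0 mulr_ge0 ?supball_psi_ge0// (le_trans ler01).
Qed.

Lemma pmax_mono s t : 0 <= s -> s <= t -> pmax f U psi K s <= pmax f U psi K t.
Proof.
move=> s0 st; have [u Uu] := U_nonempty; have K0 : 0 <= K by exact: le_trans K_ge1.
apply: ge_sup.
  exists (enorm (f 0 u)); exists (0, u) => //; split => //=.
  by rewrite enorm0 mulr_ge0 ?supball_psi_ge0.
move=> _ [w [Uw ws] <-]; apply: le_pmax => //; apply: le_trans ws _.
by rewrite ler_wpM2l//; exact: supball_mono.
Qed.

End SupremumBounds.

Section SaturatedField.
Context {R : realType} {n m : nat} (U : set 'rV[R]_m).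
Context (f : 'rV[R]_n -> 'rV[R]_m -> 'rV[R]_n) (U_compact : compact U).
Hypothesis f_smooth : smooth_on (setT `*` U)
  (fun w : 'rV[R]_n * 'rV[R]_m => f w.1 w.2).
Context (psi : 'rV[R]_n -> R) (q : R -> R) (K : R).
Hypothesis psi_smooth : smooth_on setT (psi : 'rV[R]_n -> R^o).
Hypothesis psi_gt0 : forall y, 0 < psi y.
Hypothesis K_ge1 : 1 <= K.
Hypothesis q_ge0 : forall s, 0 <= q s.
Hypothesis q_derivable : forall s : R, derivable q s 1.
Hypothesis q_C1 : continuous (derive1 q).
Hypothesis q_eq1 : forall s, s <= 1 -> q s = 1.
Hypothesis q_bound : forall s, 1 <= s -> s * q s <= K.
Context (u : R -> 'rV[R]_m) (r delta : R).
Hypothesis u_val : forall t, - r <= t -> U (u t).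
Hypothesis u_meas : leb_measurable `[- r, +oo[ u.

(** The shift is harmless: [- delta <= s] gives [- r <= s - r + delta], where the input takes values
    in [U]. Boundedness and the Lipschitz property combine those of the plant on a compact domain
    with those of the saturation. *)
Lemma saturated_field : predictor_field
  (fun y s xi => f (saturate psi q y xi) (u (s - r + delta))) delta.
Proof.
have us s : - delta <= s -> U (u (s - r + delta)) by move=> ds; apply: u_val; lra.
have K0 : 0 <= K by exact: le_trans K_ge1.
have sb := @saturate_bound R n psi q K psi_gt0 K_ge1 q_ge0 q_eq1 q_bound.
split.
- move=> rho; have [[c C] [c0 C0 HC]] := psi_bounds psi_smooth psi_gt0 rho.
  have [D D0 HD] := plant_bounded U_compact f_smooth (K * C).
  exists D => // y s xi yr ds; apply: HD; last exact: us.
  apply: le_trans (sb _ _) _; rewrite ler_wpM2l//.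
  by case/andP : (HC y yr).
- move=> B; have [[c C] [c0 C0 HC]] := psi_bounds psi_smooth psi_gt0 B.
  have [D D0 HD] := plant_lipschitz U_compact f_smooth (K * C).
  have [E E0 HE] := saturate_lipschitz psi_smooth psi_gt0 q_ge0 q_derivable q_C1 q_eq1 B.
  have sB y xi : enorm y <= B -> enorm (saturate psi q y xi) <= K * C.
    move=> yB; apply: le_trans (sb _ _) _; rewrite ler_wpM2l//.
    by case/andP : (HC y yB).
  exists (D * E) => [|y y' s xi xi' yB yB' xB xB' ds]; first exact: mulr_ge0.
  apply: le_trans (HD _ _ _ (sB _ _ yB) (sB _ _ yB') (us _ ds)) _.
  by rewrite -mulrA ler_wpM2l//; exact: HE.
- move=> D y xi mD sub my mxi.
  apply: (plant_measurable f_smooth mD).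
  + move=> i; apply: (@measurable_comp_open R n n D y xi setT
      (fun p => saturate psi q p.1 p.2 ord0 i) mD my mxi openT) => // p _.
    exact: saturate_continuous.
  + move=> i; have := leb_measurable_translate (c := delta - r) (u_meas i).
    have mE : measurable
        (((fun x => x + (delta - r)) @^-1` `[- r, +oo[) : set (lebesgueType R)).
      by apply: leb_measurable_set_translate; exact: leb_measurable_itv.
    have subE : D `<=` (fun x => x + (delta - r)) @^-1` `[- r, +oo[%classic.
      move=> s /sub; rewrite /= !in_itv/= !andbT; lra.
    move=> /(measurable_funS mE subE).
    apply: eq_measurable_fun => s _; congr (u _ ord0 i); lra.
  + by move=> s /sub; rewrite /= in_itv/= andbT; exact: us.
- move=> y t s xi ds dy.
  have [Om [g [oO UO fg dg _]]] := plant_C1 f_smooth.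
  have Us := us _ ds; set v := u _ in Us *.
  have -> : (fun x => f (saturate psi q (y x) xi) v) =
      (fun x => g (saturate psi q (y x) xi, v)).
    by apply/funext => x; rewrite fg.
  apply/derivable1_diffP.
  apply: (@differentiable_comp _ _ _ _ (fun x => (saturate psi q (y x) xi, v)) g).
    apply: differentiable_pair; last exact: differentiable_cst.
    by apply/derivable1_diffP; exact: saturate_derivable.
  by apply: dg; exact: UO.
Qed.

End SaturatedField.

(** * Solutions of the closed delay system *)

Section DelaySystem.
Context {R : realType} {n m : nat} (U : set 'rV[R]_m).
Context (f : 'rV[R]_n -> 'rV[R]_m -> 'rV[R]_n) (U_compact : compact U).
Hypothesis f_smooth : smooth_on (setT `*` U)
  (fun w : 'rV[R]_n * 'rV[R]_m => f w.1 w.2).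
Context (psi : 'rV[R]_n -> R) (q : R -> R) (K : R).
Hypothesis psi_smooth : smooth_on setT (psi : 'rV[R]_n -> R^o).
Hypothesis psi_gt0 : forall y, 0 < psi y.
Hypothesis K_ge1 : 1 <= K.
Hypothesis q_ge0 : forall s, 0 <= q s.
Hypothesis q_derivable : forall s : R, derivable q s 1.
Hypothesis q_C1 : continuous (derive1 q).
Hypothesis q_eq1 : forall s, s <= 1 -> q s = 1.
Hypothesis q_bound : forall s, 1 <= s -> s * q s <= K.
Context (r delta mu : R) (r_gt0 : 0 < r) (delta_ge0 : 0 <= delta)
  (delta_le : delta <= r) (mu_ge0 : 0 <= mu).
Context (u : R -> 'rV[R]_m) (z x0 xi0 : R -> 'rV[R]_n).
Hypothesis u_val : forall t, - r <= t -> U (u t).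
Hypothesis u_meas : leb_measurable `[- r, +oo[ u.
Hypothesis z_ac : forall b : R, abs_continuous 0 b z.
Hypothesis z_derivable : {ae (@completed_lebesgue_measure R),
  forall t : R, 0 <= t -> derivable z t 1}.
Hypothesis x0_cont : {within `[- r, 0], continuous x0}.
Hypothesis xi0_cont : {within `[- r, 0], continuous xi0}.
Local Notation L := (lebesgueType R).
Local Notation lebR := (@completed_lebesgue_measure R).
Local Notation F := (fun y s xi => f (saturate psi q y xi) (u (s - r + delta))).
Local Notation P := (predF F delta z).

Lemma predictor_field_F : predictor_field F delta.
Proof. exact: (@saturated_field R n m U f U_compact f_smooth psi q K). Qed.

Lemma pred_intE xi : pred_int f psi q r delta u z xi = P xi.
Proof. by []. Qed.

Lemma predF_eq (xi xi' : R -> 'rV[R]_n) t :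
  (forall s, t - delta <= s <= t -> xi s = xi' s) -> P xi t = P xi' t.
Proof.
move=> E; rewrite /predF /vint; apply/rowP => i; rewrite !mxE.
by apply: eq_Rintegral => s; rewrite inE/= in_itv/= => st; rewrite E.
Qed.

Lemma leb_measurable_glue a b (xi eta eta' : R -> 'rV[R]_n) :
  (forall t, a <= t <= 0 -> xi t = eta t) -> (forall t, 0 < t <= b -> xi t = eta' t) ->
  leb_measurable `[a, 0] eta -> leb_measurable `[0, b] eta' ->
  leb_measurable `[a, b] xi.
Proof.
move=> h1 h2 m1 m2 i.
have sub : `[a, b] `<=` `[a, 0] `|` `]0, b].
  move=> t; rewrite /= !in_itv/= => /andP[-> ->]/=.
  by have [t0|t0] := leP t 0; [left|right].
apply: (@measurable_funS _ _ L R _ _ _ _ sub).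
  by apply: measurableU; exact: leb_measurable_itv.
apply/measurable_funU; [exact: leb_measurable_itv|exact: leb_measurable_itv|split].
  by apply: eq_measurable_fun (m1 i) => t; rewrite inE/= in_itv/= => ta; rewrite h1.
have sub2 : `]0, b] `<=` `[0, b].
  by move=> t; rewrite /= !in_itv/= => /andP[/ltW -> ->].
have := measurable_funS (leb_measurable_itv _) sub2 (m2 i).
by apply: eq_measurable_fun => t; rewrite inE/= in_itv/= => tb; rewrite h2.
Qed.

Lemma xi0_measurable : leb_measurable `[- delta, 0] xi0.
Proof.
have dr : - r <= - delta by rewrite lerN2.
apply: (leb_measurable_itvS dr (lexx _)) => i.
by apply: leb_measurable_continuous; exact: within_coord.
Qed.

Lemma xi0_bounded s : - delta <= s <= 0 -> enorm (xi0 s) <= supnorm r xi0.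
Proof.
move=> /andP[ds s0]; apply: le_supnorm => //; rewrite s0 andbT.
by apply: le_trans ds; rewrite lerN2.
Qed.

(** The initial defect depends on the data only, as the window of time [0] lies in the history. *)
Let e0 : 'rV[R]_n := xi0 0 - z 0 - P xi0 0.

(** The end time [T'] is arbitrary so that uniqueness also covers solutions known only on a bounded
    interval. *)
Lemma delay_solution_facts (T' : \bar R) (x xi : R -> 'rV[R]_n) b :
  delay_solution f psi q r delta mu u z x0 xi0 T' x xi -> 0 <= b -> (b%:E < T')%E ->
  [/\ abs_continuous 0 b x, x 0 = x0 0,
    {ae lebR, forall t : R, 0 < t < b -> is_derive t (1 : R) x (f (x t) (u t))} &
    exists2 B, 0 <= B & [/\ leb_measurable `[- delta, b] xi,
      forall s, - delta <= s <= b -> enorm (xi s) <= B,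
      forall s, - delta <= s <= 0 -> xi s = xi0 s &
      forall t, 0 <= t <= b -> xi t = (z t + expR (- mu * t) *: e0) + P xi t]].
Proof.
move=> [[Ex Exi] [acx dx] acxi dxi] b0 bT.
have r0 : - r <= 0 by rewrite oppr_le0 ltW.
have xi_eq s : - delta <= s <= 0 -> xi s = xi0 s.
  move=> /andP[ds s0]; apply: Exi; rewrite in_itv/= s0 andbT.
  by apply: le_trans ds; rewrite lerN2.
have d0 : - delta <= 0 by rewrite oppr_le0.
have acxib := acxi b bT.
have lt_T t : t < b -> (t%:E < T')%E.
  by move=> tb; apply: lt_trans bT; rewrite lte_fin.
have [B1 B10 HB1] := abs_continuous_bounded acxib.
have xiB s : - delta <= s <= b -> enorm (xi s) <= Num.max B1 (supnorm r xi0).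
  move=> /andP[ds sb]; rewrite le_max; have [s0|/ltW s0] := leP 0 s.
    by rewrite HB1// s0.
  by rewrite xi_eq ?ds//= xi0_bounded ?ds// orbT.
have mxi : leb_measurable `[- delta, b] xi.
  apply: (leb_measurable_glue xi_eq (fun _ _ => erefl) xi0_measurable) => i.
  apply: leb_measurable_continuous.
  exact: abs_continuous_within acxib.
split.
- exact: acx.
- by apply: Ex; rewrite in_itv/= r0 lexx.
- apply: ae_leb_imply dx _ => t H /andP[t0 tb]; apply: H; first exact: ltW.
  exact: lt_T.
- exists (Num.max B1 (supnorm r xi0)); first by rewrite le_max B10.
  split => // t tb.
  have E0 : xi 0 = xi0 0 by rewrite xi_eq// d0 lexx.
  have EP : P xi 0 = P xi0 0.
    by apply: predF_eq => s; rewrite sub0r; exact: xi_eq.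
  rewrite {1}(predictor_integral_eq delta_ge0 predictor_field_F mu_ge0 (z_ac b)
    acxib mxi xiB _ tb) ?E0 ?EP//.
  apply: ae_leb_imply dxi _ => s H /andP[s0 sb].
  by apply: H; [exact: ltW|exact: lt_T].
Qed.

Lemma delay_solution_unique (T1 T2 : \bar R) (x xi x' xi' : R -> 'rV[R]_n) t :
  delay_solution f psi q r delta mu u z x0 xi0 T1 x xi ->
  delay_solution f psi q r delta mu u z x0 xi0 T2 x' xi' ->
  - r <= t -> (t%:E < T1)%E -> (t%:E < T2)%E -> x' t = x t /\ xi' t = xi t.
Proof.
move=> s1 s2 tr tT1 tT2; have [t0|t0] := leP 0 t; last first.
  have [[Ex Exi] _ _ _] := s1; have [[Ex' Exi'] _ _ _] := s2.
  have tin : t \in `[- r, 0] by rewrite in_itv/= tr ltW.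
  by rewrite Ex// Exi// Ex'// Exi'.
have [acx x00 dx [B B0 [mxi xiB xieq xiE]]] := delay_solution_facts s1 t0 tT1.
have [acx' x00' dx' [B' B'0 [mxi' xiB' xieq' xiE']]] := delay_solution_facts s2 t0 tT2.
have tt : 0 <= t <= t by rewrite t0 lexx.
split.
  apply: (ode_unique U_compact f_smooth _ acx' acx _ dx' dx tt).
    move=> s /andP[s0 _]; apply: u_val; apply: le_trans s0.
    by rewrite oppr_le0 ltW.
  by rewrite x00 x00'.
have [rho _ zr] := abs_continuous_bounded (z_ac t).
apply: (volterra_unique (B := Num.max B B') delta_ge0 predictor_field_F _ zr mxi' mxi
  _ _ _ xiE' xiE tt).
- by rewrite le_max B0.
- by move=> s sb; rewrite le_max xiB' ?orbT.
- by move=> s sb; rewrite le_max xiB.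
- by move=> s sb; rewrite xieq// xieq'.
Qed.

Lemma abs_continuous_eq a b (x y : R -> 'rV[R]_n) :
  (forall t, a <= t <= b -> x t = y t) -> abs_continuous a b y -> abs_continuous a b x.
Proof.
move=> xy acy; apply: (abs_continuous_dom (C := 1) acy acy) => s t as_ st tb.
rewrite !xy ?(le_trans as_ st) ?as_ ?tb ?(le_trans st tb)// mul1r -addrA lerDl.
by rewrite addr_ge0 ?enorm_ge0 ?subr_ge0.
Qed.

Lemma delay_solution_exists rho :
  forward_complete U f -> (forall t, 0 <= t -> enorm (z t) <= rho) ->
  exists x xi, delay_solution f psi q r delta mu u z x0 xi0 +oo%E x xi.
Proof.
move=> fc zr.
have r0 : - r <= 0 by rewrite oppr_le0 ltW.
have d0 : - delta <= 0 by rewrite oppr_le0.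
have Lu : Linfty_loc `[0, +oo[ U u.
  have Uu (t : R) : 0 <= t -> U (u t) by move=> t0; apply: u_val; exact: le_trans t0.
  have mu_ : leb_measurable `[0, +oo[ u.
    apply: leb_measurableS u_meas; first exact: leb_measurable_itv.
    by move=> t; rewrite /= !in_itv/= !andbT => t0; exact: le_trans t0.
  have [LU ? [C HC]] := compact_Linfty U_compact Uu mu_.
  split => // a b; exists C; apply: ae_leb_imply HC _ => t H [t0 _]; exact: H.
have [X X0 [acX dX]] := fc u (x0 0) Lu.
have [xi [B [xi_le0 xi_gt0 mxi xiB]]] := volterra_exists delta_ge0 predictor_field_F
  e0 mu_ge0 z_ac zr xi0_measurable xi0_bounded.
pose x t := if t <= 0 then x0 t else X t.
have xX t : 0 <= t -> x t = X t.
  move=> t0; rewrite /x; case: leP => // t0'.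
  by have -> : t = 0 by apply/eqP; rewrite eq_le t0 t0'.
have P0 : P xi 0 = P xi0 0.
  by apply: predF_eq => s /andP[_ s0]; exact: xi_le0.
have xiE t : 0 <= t -> xi t = z t + expR (- mu * t) *: e0 + P xi t.
  rewrite le_eqVlt => /predU1P[<-|]; last exact: xi_gt0.
  rewrite xi_le0// mulr0 expR0 scale1r P0 /e0.
  move: (P xi0 0) (xi0 0) (z 0) => a1 a2 a3.
  by apply/rowP => i; rewrite !mxE; ring.
have xiBb b s : - delta <= s <= b -> enorm (xi s) <= B.
  by move=> /andP[ds _]; exact: xiB.
exists x, xi; split.
- split => t; rewrite in_itv/= => /andP[_ t0]; last exact: xi_le0.
  by rewrite /x t0.
- split => [b _|].
    apply: (@abs_continuous_eq _ _ _ X); last exact: acX (ltry b).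
    by move=> t /andP[t0 _]; exact: xX.
  (* At time [0] the glued curve equals the history on the left, and the derivative of [X] need not
     be inherited. *)
  have n0 : {ae lebR, forall t : R, t != 0}.
    apply/leb_negligibleP; exists [set 0]; split => //.
      exact: lebesgue_measure_set1.
    by move=> t /= /negP; rewrite negbK => /eqP.
  apply: ae_leb_imply2 dX n0 _ => t H tn0 t0 tT.
  have {tn0}t0' : 0 < t by rewrite lt_neqAle eq_sym tn0.
  rewrite xX//; apply: near_eq_is_derive (H t0 tT).
  have : t \in `]0, t + 1[ by rewrite in_itv/= t0' ltrDl ltr01.
  move/near_in_itvoo; apply: filterS => s; rewrite in_itv/= => /andP[s0 _].
  by rewrite xX// ltW.
- move=> b _.
  have acP := predF_abs_continuous delta_ge0 predictor_field_F (mxi b) (xiBb b) (z_ac b).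
  apply: (abs_continuous_dom (C := 1 + mu * enorm e0) (z_ac b) acP) => s t s0 st tb.
  have t0 := le_trans s0 st; rewrite !xiE//.
  have -> : z t + expR (- mu * t) *: e0 + P xi t - (z s + expR (- mu * s) *: e0 + P xi s)
      = (z t - z s) + (P xi t - P xi s) + (expR (- mu * t) - expR (- mu * s)) *: e0.
    move: (expR _) (expR _) (z t) (z s) (P xi t) (P xi s) => a1 a2 v1 v2 v3 v4.
    by rewrite scalerBl; apply/rowP => i; rewrite !mxE; ring.
  apply: le_trans (enormD _ _) _; rewrite enormZ.
  apply: (@le_trans _ _ (enorm (z t - z s) + enorm (P xi t - P xi s) +
     (mu * (t - s)) * enorm e0)).
    apply: lerD; first exact: enormD.
    by apply: ler_wpM2r; [exact: enorm_ge0|exact: expRN_lipschitz].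
  move: (enorm_ge0 (z t - z s)) (enorm_ge0 (P xi t - P xi s)).
  have : 0 <= mu * enorm e0 by rewrite mulr_ge0 ?enorm_ge0.
  have : 0 <= t - s by rewrite subr_ge0.
  by move: (enorm _) (enorm _) (enorm _) => A1 A2 A3; nra.
- have dP : {ae lebR, forall t, 0 < t -> derivable (P xi) t 1}.
    (* Differentiability is known on bounded intervals; the exceptional sets of a countable
       exhaustion are united. *)
    pose A (k : nat) := ~` [set t : R | 0 < t < k%:R -> derivable (P xi) t 1].
    have nA : lebR.-negligible (\bigcup_k A k).
      apply: negligible_bigcup => k.
      apply: (predF_derivable delta_ge0 predictor_field_F (mxi _) (xiBb _) (z_ac _)).
      by apply: ae_leb_imply z_derivable _ => t H /andP[t0 _]; apply: H; exact: ltW.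
    apply: negligibleS nA => t /= /not_implyP[t0 nd].
    exists (Num.bound t) => // /= H; apply: nd; apply: H; rewrite t0.
    exact: archi_boundP (ltW t0).
  have n0 : {ae lebR, forall t : R, t != 0}.
    apply/leb_negligibleP; exists [set 0]; split => //.
      exact: lebesgue_measure_set1.
    by move=> t /= /negP; rewrite negbK => /eqP.
  apply: ae_leb_imply2 (ae_leb_imply2 dP n0 _) z_derivable _ => [t H1 H2|t H1 H2 t0 _].
    exact: (conj H1 H2).
  have t0' : 0 < t by rewrite lt_neqAle eq_sym H1.2.
  have dzt := H2 t0; have dPt := H1.1 t0'.
  rewrite pred_intE; split; [exact: dzt|exact: dPt|].
  have dE : is_derive t (1 : R) (fun x => expR (- mu * x) *: e0)
      ((- mu * expR (- mu * t)) *: e0).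
    apply/is_derive_rowP => i.
    have h : is_derive t (1 : R) (fun s : R => - mu * s) (- mu).
      by rewrite -[X in is_derive _ _ _ X]mulr1; exact: is_deriveZ.
    have -> : (fun s => (expR (- mu * s) *: e0) ord0 i) =
        (fun s : R => e0 ord0 i * expR (- mu * s)).
      by apply/funext => s; rewrite mxE mulrC.
    have := is_deriveZ (e0 ord0 i) (is_derive1_comp (is_derive_expR (- mu * t)) h).
    move=> H; apply: (is_derive_eq H).
    by rewrite !mxE /GRing.scale/=; ring.
  have near_ : \near t, ((z \+ (fun x => expR (- mu * x) *: e0)) \+ P xi) t = xi t.
    have : t \in `]0, t + 1[ by rewrite in_itv/= t0' ltrDl ltr01.
    move/near_in_itvoo; apply: filterS => s; rewrite in_itv/= => /andP[s0 _].
    by rewrite /= xiE// ltW.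
  have H := is_deriveD (is_deriveD (derivableP dzt) dE) (derivableP dPt).
  have := near_eq_is_derive near_ H => {}H; apply: (is_derive_eq H).
  have lin (d1 d2 v1 v2 v3 : 'rV[R]_n) (c ex : R) :
      d1 + (- c * ex) *: v3 + d2 =
      d1 + d2 - c *: (v1 + ex *: v3 + v2 - v1 - v2).
    by apply/rowP => i; rewrite !mxE; ring.
  by rewrite (xiE t)//; exact: lin.
Qed.

End DelaySystem.

(** * The prediction estimate *)

(* A delayed small-gain inequality, in the norm sup_t exp(sigma t) H(t); the
   part [t < T2] is absorbed in the exponentially decaying term. *)
Lemma small_gain_estimate (R : realType) (sigma delta G1 G2 T2 Bd E SS t1 : R)
    (H D : R -> R) :
  0 < sigma -> 0 <= delta -> 0 < G1 -> 0 < G2 -> 0 <= Bd -> 0 <= E -> 0 <= t1 ->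
  G1 * ((expR (sigma * delta) - 1) / sigma) < 1 ->
  (forall t, 0 <= t <= t1 -> 0 <= H t <= Bd) ->
  (forall t, 0 <= t <= t1 -> 0 <= D t) ->
  (forall t, 0 <= t <= t1 -> expR (- sigma * (t1 - t)) * D t <= SS) ->
  (forall t N, 0 <= t <= t1 -> T2 <= t -> 0 <= N ->
    (forall s, 0 <= s <= t -> H s <= N * expR (- sigma * s)) ->
    H t <= (1 + G2 * delta) * D t + expR (- sigma * t) *
      (E + G1 * ((expR (sigma * delta) - 1) / sigma) * N)) ->
  H t1 <= expR (- sigma * t1) * ((expR (sigma * T2) * Bd + E) /
      (1 - G1 * ((expR (sigma * delta) - 1) / sigma))) +
    (sigma + G2 * (expR (sigma * delta) - 1)) /
      (sigma - G1 * (expR (sigma * delta) - 1)) * SS.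
Proof.
move=> s0 d0 G10 G20 Bd0 E0 t10; set c := G1 * _ => c1 HB D0 DS step.
have ed : 1 + sigma * delta <= expR (sigma * delta) := expR_ge1Dx _.
have c0 : 0 <= c.
  rewrite /c mulr_ge0 ?(ltW G10)// divr_ge0 ?(ltW s0)// subr_ge0.
  by apply: le_trans ed; rewrite lerDl mulr_ge0// ltW.
have expK (t : R) : expR (sigma * t) * expR (- sigma * t) = 1.
  by rewrite -expRD mulNr subrr expR0.
have expK' (t : R) : expR (- sigma * t) * expR (sigma * t) = 1 by rewrite mulrC.
have et (t : R) : 0 < expR (sigma * t) := expR_gt0 _.
(* Taken over the finite horizon [t1], so the supremum is finite before any decay is known. *)
pose A := [set expR (sigma * t) * H t | t in [set t | 0 <= t <= t1]].
have t11 : 0 <= t1 <= t1 by rewrite t10 lexx.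
have A0 : A !=set0 by exists (expR (sigma * t1) * H t1); exists t1.
have Aub : has_ubound A.
  exists (expR (sigma * t1) * Bd) => _ [t tt <-].
  have /andP[h0 hB] := HB t tt; have /andP[t0 tt1] := tt.
  by apply: ler_pM; [exact: expR_ge0|exact: h0|rewrite ler_expR ler_pM2l|exact: hB].
pose N := sup A.
have HN t : 0 <= t <= t1 -> expR (sigma * t) * H t <= N.
  by move=> tt; apply: ub_le_sup => //; exists t.
have N0 : 0 <= N.
  apply: le_trans (HN t1 t11); rewrite mulr_ge0 ?expR_ge0//.
  by case/andP : (HB t1 t11).
pose W := expR (sigma * t1) * SS.
have SS0 : 0 <= SS.
  by apply: le_trans (DS t1 t11); rewrite mulr_ge0 ?expR_ge0 ?D0.
have W0 : 0 <= W by rewrite /W mulr_ge0 ?expR_ge0.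
(* The factor exp(sigma t1) undoes the discount from [t1] contained in [SS]. *)
have DW t : 0 <= t <= t1 -> expR (sigma * t) * D t <= W.
  move=> tt; rewrite /W.
  have -> : expR (sigma * t) = expR (sigma * t1) * expR (- sigma * (t1 - t)).
    by rewrite -expRD; congr expR; ring.
  by rewrite -mulrA ler_wpM2l ?expR_ge0// DS.
have G2d : 0 <= G2 * delta by rewrite mulr_ge0// ltW.
(* Before [T2] the crude bound is used; afterwards the one-step inequality is fed with [N]
   itself. *)
have NB : N <= Num.max (expR (sigma * T2) * Bd) ((1 + G2 * delta) * W + E + c * N).
  apply: ge_sup => // _ [t tt <-]; have /andP[t0 tt1] := tt.
  rewrite le_max; have [T2t|/ltW tT2] := leP T2 t; last first.
    apply/orP; left; have /andP[h0 hB] := HB t tt.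
    by apply: ler_pM; [exact: expR_ge0|exact: h0|rewrite ler_expR ler_pM2l|exact: hB].
  apply/orP; right.
  have Hs s : 0 <= s <= t -> H s <= N * expR (- sigma * s).
    move=> /andP[s0' st]; have sb : 0 <= s <= t1 by rewrite s0' (le_trans st).
    have := ler_wpM2r (expR_ge0 (- sigma * s)) (HN s sb).
    by rewrite mulrAC expK mul1r.
  have := ler_wpM2l (expR_ge0 (sigma * t)) (step t N tt T2t N0 Hs).
  rewrite mulrDr [expR (sigma * t) * (expR _ * _)]mulrA expK mul1r => /le_trans; apply.
  rewrite -addrA lerD2r mulrCA ler_wpM2l ?DW//.
  by rewrite addr_ge0.
have c1' : 0 < 1 - c by rewrite subr_gt0.
have NB2 : N * (1 - c) <= (1 + G2 * delta) * W + (expR (sigma * T2) * Bd + E).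
  have W1 : 0 <= (1 + G2 * delta) * W by rewrite mulr_ge0// addr_ge0.
  have B1 : 0 <= expR (sigma * T2) * Bd by rewrite mulr_ge0 ?expR_ge0.
  have cN : 0 <= c * N by rewrite mulr_ge0.
  move: NB; rewrite le_max => /orP[|]; rewrite mulrBr mulr1 [N * c]mulrC; lra.
have H1 : H t1 <= expR (- sigma * t1) * N.
  have := ler_wpM2l (expR_ge0 (- sigma * t1)) (HN t1 t11).
  by rewrite mulrA expK' mul1r.
apply: le_trans H1 _.
set Bt := expR (sigma * T2) * Bd + E in NB2 *.
have N2 : N <= Bt / (1 - c) + (1 + G2 * delta) / (1 - c) * W.
  by rewrite mulrAC -mulrDl ler_pdivlMr// [Bt + _]addrC.
apply: le_trans (ler_wpM2l (expR_ge0 _) N2) _.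
rewrite mulrDr lerD2l mulrCA /W [expR (- sigma * t1) * (_ * _)]mulrA expK' mul1r.
rewrite ler_wpM2r//.
(* Here [beta] appears: its denominator is [sigma * (1 - c)], and [ed] gives sigma (1 + G2 delta) <=
   sigma + G2 (exp(sigma delta) - 1). *)
have sc : sigma - G1 * (expR (sigma * delta) - 1) = sigma * (1 - c).
  by rewrite /c; field; rewrite gt_eqF.
rewrite sc invfM mulrA ler_wpM2r ?invr_ge0 ?(ltW c1')//.
rewrite ler_pdivlMr//; nra.
Qed.

Lemma delayed_time_ge (R : realFieldType) (r delta t s : R) :
  0 <= t -> t - delta <= s -> - r <= s - r + delta.
Proof. by move=> t0 ts; lra. Qed.

(** Applied with [a] a bound for the entrance time into [S] and [b] the time after which the defect
    is at most [1]; the summands [r] and [delta] leave room for the window. *)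
Lemma entrance_times (R : realFieldType) (r delta a b t s : R) :
  0 <= r -> 0 <= delta -> delta <= r -> 0 <= a -> 0 <= b ->
  a + b + r + delta <= t -> t - delta <= s ->
  [/\ 0 <= s, a <= s, b <= s & a <= t].
Proof. by move=> *; split; lra. Qed.

(** The counterpart for the delayed times at which the plant is read, the earliest being [t - r]. *)
Lemma delayed_entrance_times (R : realFieldType) (r delta a b t s : R) :
  0 <= r -> 0 <= delta -> delta <= r -> 0 <= a -> 0 <= b ->
  a + b + r + delta <= t -> t - delta <= s ->
  [/\ 0 <= t - r, a <= t - r, 0 <= s - r + delta, a <= s - r + delta &
      t - r <= s - r + delta].
Proof. by move=> *; split; lra. Qed.

Theorem proposition4p1 (R : realType) (n m : nat)
  (U : set 'rV[R]_m) (f : 'rV[R]_n -> 'rV[R]_m -> 'rV[R]_n)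
  (U_nonempty : U !=set0) (U_compact : compact U)
  (f_smooth : smooth_on (setT `*` U)
     (fun w : 'rV[R]_n * 'rV[R]_m => f w.1 w.2))
  (f_complete : forward_complete U f)
  (S : set 'rV[R]_n) (T : 'rV[R]_n -> R) (psi : 'rV[R]_n -> R)
  (S_nonempty : S !=set0) (S_compact : compact S)
  (T_continuous : continuous T) (T_ge0 : forall y, 0 <= T y)
  (psi_smooth : smooth_on setT (psi : 'rV[R]_n -> R^o))
  (psi_gt0 : forall y, 0 < psi y)
  (f_dissipative : forall (u : R -> 'rV[R]_m) (x : R -> 'rV[R]_n),
     Linfty `[0, +oo[ U u -> ode_solution f u +oo%E x ->
     (forall t : R, 0 <= t -> T (x 0) <= t -> S (x t)) /\
     (forall t : R, 0 <= t -> enorm (x t) <= psi (x 0)))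
  (sigma r : R) (sigma_gt0 : 0 < sigma) (r_gt0 : 0 < r)
  (q : R -> R) (K : R) (K_ge1 : 1 <= K)
  (q_ge0 : forall s, 0 <= q s)
  (q_derivable : forall s : R, derivable q s 1)
  (q_C1 : continuous (derive1 q))
  (q_eq1 : forall s, s <= 1 -> q s = 1)
  (q_bound : forall s, 1 <= s -> s * q s <= K)
  (G1 G2 : R) (G1_gt0 : 0 < G1) (G2_gt0 : 0 < G2)
  (G_lipschitz : forall (u : 'rV[R]_m) (y x z xi : 'rV[R]_n),
     U u -> S y -> S x -> S z -> S_tilde f U S psi K r xi ->
     enorm (f (saturate psi q z xi) u - f (saturate psi q y x) u)
       <= G1 * enorm (xi - x) + G2 * enorm (z - y))
  (mu : R) (mu_ge : sigma <= mu)
  (delta : R) (delta_ge0 : 0 <= delta) (delta_le : delta <= r)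
  (small_gain : G1 * ((expR (sigma * delta) - 1) / sigma) < 1) :
  let beta := (sigma + G2 * (expR (sigma * delta) - 1))
              / (sigma - G1 * (expR (sigma * delta) - 1)) in
  exists M : R -> R,
    [/\ forall s : R, 0 <= s -> 0 <= M s,
        forall s t : R, 0 <= s -> s <= t -> M s <= M t &
        forall (u : R -> 'rV[R]_m) (z x0 xi0 : R -> 'rV[R]_n),
          Linfty_loc `[- r, +oo[ U u ->
          (forall b : R, abs_continuous 0 b z) ->
          (exists2 dz : R -> 'rV[R]_n, Linfty_loc `[0, +oo[ setT dz &
             {ae leb, forall t : R, 0 <= t -> is_derive t 1 z (dz t)}) ->
          (forall s t : R, 0 <= s -> s <= t -> enorm (z t) <= psi (z s)) ->
          (forall t : R, 0 <= t -> T (z 0) <= t -> S (z t)) ->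
          {within `[- r, 0], continuous x0} ->
          {within `[- r, 0], continuous xi0} ->
          exists x xi : R -> 'rV[R]_n,
            [/\ delay_solution f psi q r delta mu u z x0 xi0 +oo%E x xi,
                forall (T' : \bar R) (x' xi' : R -> 'rV[R]_n),
                  delay_solution f psi q r delta mu u z x0 xi0 T' x' xi' ->
                  forall t : R, - r <= t -> (t%:E < T')%E ->
                    x' t = x t /\ xi' t = xi t &
                forall t : R, 0 <= t ->
                  enorm (xi t - x (t - r + delta)) <=
                    expR (- sigma * t)
                      * M (supnorm r x0 + enorm (z 0) + supnorm r xi0)
                    + beta * sup [set expR (- sigma * (t - s))
                                        * enorm (z s - x (s - r))
                                 | s in `[0, t]]]].
Proof.
move=> beta.
have mu_gt0 : 0 < mu by exact: lt_le_trans mu_ge.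
have psi_cont : continuous psi := psi_continuous psi_smooth.
have f_bnd := plant_bounded U_compact f_smooth.
set c := G1 * _ in small_gain.

(* Constants depending on the size of the data *)
pose pb := supball psi; pose Tb := supball T; pose pm := pmax f U psi K.
have pb_ge0 s : 0 <= s -> 0 <= pb s by move=> s0; exact: supball_psi_ge0.
have pb_mono s t : 0 <= s -> s <= t -> pb s <= pb t by exact: supball_mono.
have Tb_ge0 s : 0 <= s -> 0 <= Tb s.
  by move=> s0; apply: le_trans (T_ge0 0) _; apply: le_supball => //; rewrite enorm0.
have Tb_mono s t : 0 <= s -> s <= t -> Tb s <= Tb t by exact: supball_mono.
have pm_ge0 s : 0 <= s -> 0 <= pm s by move=> s0; exact: pmax_ge0.
have pm_mono s t : 0 <= s -> s <= t -> pm s <= pm t by move=> s0 st; exact: pmax_mono.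
(* Bounds on [|xi(0) - z(0) - P(0)|], on the entrance time in the region where
   the Lipschitz estimate applies, and on the prediction error. *)
pose E s := s + r * pm s.
pose T2 s := Tb s + E s / mu + r + delta.
pose Bd s := pb s + r * pm (pb s) + E s + (s + pb s).
(* The decaying constant of [small_gain_estimate]; it is monotone because [T2], [Bd] and [E] are and
   [c] is fixed. *)
pose M s := (expR (sigma * T2 s) * Bd s + E s) / (1 - c).
have r0 := ltW r_gt0.
have E_ge0 s : 0 <= s -> 0 <= E s by move=> s0; rewrite addr_ge0 ?mulr_ge0 ?pm_ge0.
have E_mono s t : 0 <= s -> s <= t -> E s <= E t.
  by move=> s0 st; rewrite lerD// ler_wpM2l ?pm_mono.
have Bd_ge0 s : 0 <= s -> 0 <= Bd s.
  by move=> s0; rewrite !addr_ge0 ?mulr_ge0 ?pm_ge0 ?pb_ge0 ?E_ge0.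
have Bd_mono s t : 0 <= s -> s <= t -> Bd s <= Bd t.
  move=> s0 st; rewrite /Bd; apply: lerD; last by apply: lerD => //; exact: pb_mono.
  apply: lerD; last exact: E_mono.
  apply: lerD; first exact: pb_mono.
  by rewrite ler_wpM2l// pm_mono ?pb_mono ?pb_ge0.
have T2_mono s t : 0 <= s -> s <= t -> T2 s <= T2 t.
  move=> s0 st; rewrite /T2 !lerD2r; apply: lerD; first exact: Tb_mono.
  by rewrite ler_pM2r ?invr_gt0// E_mono.
have c1 : 0 < 1 - c by rewrite subr_gt0.
have M_mono s t : 0 <= s -> s <= t -> M s <= M t.
  move=> s0 st; rewrite /M ler_pM2r ?invr_gt0//; apply: lerD; last exact: E_mono.
  apply: ler_pM; [exact: expR_ge0|exact: Bd_ge0| |exact: Bd_mono].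
  by rewrite ler_expR ler_pM2l// T2_mono.
exists M; split => [s s0||u z x0 xi0 Lu acz dz zpsi zS cx0 cxi0].
- rewrite divr_ge0 ?(ltW c1)// addr_ge0 ?E_ge0// mulr_ge0 ?expR_ge0//; exact: Bd_ge0.
- exact: M_mono.
have [u_in u_meas _] := Lu.
have u_val (t : R) : - r <= t -> U (u t).
  by move=> tr; apply: u_in; rewrite /= in_itv/= tr.
have zder : {ae (@completed_lebesgue_measure R),
    forall t : R, 0 <= t -> derivable z t 1}.
  by have [dz' _ Hz] := dz; apply: ae_leb_imply Hz _ => t H t0; have [] := H t0.
have HFs := predictor_field_F U_compact f_smooth psi_smooth psi_gt0 K_ge1 q_ge0
  q_derivable q_C1 q_eq1 q_bound delta u_val u_meas.
have mu0 := ltW mu_gt0.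
have zB t : 0 <= t -> enorm (z t) <= psi (z 0) by move=> t0; exact: zpsi.
have [x [xi sol]] := delay_solution_exists U_compact f_smooth psi_smooth psi_gt0
  K_ge1 q_ge0 q_derivable q_C1 q_eq1 q_bound r_gt0 delta_ge0 delta_le mu0 x0 u_val u_meas
  acz zder cxi0 f_complete zB.
exists x, xi; split => //.
  move=> T' x' xi' sol' t tr tT.
  apply: (delay_solution_unique U_compact f_smooth psi_smooth psi_gt0
    K_ge1 q_ge0 q_derivable q_C1 q_eq1 q_bound r_gt0 delta_ge0 delta_le mu0 u_val u_meas
    acz cxi0 sol sol' tr _ tT).
  exact: ltry.

(* A priori bounds along the solution *)
move=> t1 t10.
set P := predF (fun y s xi => f (saturate psi q y xi) (u (s - r + delta))) delta z.
pose A := supnorm r x0 + enorm (z 0) + supnorm r xi0; rewrite -/A.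
have mr0 : - r <= 0 by rewrite oppr_le0.
have md0 : - delta <= 0 by rewrite oppr_le0.
have x0B s : - r <= s <= 0 -> enorm (x0 s) <= supnorm r x0 by exact: le_supnorm.
have xi0B s : - r <= s <= 0 -> enorm (xi0 s) <= supnorm r xi0 by exact: le_supnorm.
have rr : - r <= (0 : R) <= 0 by rewrite mr0 lexx.
have nx0 : 0 <= supnorm r x0 := le_trans (enorm_ge0 _) (x0B 0 rr).
have nxi0 : 0 <= supnorm r xi0 := le_trans (enorm_ge0 _) (xi0B 0 rr).
have nz0 := enorm_ge0 (z 0).
have A0 : 0 <= A by rewrite /A !addr_ge0.
have x0A : supnorm r x0 <= A by rewrite /A -addrA lerDl addr_ge0.
have zA : enorm (z 0) <= A by rewrite /A addrAC lerDr addr_ge0.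
have facts b (b0 : 0 <= b) := delay_solution_facts U_compact f_smooth psi_smooth psi_gt0
  K_ge1 q_ge0 q_derivable q_C1 q_eq1 q_bound r_gt0 delta_ge0 delta_le mu0 u_val u_meas
  acz cxi0 sol b0 (ltry b).
have [[Ex _] odex _ _] := sol; have [acx dx] := odex.
have [_ x00 _ [_ _ [_ _ xi_le0 _]]] := facts 0 (lexx 0).
have u0_val (t : R) : 0 <= t -> U (u t) by move=> t0; apply: u_val; exact: le_trans t0.
have u0_meas : leb_measurable `[0, +oo[ u.
  apply: leb_measurableS u_meas; first exact: leb_measurable_itv.
  by move=> t; rewrite /= !in_itv/= !andbT => t0; exact: le_trans t0.
have [xS _] := f_dissipative u x (compact_Linfty U_compact u0_val u0_meas) odex.
have semi := dissipative_semigroup U_compact f_dissipative u0_val u0_meas odex.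
have x0A' : enorm (x 0) <= A by rewrite x00; exact: le_trans (x0B 0 rr) x0A.
have psix : psi (x 0) <= pb A by exact: le_supball.
have Tx : T (x 0) <= Tb A by exact: le_supball.
have psiz : psi (z 0) <= pb A by exact: le_supball.
have Tz : T (z 0) <= Tb A by exact: le_supball.
have pbA := pb_ge0 A A0; have EA := E_ge0 A A0; have TbA := Tb_ge0 A A0.
have zpb t : 0 <= t -> enorm (z t) <= pb A.
  by move=> t0; apply: le_trans (zB t t0) psiz.
have xB s : - r <= s -> enorm (x s) <= A + pb A.
  move=> sr; have [s0|/ltW s0] := leP 0 s.
    apply: le_trans (semi 0 s (lexx _) s0) _; apply: le_trans psix _.
    by rewrite lerDr.
  rewrite Ex ?in_itv/= ?sr//; apply: le_trans (x0B s _) _; first by rewrite sr.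
  by apply: le_trans x0A _; rewrite lerDl.
have satB := @saturate_bound R n psi q K psi_gt0 K_ge1 q_ge0 q_eq1 q_bound.
have mP t : 0 <= t -> bmeasv `[t - delta, t]
    (fun s => f (saturate psi q (z t) (xi s)) (u (s - r + delta))).
  move=> t0; have [_ _ _ [_ _ [mxi _ _ _]]] := facts t t0.
  have dt : - delta <= t - delta by rewrite lerDr.
  exact: (field_bmeasv HFs (z t) dt (leb_measurable_itvS dt (lexx _) mxi)).
have us t s : 0 <= t -> t - delta <= s -> U (u (s - r + delta)).
  by move=> t0 ts; apply/u_val/(delayed_time_ge _ t0).
(* The saturation keeps the first argument of [f] in the ball that defines [pmax]. With [rho] the
   radius of [S] this is the term r p(a) of [S_tilde]. *)
have PB t rho : 0 <= t -> enorm (z t) <= rho -> enorm (P xi t) <= r * pm rho.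
  move=> t0 zr; have rho0 : 0 <= rho := le_trans (enorm_ge0 _) zr.
  apply: (@le_trans _ _ (pm rho * (t - (t - delta)))).
    apply: enorm_vint_bound; [by rewrite gerBl|exact: mP|].
    move=> s /andP[ts _]; apply: (le_pmax f_bnd); last exact: us ts.
    apply: le_trans (satB _ _) _; rewrite ler_wpM2l ?(le_trans ler01)//.
    exact: le_supball.
  have -> : t - (t - delta) = delta by ring.
  by rewrite mulrC ler_wpM2r ?pm_ge0.
pose e0 := xi0 0 - z 0 - P xi0 0.
have xiE t : 0 <= t -> xi t = z t + expR (- mu * t) *: e0 + P xi t.
  move=> t0; have [_ _ _ [_ _ [_ _ _ H]]] := facts t t0.
  by apply: H; rewrite t0 lexx.
have e0B : enorm e0 <= E A.
  have -> : e0 = xi0 0 - z 0 - P xi 0.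
    have P0 s : 0 - delta <= s <= 0 -> xi s = xi0 s by rewrite sub0r; exact: xi_le0.
    by rewrite /e0 /P (predF_eq f psi q r u z P0).
  apply: le_trans (enormB _ _) _; apply: lerD; last exact: PB.
  apply: le_trans (enormB _ _) _; rewrite /A -addrA [enorm (z 0) + _]addrC.
  by apply: (le_trans (lerD (xi0B 0 rr) (lexx _))); rewrite lerDr.
have e0mu t : 0 <= t -> enorm (expR (- mu * t) *: e0) <= expR (- mu * t) * E A.
  by move=> t0; rewrite enormZ ger0_norm ?expR_ge0// ler_wpM2l ?expR_ge0.
have expmu t : 0 <= t -> expR (- mu * t) <= 1.
  by move=> t0; rewrite -expR0 ler_expR mulNr oppr_le0 mulr_ge0.
have xiB t : 0 <= t -> enorm (xi t) <= pb A + r * pm (pb A) + E A.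
  move=> t0; rewrite (xiE t t0) addrAC; apply: le_trans (enormD _ _) _; apply: lerD.
    apply: le_trans (enormD _ _) _; apply: lerD; first exact: zpb.
    by apply: PB => //; exact: zpb.
  by apply: le_trans (e0mu t t0) _; rewrite ler_piMl// expmu.
pose H t := enorm (xi t - x (t - r + delta)); pose D t := enorm (z t - x (t - r)).
have HB t : 0 <= t -> 0 <= H t <= Bd A.
  move=> t0; rewrite enorm_ge0/=; apply: le_trans (enormB _ _) _.
  apply: lerD; first exact: xiB.
  by apply/xB/(delayed_time_ge _ t0); rewrite gerBl.
have DB t : 0 <= t -> D t <= pb A + (A + pb A).
  move=> t0; apply: le_trans (enormB _ _) _.
  by apply: lerD; [exact: zpb|apply: xB; rewrite lerDr].
(* All but the last hypothesis are a priori bounds; the last is the one-step inequality after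
   [T2 A]. *)
apply: (@small_gain_estimate _ sigma delta G1 G2 (T2 A) (Bd A) (E A) _ t1 H D) => //.
- exact: Bd_ge0.
- by move=> t /andP[t0 _]; exact: HB.
- by move=> t _; exact: enorm_ge0.
- move=> t /andP[t0 tt1]; apply: ub_le_sup; last by exists t => //=; rewrite in_itv/= t0.
  exists (pb A + (A + pb A)) => _ [s + <-]; rewrite /= in_itv/= => /andP[s0 st].
  apply: le_trans (DB s s0); rewrite ler_piMl ?enorm_ge0//.
  by rewrite -expR0 ler_expR mulNr oppr_le0 mulr_ge0 ?(ltW sigma_gt0)// subr_ge0.

(* Comparison of the two window integrals *)
move=> t N /andP[t0 tt1] T2t N0 HN.
have Emu : 0 <= E A / mu by rewrite divr_ge0.
have td : t - delta <= t by rewrite gerBl.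
have times s := entrance_times r0 delta_ge0 delta_le TbA Emu T2t (s := s).
have dtimes s := delayed_entrance_times r0 delta_ge0 delta_le TbA Emu T2t (s := s).
have tr0 : 0 <= t - delta + (delta - r).
  by have [] := dtimes _ (lexx _); rewrite addrA subrK.
have dx' : {ae (@completed_lebesgue_measure R), forall t : R, 0 < t ->
    is_derive t (1 : R) x (f (x t) (u t))}.
  by apply: ae_leb_imply dx _ => s Hs s0; apply: Hs; [exact: ltW|exact: ltry].
have [bX IX] := ode_integral_translate U_compact f_smooth td tr0 u0_val u0_meas
  (fun d => acx d (ltry d)) dx'.
pose X s := f (x (s - r + delta)) (u (s - r + delta)).
pose G s := f (saturate psi q (z t) (xi s)) (u (s - r + delta)).
have XE : (fun s => f (x (s + (delta - r))) (u (s + (delta - r)))) = X.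
  apply/funext => s; rewrite /X; have -> : s - r + delta = s + (delta - r) by ring.
  by [].
rewrite XE in bX IX.
(* The error splits into the observation error, the decaying defect, and the difference of the
   predictor and plant integrals over one and the same window. *)
have -> : H t = enorm ((z t - x (t - r)) + expR (- mu * t) *: e0 +
    (vint G (t - delta) t - vint X (t - delta) t)).
  rewrite /H -IX (xiE t t0).
  have -> : t + (delta - r) = t - r + delta by ring.
  have -> : t - delta + (delta - r) = t - r by ring.
  congr enorm; rewrite -[vint G _ _]/(P xi t).
  move: (P xi t) (z t) (x _) (x _) (_ *: _) => v1 v2 v3 v4 v5.
  by apply/rowP => i; rewrite !mxE; ring.
have a1 : forall y, S y -> enorm y <= set_radius S.
  move=> y Sy; apply: ub_le_sup; last by exists y.
  have [p Sp|C C0 HC] := compact_continuous_bounded S_compact (h := @enorm R n).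
    exact: enorm_continuous.
  by exists C => _ [p Sp <-]; apply: le_trans (ler_norm _) _; exact: HC.
have GX s : t - delta <= s <= t ->
    enorm (G s - X s) <= (G1 * N) * expR (- sigma * s) + (G2 * D t) * cst 1 s.
  move=> /andP[s1 s2]; have [s0 Tbs Es Tbt] := times s s1.
  have [tr Tbtr sr Tbsr tsr] := dtimes s s1.
  have zs : S (z s) by apply: zS => //; exact: le_trans Tz Tbs.
  have zt : S (z t) by apply: zS => //; exact: le_trans Tz Tbt.
  have xs : S (x (s - r + delta)) by apply: xS => //; exact: le_trans Tx Tbsr.
  have xt : S (x (t - r)) by apply: xS => //; exact: le_trans Tx Tbtr.
  have xst : enorm (x (s - r + delta)) <= psi (x (t - r)) by exact: semi.
  (* The three terms of [xi s] match those of the radius: [z s] lies in [S], the integral is at most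
     r p(a), and the defect at most [1]. *)
  have xis : S_tilde f U S psi K r (xi s).
    rewrite /S_tilde /= (xiE s s0) addrAC -[leRHS]addrA [leRHS]addrC.
    apply: le_trans (enormD _ _) _; apply: lerD.
      apply: le_trans (enormD _ _) _; apply: lerD; first exact: a1.
      by apply: PB => //; exact: a1.
    apply: le_trans (e0mu s s0) _.
    (* From exp(mu s) >= 1 + mu s and s >= E / mu, which is why [T2] contains [E / mu]. *)
    have es : E A <= expR (mu * s).
      apply: le_trans (expR_ge1Dx _); apply: (@le_trans _ _ (mu * s)); last
        by rewrite lerDr.
      by rewrite mulrC -ler_pdivrMr.
    have := ler_wpM2l (expR_ge0 (- mu * s)) es.
    by rewrite -expRD mulNr addNr expR0.
  (* The plant state is rewritten as its own saturation with parameter [x (t - r)], so that both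
     integrands have the form required by [G_lipschitz]. *)
  rewrite /G /X -{1}(saturate_id psi_gt0 q_eq1 xst).
  apply: le_trans (G_lipschitz _ _ _ _ _ (us t s t0 s1) xt xs zt xis) _.
  rewrite mulr1 lerD2r -mulrA ler_wpM2l ?(ltW G1_gt0)//.
  by apply: HN; rewrite s0.
have bE : bmeas `[t - delta, t] (fun s => expR (- sigma * s)).
  apply: bmeas_continuous; apply: continuous_subspaceT => s.
  apply: continuous_comp; last exact: continuous_expR.
  by apply: cvgM; [exact: cvg_cst|exact: cvg_id].
have bG : bmeasv `[t - delta, t] G := mP t t0.
have IGX : enorm (vint G (t - delta) t - vint X (t - delta) t) <=
    expR (- sigma * t) * (c * N) + G2 * delta * D t.
  rewrite vintB; [|exact: bG|exact: bX].
  apply: (@le_trans _ _ (itg (fun s => (G1 * N) * expR (- sigma * s) +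
    (G2 * D t) * cst 1 s) (t - delta) t)).
    apply: enorm_vint_le; last exact: GX.
      by apply: bmeasvB; [exact: leb_measurable_itv|exact: bG|exact: bX].
    by apply: bmeas_lin; [exact: leb_measurable_itv|exact: bE|exact: bmeas_cst].
  rewrite itg_lin; [|exact: bE|exact: bmeas_cst].
  rewrite itg_cst// itg_expR ?oppr_eq0 ?gt_eqF//.
  (* Factoring out exp(- sigma t) leaves (exp(sigma delta) - 1) / sigma, which times G1 is [c]. *)
  have -> : expR (- sigma * (t - delta)) = expR (- sigma * t) * expR (sigma * delta).
    by rewrite -expRD; congr expR; ring.
  rewrite /c le_eqVlt; apply/orP; left; apply/eqP.
  by field; rewrite gt_eqF.
apply: le_trans (enormD _ _) _; apply: le_trans (lerD (enormD _ _) IGX) _.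
(* The place where [sigma <= mu] enters: the defect decays at least at the rate [sigma]. *)
have et : expR (- mu * t) * E A <= expR (- sigma * t) * E A.
  by rewrite ler_wpM2r// ler_expR !mulNr lerN2 ler_wpM2r.
apply: le_trans (lerD (lerD (lexx _) (le_trans (e0mu t t0) et)) (lexx _)) _.
by rewrite -/(D t) -/c le_eqVlt; apply/orP; left; apply/eqP; ring.
Qed.
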